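(* Consider the two-way rate-distortion problem with a helper described in the context, where the source triple satisfies the Markov chain $Y-X-Z$. Then the operational achievable region equals the single-letter region: $$\mathcal R^O(D_x,D_z)=\mathcal R(D_x,D_z).$$
   Context: Let $\mathcal X,\mathcal Y,\mathcal Z$ be finite alphabets and let $(X_i,Y_i,Z_i)$, $i=1,2,\dots$, be i.i.d. with distribution $p(x,y,z)$ such that $Y-X-Z$ is a Markov chain, i.e. $p(x,y,z)=p(x,y)p(z|x)$. Let $\hat{\mathcal X},\hat{\mathcal Z}$ be finite reconstruction alphabets and $d_x:\mathcal X\times\hat{\mathcal X}\to[0,\infty)$, $d_z:\mathcal Z\times\hat{\mathcal Z}\to[0,\infty)$ single-letter distortion measures. For positive integers $M_1,M_2,M_3$ write $\mathcal M_j=\{1,\dots,M_j\}$. An $(n,M_1,M_2,M_3,D_x,D_z)$ code consists of a helper encoder $f_1:\mathcal Y^n\to\mathcal M_1$, an encoder $f_2:\mathcal Z^n\times\mathcal M_1\to\mathcal M_2$ at User Z, an encoder $f_3:\mathcal X^n\times\mathcal M_1\times\mathcal M_2\to\mathcal M_3$ at User X, and decoders $g_2:\mathcal X^n\times\mathcal M_1\times\mathcal M_2\to\hat{\mathcal Z}^n$ (at User X) and $g_3:\mathcal Z^n\times\mathcal M_1\times\mathcal M_3\to\hat{\mathcal X}^n$ (at User Z), with $T_1=f_1(Y^n)$, $T_2=f_2(Z^n,T_1)$, $T_3=f_3(X^n,T_1,T_2)$, $\hat Z^n=g_2(X^n,T_1,T_2)$, $\hat X^n=g_3(Z^n,T_1,T_3)$,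 such that $\mathbb E\big[\frac1n\sum_{i=1}^n d_x(X_i,\hat X_i)\big]\le D_x$ and $\mathbb E\big[\frac1n\sum_{i=1}^n d_z(Z_i,\hat Z_i)\big]\le D_z$. A rate triple $(R_1,R_2,R_3)$ is achievable for $(D_x,D_z)$ if for every $\epsilon>0$ and all sufficiently large $n$ there is an $(n,2^{nR_1},2^{nR_2},2^{nR_3},D_x+\epsilon,D_z+\epsilon)$ code. $\mathcal R^O(D_x,D_z)$ is the closure of the set of achievable rate triples. $\mathcal R(D_x,D_z)$ is the set of all $(R_1,R_2,R_3)$ such that $R_1\ge I(Y;U|Z)$, $R_2\ge I(Z;V|U,X)$, $R_3\ge I(X;W|U,V,Z)$ for some finite-alphabet auxiliary random variables $U,V,W$ with joint distribution $p(x,y,z,u,v,w)=p(x,y)p(z|x)p(u|y)p(v|u,z)p(w|u,v,x)$ and some deterministic functions $\hat X(U,W,Z)\in\hat{\mathcal X}$ and $\hat Z(U,V,X)\in\hat{\mathcal Z}$ with $\mathbb E\, d_x(X,\hat X(U,W,Z))\le D_x$ and $\mathbb E\, d_z(Z,\hat Z(U,V,X))\le D_z$. *)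

(* Defs.v *)
From HB Require Import structures.
From mathcomp Require Import all_boot all_order all_algebra.
From mathcomp Require Import all_classical all_reals all_analysis.
Set Implicit Arguments. Unset Strict Implicit. Unset Printing Implicit Defensive.
Import Order.TTheory GRing.Theory Num.Theory.
Import numFieldNormedType.Exports.
Local Open Scope ring_scope.
Local Open Scope classical_set_scope.

Definition is_pmf (R : realType) (T : finType) (p : T -> R) : Prop :=
  (forall t, 0 <= p t) /\ \sum_(t : T) p t = 1.

Definition log2 (R : realType) (x : R) : R := ln x / ln 2.

Definition pushpmf (R : realType) (Om T : finType) (P : Om -> R) (f : Om -> T)
  (t : T) : R := \sum_(w : Om | f w == t) P w.

Definition entropy (R : realType) (Om T : finType) (P : Om -> R) (f : Om -> T) : R :=
  - \sum_(t : T) (if pushpmf P f t == 0 then 0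
                  else pushpmf P f t * log2 (pushpmf P f t)).

Definition cmi (R : realType) (Om TA TB TC : finType) (P : Om -> R)
  (A : Om -> TA) (B : Om -> TB) (C : Om -> TC) : R :=
  entropy P (fun w => (A w, C w)) + entropy P (fun w => (B w, C w))
  - entropy P (fun w => (A w, B w, C w)) - entropy P C.

Definition expect (R : realType) (Om : finType) (P : Om -> R) (g : Om -> R) : R :=
  \sum_(w : Om) P w * g w.

Definition markov_YXZ (R : realType) (X Y Z : finType) (p : X * Y * Z -> R) : Prop :=
  forall x y z,
    p (x, y, z) * (\sum_(y' : Y) \sum_(z' : Z) p (x, y', z'))
    = (\sum_(z' : Z) p (x, y, z')) * (\sum_(y' : Y) p (x, y', z)).

Definition iid_pmf (R : realType) (X Y Z : finType) (p : X * Y * Z -> R) (n : nat)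
  (w : {ffun 'I_n -> X * Y * Z}) : R := \prod_(i < n) p (w i).

Definition xseq (X Y Z : finType) n (w : {ffun 'I_n -> X * Y * Z}) : {ffun 'I_n -> X} :=
  [ffun i => (w i).1.1].
Definition yseq (X Y Z : finType) n (w : {ffun 'I_n -> X * Y * Z}) : {ffun 'I_n -> Y} :=
  [ffun i => (w i).1.2].
Definition zseq (X Y Z : finType) n (w : {ffun 'I_n -> X * Y * Z}) : {ffun 'I_n -> Z} :=
  [ffun i => (w i).2].

Definition avg_dist (R : realType) (A B : finType) (d : A -> B -> R) n
  (a : {ffun 'I_n -> A}) (b : {ffun 'I_n -> B}) : R :=
  n%:R^-1 * \sum_(i < n) d (a i) (b i).

Definition code_exists (R : realType) (X Y Z Xh Zh : finType) (p : X * Y * Z -> R)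
  (dx : X -> Xh -> R) (dz : Z -> Zh -> R) (n M1 M2 M3 : nat) (Dx Dz : R) : Prop :=
  exists (f1 : {ffun 'I_n -> Y} -> 'I_M1)
         (f2 : {ffun 'I_n -> Z} -> 'I_M1 -> 'I_M2)
         (f3 : {ffun 'I_n -> X} -> 'I_M1 -> 'I_M2 -> 'I_M3)
         (g2 : {ffun 'I_n -> X} -> 'I_M1 -> 'I_M2 -> {ffun 'I_n -> Zh})
         (g3 : {ffun 'I_n -> Z} -> 'I_M1 -> 'I_M3 -> {ffun 'I_n -> Xh}),
    let T1 w := f1 (yseq w) in
    let T2 w := f2 (zseq w) (T1 w) in
    let T3 w := f3 (xseq w) (T1 w) (T2 w) in
    let Zhat w := g2 (xseq w) (T1 w) (T2 w) in
    let Xhat w := g3 (zseq w) (T1 w) (T3 w) in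
    expect (@iid_pmf _ _ _ _ p n) (fun w => avg_dist dx (xseq w) (Xhat w)) <= Dx /\
    expect (@iid_pmf _ _ _ _ p n) (fun w => avg_dist dz (zseq w) (Zhat w)) <= Dz.

Definition achievable (R : realType) (X Y Z Xh Zh : finType) (p : X * Y * Z -> R)
  (dx : X -> Xh -> R) (dz : Z -> Zh -> R) (Dx Dz : R) (r : R * R * R) : Prop :=
  forall eps : R, 0 < eps ->
  exists N : nat, forall n : nat, (N <= n)%N ->
  exists M1 M2 M3 : nat,
    [/\ M1%:R <= (2:R) `^ (n%:R * r.1.1),
        M2%:R <= (2:R) `^ (n%:R * r.1.2),
        M3%:R <= (2:R) `^ (n%:R * r.2) &
        code_exists p dx dz n M1 M2 M3 (Dx + eps) (Dz + eps)].

Definition RO (R : realType) (X Y Z Xh Zh : finType) (p : X * Y * Z -> R)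
  (dx : X -> Xh -> R) (dz : Z -> Zh -> R) (Dx Dz : R) : set (R * R * R) :=
  @closure ((R : realType) * (R : realType) * (R : realType))%type [set r | achievable p dx dz Dx Dz r].

Definition aux_pmf (R : realType) (X Y Z U V W : finType) (p : X * Y * Z -> R)
  (qu : Y -> U -> R) (qv : U -> Z -> V -> R) (qw : U -> V -> X -> W -> R)
  (o : X * Y * Z * U * V * W) : R :=
  let: (x, y, z, u, v, w) := o in p (x, y, z) * qu y u * qv u z v * qw u v x w.

Definition region (R : realType) (X Y Z Xh Zh : finType) (p : X * Y * Z -> R)
  (dx : X -> Xh -> R) (dz : Z -> Zh -> R) (Dx Dz : R) : set (R * R * R) :=
  [set r | exists (U V W : finType)
     (qu : Y -> U -> R) (qv : U -> Z -> V -> R) (qw : U -> V -> X -> W -> R)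
     (xh : U -> W -> Z -> Xh) (zh : U -> V -> X -> Zh),
     let P := aux_pmf p qu qv qw in
     let oX (o : X * Y * Z * U * V * W) := o.1.1.1.1.1 in
     let oY (o : X * Y * Z * U * V * W) := o.1.1.1.1.2 in
     let oZ (o : X * Y * Z * U * V * W) := o.1.1.1.2 in
     let oU (o : X * Y * Z * U * V * W) := o.1.1.2 in
     let oV (o : X * Y * Z * U * V * W) := o.1.2 in
     let oW (o : X * Y * Z * U * V * W) := o.2 in
     (forall y, is_pmf (qu y)) /\
     (forall u z, is_pmf (qv u z)) /\
     (forall u v x, is_pmf (qw u v x)) /\
     cmi P oY oU oZ <= r.1.1 /\
     cmi P oZ oV (fun o => (oU o, oX o)) <= r.1.2 /\
     cmi P oX oW (fun o => (oU o, oV o, oZ o)) <= r.2 /\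
     expect P (fun o => dx (oX o) (xh (oU o) (oW o) (oZ o))) <= Dx /\
     expect P (fun o => dz (oZ o) (zh (oU o) (oV o) (oX o))) <= Dz].

(* Main.v *)
Require Import Defs.
From HB Require Import structures.
From mathcomp Require Import all_boot all_order all_algebra.
From mathcomp Require Import all_classical all_reals all_analysis.
From mathcomp Require Import ring lra.
Set Implicit Arguments. Unset Strict Implicit. Unset Printing Implicit Defensive.
Import Order.TTheory GRing.Theory Num.Theory.
Import numFieldNormedType.Exports.
Local Open Scope ring_scope.

(** Achievability: each auxiliary variable is transmitted by a random hash of its whole
    alphabet into [F * M] bins.  The encoder samples from its kernel restricted to the bins
    with first index 0 and sends the second index; the decoder samples from its posterior
    restricted to the announced bin.  Jensen's inequality for [1 / (s1 s2 s3)] applied to the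
    random normalisation constants shows that, on average over the hash, every tuple
    [(x, y, z, u, v, w)] for which [F] is small compared with [1 / q(u|y)] and [F M] is large
    compared with [1 / P(u|z)] is produced, and correctly decoded, with nearly its ideal
    probability.  So neither typicality encoding nor a Markov lemma is needed: all
    randomisation can be frozen because the success probability is linear in each kernel, and
    Chebyshev's inequality makes the thresholds hold with high probability for long blocks.

    Converse: take a uniform time index [i], [U = (i, T1, X^(i-1), Z_(i+1)^n)], [V = T2] and
    [W = (T2, T3)].  All conditional independences come from one observation: exchanging the
    letters [z_1 .. z_k] of two source words that agree on [x_1 .. x_k] preserves the product
    of their probabilities.  In general [Y] is not independent of [W] given [(U, V, X)], but
    [region] only sees the laws of [(X, Y, Z, U, V)] and of [(X, Z, U, V, W)].

    Closedness of the single-letter region: every rate and distortion is a sum, over the values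
    of an auxiliary variable, of a function positively homogeneous in the corresponding column
    of its kernel, so Caratheodory's theorem bounds the alphabets, and kernels on fixed
    alphabets form a compact set on which the functionals are continuous. *)

(** * Marginals, entropy and conditional independence *)

(** The helper's message must serve both users at the single rate [I(Y;U|Z)]. A hash stage therefore
    carries two decoder posteriors besides the encoder kernel, which is where three normalisation
    constants come from. The Markov hypothesis makes X at least as good as Z as side information
    about U, so bins that suffice for User Z suffice for User X. User Z recomputes V from its own
    source word, hence its decoder for W may take V as known. An obstacle in the converse and in the
    cardinality bound is that the reconstruction [xh] sees [(U, W, Z)] but not V. So W has to repeat
    what V tells: it contains [T2] in the converse and a copy of the index of V in the reduced
    alphabets. The copy is free, because the third rate is conditioned on V. A code of fixed length
    only yields a point of the region with enlarged distortions, and the closure perturbs the rates.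
    One passage to the limit absorbs both slacks. *)

Section Log2.
Variable R : realType.
Implicit Types x y : R.

Lemma ln2_gt0 : 0 < ln (2 : R).
Proof. by apply: ln_gt0; rewrite ltr1n. Qed.

Lemma log2M x y : 0 < x -> 0 < y -> log2 (x * y) = log2 x + log2 y.
Proof. by move=> x0 y0; rewrite /log2 lnM ?posrE // mulrDl. Qed.

Lemma log2V x : 0 < x -> log2 x^-1 = - log2 x.
Proof. by move=> x0; rewrite /log2 lnV ?posrE // mulNr. Qed.

Lemma log2_div x y : 0 < x -> 0 < y -> log2 (x / y) = log2 x - log2 y.
Proof. by move=> x0 y0; rewrite log2M ?invr_gt0 // log2V. Qed.

Lemma log2_1 : log2 (1 : R) = 0.
Proof. by rewrite /log2 ln1 mul0r. Qed.

Lemma log2_pow2 x : log2 (2 `^ x) = x.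
Proof. by rewrite /log2 ln_powR mulfK // gt_eqF // ln2_gt0. Qed.

Lemma pow2_log2 x : 0 < x -> 2 `^ (log2 x) = x.
Proof.
move=> x0; rewrite /powR pnatr_eq0 /= /log2 divfK ?lnK ?posrE //.
by rewrite gt_eqF // ln2_gt0.
Qed.

Lemma ler_log2 x y : 0 < x -> x <= y -> log2 x <= log2 y.
Proof.
move=> x0 xy; rewrite /log2 ler_pM2r ?invr_gt0 ?ln2_gt0 // ler_ln ?posrE //.
exact: lt_le_trans xy.
Qed.

Lemma log2_le_sub1 x : 0 < x -> log2 x <= (x - 1) / ln 2.
Proof.
move=> x0; rewrite /log2 ler_pM2r ?invr_gt0 ?ln2_gt0 //.
by have := @le_ln1Dx _ (x - 1); rewrite addrCA subrr addr0; apply; lra.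
Qed.

End Log2.

Section Pushforward.
Variable R : realType.

Lemma pushpmf_ge0 (Om T : finType) (P : Om -> R) (f : Om -> T) t :
  (forall w, 0 <= P w) -> 0 <= pushpmf P f t.
Proof. by move=> P0; apply: sumr_ge0. Qed.

Lemma sum_pushpmf (Om T : finType) (P : Om -> R) (f : Om -> T) (g : T -> R) :
  \sum_t pushpmf P f t * g t = \sum_w P w * g (f w).
Proof.
rewrite (partition_big f xpredT) //=; apply: eq_bigr => t _.
by rewrite /pushpmf mulr_suml; apply: eq_bigr => w /eqP <-.
Qed.

Lemma sum_pushpmf1 (Om T : finType) (P : Om -> R) (f : Om -> T) :
  \sum_t pushpmf P f t = \sum_w P w.
Proof.
have := sum_pushpmf P f (fun=> 1).
by under eq_bigr do rewrite mulr1; under [in RHS]eq_bigr do rewrite mulr1.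
Qed.

Lemma pushpmf_comp (Om S T : finType) (P : Om -> R) (f : Om -> S) (g : S -> T) t :
  pushpmf P (fun w => g (f w)) t = pushpmf (pushpmf P f) g t.
Proof.
rewrite {1}/pushpmf {1}/pushpmf (partition_big f (fun s => g s == t)) //=.
apply: eq_bigr => s gs; rewrite /pushpmf; apply: eq_bigl => w.
by have [->|] := eqVneq (f w) s; rewrite ?gs ?andbF.
Qed.

Lemma pushpmf_fst (A B : finType) (P : A * B -> R) a :
  pushpmf P fst a = \sum_b P (a, b).
Proof.
rewrite /pushpmf (eq_bigr (fun w => P (w.1, w.2))) => [|[a' b] _ //].
rewrite (eq_bigl (fun w : A * B => (w.1 == a) && true)) => [|w]; last by rewrite andbT.
by rewrite -(pair_big (fun a' => a' == a) xpredT (fun a b => P (a, b))) /= big_pred1_eq.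
Qed.

Lemma sum_pushpmf_pair (Om A B : finType) (P : Om -> R) (f : Om -> A) (g : Om -> B) b :
  \sum_a pushpmf P (fun w => (f w, g w)) (a, b) = pushpmf P g b.
Proof.
rewrite /pushpmf (partition_big f xpredT) //=; apply: eq_bigr => a _.
by apply: eq_bigl => w; rewrite xpair_eqE andbC.
Qed.

Lemma pushpmf_inj (Om S T : finType) (P : Om -> R) (f : Om -> S) (g : S -> T) s :
  injective g -> pushpmf P (fun w => g (f w)) (g s) = pushpmf P f s.
Proof. by move=> ig; apply: eq_bigl => w; rewrite inj_eq. Qed.

Lemma pushpmf_self_ge (Om T : finType) (P : Om -> R) (f : Om -> T) w :
  (forall w, 0 <= P w) -> P w <= pushpmf P f (f w).
Proof.
move=> P0; rewrite /pushpmf (bigD1 w) //= lerDl; exact: sumr_ge0.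
Qed.

Lemma pushpmf_gt0 (Om T : finType) (P : Om -> R) (f : Om -> T) w :
  (forall w, 0 <= P w) -> 0 < P w -> 0 < pushpmf P f (f w).
Proof. by move=> P0 Pw; apply: lt_le_trans (pushpmf_self_ge f w P0). Qed.

Lemma pushpmf_eq_at (Om S T : finType) (P : Om -> R) (f : Om -> S) (g : Om -> T) w :
  (forall w', (f w' == f w) = (g w' == g w)) -> pushpmf P f (f w) = pushpmf P g (g w).
Proof. by move=> fg; apply: eq_bigl. Qed.

Lemma expect_push (Om T : finType) (P : Om -> R) (f : Om -> T) (h : T -> R) :
  expect P (fun w => h (f w)) = expect (pushpmf P f) h.
Proof. by rewrite /expect sum_pushpmf. Qed.

(** Summing over outcomes instead of values removes the guard against null values, which carry no
    weight. *)
Lemma entropyE (Om T : finType) (P : Om -> R) (f : Om -> T) :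
  entropy P f = - \sum_w P w * log2 (pushpmf P f (f w)).
Proof.
rewrite /entropy -(sum_pushpmf P f (fun t => log2 (pushpmf P f t))).
by congr (- _); apply: eq_bigr => t _; case: eqP => // ->; rewrite mul0r.
Qed.

(** Entropy sees only the partition of the outcomes, so tuples can be reordered, re-encoded or freed
    of redundant components. *)
Lemma entropy_eqrel (Om S T : finType) (P : Om -> R) (f : Om -> S) (g : Om -> T) :
  (forall w w', (f w == f w') = (g w == g w')) -> entropy P f = entropy P g.
Proof.
move=> fg; rewrite !entropyE; congr (- _); apply: eq_bigr => w _.
by rewrite (pushpmf_eq_at P (g := g)).
Qed.

Lemma entropy_law (Om Om' T : finType) (P : Om -> R) (P' : Om' -> R)
    (f : Om -> T) (f' : Om' -> T) :
  pushpmf P f =1 pushpmf P' f' -> entropy P f = entropy P' f'.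
Proof. by move=> E; rewrite /entropy; under eq_bigr do rewrite E. Qed.

(** Averages [log2 h <= (h - 1) / ln 2]. With [h] a likelihood ratio it gives the cardinality bound
    on entropy, the nonnegativity of information and the comparison of the two decoders of U. *)
Lemma gibbs (O : finType) (P h : O -> R) :
  (forall o, 0 <= P o) -> (forall o, 0 < P o -> 0 < h o) ->
  \sum_o P o * h o <= \sum_o P o -> \sum_o P o * log2 (h o) <= 0.
Proof.
move=> P0 h0 le; apply: (@le_trans _ _ (\sum_o P o * ((h o - 1) / ln 2))).
  apply: ler_sum => o _; have := P0 o; rewrite le0r => /orP[/eqP->|Po].
    by rewrite !mul0r.
  by rewrite ler_wpM2l ?P0 // log2_le_sub1 // h0.
under eq_bigr do rewrite mulrA; rewrite -mulr_suml pmulr_lle0 ?invr_gt0 ?ln2_gt0 //.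
by under eq_bigr do rewrite mulrBr mulr1; rewrite sumrB subr_le0.
Qed.

Lemma pmf_inhabited (T : finType) (P : T -> R) : is_pmf P -> exists t : T, 0 < P t.
Proof.
move=> [P0 P1]; have [t Pt|no] := pickP (fun t => 0 < P t); first by exists t.
have : \sum_t P t = 0.
  by apply: big1 => t _; apply/eqP; move: (no t); rewrite lt0r P0 andbT => /negbFE.
by rewrite P1 => /eqP; rewrite oner_eq0.
Qed.

Lemma entropy_le_card (Om T : finType) (P : Om -> R) (f : Om -> T) :
  is_pmf P -> entropy P f <= log2 #|T|%:R.
Proof.
move=> Ppmf; have [P0 P1] := Ppmf; rewrite entropyE.
have T0 : 0 < #|T|%:R :> R.
  have [w _] := pmf_inhabited Ppmf.
  by rewrite ltr0n; apply/card_gt0P; exists (f w).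
have -> : log2 #|T|%:R = \sum_w P w * log2 (#|T|%:R : R) by rewrite -mulr_suml P1 mul1r.
rewrite -subr_le0 -opprD -big_split /= -sumrN.
rewrite (eq_bigr (fun w => P w * log2 (pushpmf P f (f w) * #|T|%:R)^-1)); last first.
  move=> w _; have := P0 w; rewrite le0r => /orP[/eqP->|Pw].
    by rewrite !mul0r addr0 oppr0.
  have q0 := pushpmf_gt0 f P0 Pw.
  by rewrite log2V ?mulr_gt0 // log2M // -mulrDr mulrN.
apply: gibbs => // [w Pw|].
  by rewrite invr_gt0 mulr_gt0 // pushpmf_gt0.
rewrite -(sum_pushpmf P f (fun t => (pushpmf P f t * #|T|%:R)^-1)) P1.
apply: (@le_trans _ _ (\sum_(t : T) #|T|%:R^-1)).
  apply: ler_sum => t _; rewrite invfM.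
  have [->|q0] := eqVneq (pushpmf P f t) 0; first by rewrite mul0r invr_ge0 ltW.
  by rewrite mulrA mulfV // mul1r.
by rewrite sumr_const -[_ *+ _]mulr_natl mulfV // gt_eqF.
Qed.

Lemma cmiE (Om TA TB TC : finType) (P : Om -> R)
    (A : Om -> TA) (B : Om -> TB) (C : Om -> TC) :
  (forall w, 0 <= P w) ->
  cmi P A B C = \sum_w P w *
    log2 (pushpmf P (fun w => (A w, B w, C w)) (A w, B w, C w) * pushpmf P C (C w)
       / (pushpmf P (fun w => (A w, C w)) (A w, C w)
          * pushpmf P (fun w => (B w, C w)) (B w, C w))).
Proof.
move=> P0; rewrite /cmi !entropyE -!sumrN -!big_split /=; apply: eq_bigr => w _.
have := P0 w; rewrite le0r => /orP[/eqP->|Pw]; first by rewrite !mul0r; lra.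
have q0 (T : finType) (f : Om -> T) : 0 < pushpmf P f (f w) by exact: pushpmf_gt0.
have q1 := q0 _ (fun w => (A w, B w, C w)); have q2 := q0 _ C.
have q3 := q0 _ (fun w => (A w, C w)); have q4 := q0 _ (fun w => (B w, C w)).
by rewrite log2_div ?mulr_gt0 // !log2M //; lra.
Qed.

Lemma cmi_ge0 (Om TA TB TC : finType) (P : Om -> R)
    (A : Om -> TA) (B : Om -> TB) (C : Om -> TC) :
  (forall w, 0 <= P w) -> 0 <= cmi P A B C.
Proof.
move=> P0; rewrite cmiE // -oppr_le0 -sumrN.
pose ABC := pushpmf P (fun w => (A w, B w, C w)).
pose AC := pushpmf P (fun w => (A w, C w)).
pose BC := pushpmf P (fun w => (B w, C w)).
pose h (t : TA * TB * TC) :=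
  AC (t.1.1, t.2) * BC (t.1.2, t.2) / (ABC t * pushpmf P C t.2).
have q0 (T : finType) (f : Om -> T) w : 0 < P w -> 0 < pushpmf P f (f w).
  exact: pushpmf_gt0.
rewrite (eq_bigr (fun w => P w * log2 (h (A w, B w, C w)))); last first.
  move=> w _; have := P0 w; rewrite le0r => /orP[/eqP->|Pw]; first by rewrite !mul0r oppr0.
  have q1 := q0 _ (fun w => (A w, B w, C w)) _ Pw; have q2 := q0 _ C _ Pw.
  have q3 := q0 _ (fun w => (A w, C w)) _ Pw; have q4 := q0 _ (fun w => (B w, C w)) _ Pw.
  by rewrite -mulrN -log2V ?divr_gt0 ?mulr_gt0 // invf_div.
apply: gibbs => // [w Pw|].
  have q1 := q0 _ (fun w => (A w, B w, C w)) _ Pw; have q2 := q0 _ C _ Pw.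
  have q3 := q0 _ (fun w => (A w, C w)) _ Pw; have q4 := q0 _ (fun w => (B w, C w)) _ Pw.
  by rewrite divr_gt0 // mulr_gt0.
rewrite -(sum_pushpmf P (fun w => (A w, B w, C w)) h) -(sum_pushpmf1 P C).
(* [g] makes [A] and [B] independent given [C] with the same pair marginals; its mass over each [c]
   is at most that of [C]. *)
pose g (t : TA * TB * TC) := AC (t.1.1, t.2) * BC (t.1.2, t.2) / pushpmf P C t.2.
apply: (@le_trans _ _ (\sum_t g t)).
  apply: ler_sum => t _; rewrite -/(ABC t) /h /g.
  have [->|n0] := eqVneq (ABC t) 0.
    by rewrite mul0r divr_ge0 ?mulr_ge0 ?pushpmf_ge0.
  by rewrite [in leLHS]invfM mulrCA mulVKf.
rewrite -(pair_bigA _ (fun ab c => g (ab, c))) /= exchange_big /=.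
apply: ler_sum => c _; rewrite -(pair_bigA _ (fun a b => g (a, b, c))) /= /g /=.
under eq_bigr do rewrite -mulr_suml -mulr_sumr.
rewrite -!mulr_suml /AC /BC !sum_pushpmf_pair.
have [->|n0] := eqVneq (pushpmf P C c) 0; first by rewrite !mul0r.
by rewrite mulfK.
Qed.

(** The cross-multiplied form needs no care with null events and turns both sides into sums over
    pairs of outcomes. *)
Definition cind (Om TA TB TC : finType) (P : Om -> R)
    (A : Om -> TA) (B : Om -> TB) (C : Om -> TC) : Prop :=
  forall a b c, pushpmf P (fun w => (A w, B w, C w)) (a, b, c) * pushpmf P C c
    = pushpmf P (fun w => (A w, C w)) (a, c) * pushpmf P (fun w => (B w, C w)) (b, c).

Lemma cind_cmi0 (Om TA TB TC : finType) (P : Om -> R)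
    (A : Om -> TA) (B : Om -> TB) (C : Om -> TC) :
  (forall w, 0 <= P w) -> cind P A B C -> cmi P A B C = 0.
Proof.
move=> P0 ci; rewrite cmiE // big1 // => w _.
have := P0 w; rewrite le0r => /orP[/eqP->|Pw]; first by rewrite mul0r.
rewrite ci divff ?log2_1 ?mulr0 //.
by rewrite gt_eqF // mulr_gt0 //; [move: (pushpmf_gt0 (fun w => (A w, C w)) P0 Pw)
  | move: (pushpmf_gt0 (fun w => (B w, C w)) P0 Pw)].
Qed.

(* Exchanging the A-part of two outcomes with equal C-part is a measure-preserving
   involution of pairs of outcomes; it maps (ABC, C) pairs to (AC, BC) pairs. *)
Lemma cind_swap (Om TA TB TC : finType) (P : Om -> R)
    (A : Om -> TA) (B : Om -> TB) (C : Om -> TC) (m : Om -> Om -> Om) :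
  (forall w w', C w = C w' ->
    [/\ P (m w w') * P (m w' w) = P w * P w',
        A (m w w') = A w, B (m w w') = B w', C (m w w') = C w
      & m (m w w') (m w' w) = w]) ->
  cind P A B C.
Proof.
move=> H a b c; rewrite /pushpmf !big_distrlr /= !pair_big /=.
pose s (t : Om * Om) := if C t.1 == C t.2 then (m t.1 t.2, m t.2 t.1) else t.
have sK : involutive s.
  move=> [w w']; rewrite /s /=; case: (eqVneq (C w) (C w')) => [E|/negPf E]; last by rewrite /= E.
  have [_ _ _ E1 E2] := H _ _ E; have [_ _ _ E3 E4] := H _ _ (esym E).
  by rewrite /= E1 E3 E eqxx E2 E4.
rewrite (reindex_inj (inv_inj sK)) /=; apply: eq_big => [[w w']|[w w']] /=; last first.
  rewrite /s /=; case: (eqVneq (C w) (C w')) => //= E _.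
  by have [-> _ _ _ _] := H _ _ E.
rewrite /s /= !xpair_eqE; case: (eqVneq (C w) (C w')) => [E|n] /=.
  have [_ -> -> -> _] := H _ _ E; have [_ _ _ -> _] := H _ _ (esym E).
  by rewrite E; case: (A w == a); case: (B w' == b); case: (C w' == c).
case: (eqVneq (C w) c) n => [->|_ _]; last by rewrite !andbF.
by rewrite eq_sym => /negPf->; rewrite !andbF.
Qed.

(* A has conditional law k given (B, C), where k only looks at C *)
Definition kernel_of (Om TA TB TC : finType) (P : Om -> R)
    (A : Om -> TA) (B : Om -> TB) (C : Om -> TC) (k : TC -> TA -> R) : Prop :=
  forall a b c, pushpmf P (fun w => (A w, B w, C w)) (a, b, c)
    = pushpmf P (fun w => (B w, C w)) (b, c) * k c a.

(* Conditioning on a null value of C yields the point mass at a0. *)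
Definition condk (Om TA TC : finType) (P : Om -> R) (A : Om -> TA) (C : Om -> TC)
    (a0 : TA) (c : TC) (a : TA) : R :=
  if pushpmf P C c == 0 then (a == a0)%:R
  else pushpmf P (fun w => (A w, C w)) (a, c) / pushpmf P C c.

Lemma is_pmf_delta (T : finType) (t0 : T) : is_pmf (fun t => (t == t0)%:R : R).
Proof.
split=> [t|]; first exact: ler0n.
by rewrite (bigD1 t0) //= eqxx big1 ?addr0 // => t /negPf->.
Qed.

Lemma condk_pmf (Om TA TC : finType) (P : Om -> R) (A : Om -> TA) (C : Om -> TC) a0 c :
  (forall w, 0 <= P w) -> is_pmf (condk P A C a0 c).
Proof.
move=> P0; rewrite /condk /is_pmf; case: eqP => [_|/eqP n]; first exact: is_pmf_delta.
split=> [a|]; first by rewrite divr_ge0 ?pushpmf_ge0.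
by rewrite -mulr_suml sum_pushpmf_pair mulfV.
Qed.

Lemma push_le_push2 (Om TB TC : finType) (P : Om -> R) (B : Om -> TB) (C : Om -> TC) b c :
  (forall w, 0 <= P w) -> pushpmf P (fun w => (B w, C w)) (b, c) <= pushpmf P C c.
Proof.
move=> P0; rewrite -(sum_pushpmf_pair P B C c) (bigD1 b) //= lerDl.
by apply: sumr_ge0 => b' _; exact: pushpmf_ge0.
Qed.

(** Over a null [c] both joint probabilities vanish, so the default value of [condk] is harmless. *)
Lemma cind_kernel (Om TA TB TC : finType) (P : Om -> R)
    (A : Om -> TA) (B : Om -> TB) (C : Om -> TC) a0 :
  (forall w, 0 <= P w) -> cind P A B C -> kernel_of P A B C (condk P A C a0).
Proof.
move=> P0 ci a b c; rewrite /condk; case: eqP => [E|/eqP n]; last first.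
  by apply/(mulIf n); rewrite ci mulrC -mulrA divfK.
have z (T : finType) (f : Om -> T) t : pushpmf P (fun w => (f w, C w)) (t, c) = 0.
  by apply/eqP; rewrite eq_le pushpmf_ge0 // andbT -[leRHS]E push_le_push2.
by rewrite z mul0r; exact: (z _ (fun w => (A w, B w)) (a, b)).
Qed.

Lemma kernel_of_fun (Om TA TB TB' TC : finType) (P : Om -> R)
    (A : Om -> TA) (B : Om -> TB) (C : Om -> TC) k (f : TB -> TC -> TB') :
  kernel_of P A B C k -> kernel_of P A (fun w => f (B w) (C w)) C k.
Proof.
move=> H a b' c.
have E1 : pushpmf P (fun w => (A w, f (B w) (C w), C w)) (a, b', c) =
  \sum_(b | f b c == b') pushpmf P (fun w => (A w, B w, C w)) (a, b, c).
  rewrite {1}/pushpmf (partition_big B (fun b => f b c == b')) /=; last first.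
    by move=> w; rewrite !xpair_eqE => /andP[/andP[_ /eqP<-] /eqP->].
  apply: eq_bigr => b /eqP <-; apply: eq_bigl => w; rewrite !xpair_eqE.
  case: (eqVneq (C w) c) => [->|_]; last by rewrite !andbF.
  by case: (eqVneq (B w) b) => [->|_]; rewrite ?eqxx ?andbT ?andbF.
have E2 : pushpmf P (fun w => (f (B w) (C w), C w)) (b', c) =
  \sum_(b | f b c == b') pushpmf P (fun w => (B w, C w)) (b, c).
  rewrite {1}/pushpmf (partition_big B (fun b => f b c == b')) /=; last first.
    by move=> w; rewrite !xpair_eqE => /andP[/eqP<- /eqP->].
  apply: eq_bigr => b /eqP <-; apply: eq_bigl => w; rewrite !xpair_eqE.
  case: (eqVneq (C w) c) => [->|_]; last by rewrite !andbF.
  by case: (eqVneq (B w) b) => [->|_]; rewrite ?eqxx ?andbT ?andbF.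
by rewrite E1 E2 mulr_suml; apply: eq_bigr => b _; rewrite H.
Qed.

(** The joint probability of [(A, C)] cancels, leaving the kernel against the posterior of [B] given
    [C]. [D] selects the part of [(A, C)] that the kernel reads. *)
Lemma cmi_kernelE (Om TA TB TC : finType) (P : Om -> R)
    (A : Om -> TA) (B : Om -> TB) (C : Om -> TC) (TD : finType) (D : TA -> TC -> TD)
    (k : TD -> TB -> R) :
  (forall w, 0 <= P w) ->
  (forall w, 0 < P w -> pushpmf P (fun w => (A w, B w, C w)) (A w, B w, C w)
    = pushpmf P (fun w => (A w, C w)) (A w, C w) * k (D (A w) (C w)) (B w)) ->
  cmi P A B C = \sum_w P w * log2 (k (D (A w) (C w)) (B w) * pushpmf P C (C w)
       / pushpmf P (fun w => (B w, C w)) (B w, C w)).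
Proof.
move=> P0 H; rewrite cmiE //; apply: eq_bigr => w _.
have := P0 w; rewrite le0r => /orP[/eqP->|Pw]; first by rewrite !mul0r.
have q3 := pushpmf_gt0 (fun w => (A w, C w)) P0 Pw.
congr (_ * log2 _); rewrite H // invfM -!mulrA mulrC -!mulrA [X in _ * (_ * X)]mulrC.
by rewrite mulfK ?gt_eqF.
Qed.

Lemma derand_pick (B : finType) (k c : B -> R) :
  is_pmf k -> exists b, \sum_b k b * c b <= c b.
Proof.
move=> kp; have [b0 _] := pmf_inhabited kp; have [k0 k1] := kp.
have [b _ /= bmax] := @arg_maxP _ _ B b0 xpredT c isT.
exists b; rewrite -[leRHS]mul1r -k1 mulr_suml; apply: ler_sum => b' _.
by rewrite ler_wpM2l // bmax.
Qed.

(** The sum is linear in every row of [k], and different rows meet disjoint sets of outcomes, so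
    each row can be replaced by its best point mass separately. *)
Lemma derand (O A B : finType) (g : O -> R) (al : O -> A) (be : O -> B) (k : A -> B -> R) :
  (forall a, is_pmf (k a)) ->
  exists f : A -> B, \sum_o g o * k (al o) (be o) <= \sum_o g o * (f (al o) == be o)%:R.
Proof.
move=> kp; pose c a b : R := \sum_(o | (al o == a) && (be o == b)) g o.
have /choice[f Hf] a := derand_pick (c a) (kp a).
exists f; rewrite (partition_big al xpredT) //= [leRHS](partition_big al xpredT) //=.
apply: ler_sum => a _; apply: le_trans (le_trans (Hf a) _); rewrite le_eqVlt; apply/orP; left; apply/eqP.
  rewrite (partition_big be xpredT) //=; apply: eq_bigr => b _.
  by rewrite /c mulr_sumr; apply: eq_bigr => o /andP[/eqP-> /eqP->]; rewrite mulrC.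
rewrite /c [RHS]big_mkcond [LHS]big_mkcond; apply: eq_bigr => o _.
case: (eqVneq (al o) a) => //= ->; rewrite eq_sym.
by case: (f a == be o); rewrite ?mulr1 ?mulr0.
Qed.

End Pushforward.

(** * One-shot coding by random hashing *)

Section ProductMeasure.
Variable R : realType.

Lemma prod_expect (I B : finType) (q : B -> R) (g : I -> B -> R) :
  \sum_(w : {ffun I -> B}) (\prod_i q (w i)) * (\prod_i g i (w i))
  = \prod_i \sum_b q b * g i b.
Proof.
rewrite bigA_distr_bigA /=; apply: eq_bigr => w _.
by rewrite -big_split.
Qed.

Lemma prod_pmf (I B : finType) (q : B -> R) :
  is_pmf q -> is_pmf (fun w : {ffun I -> B} => \prod_i q (w i)).
Proof.
move=> [q0 q1]; split=> [w|]; first by apply: prodr_ge0.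
rewrite -(bigA_distr_bigA (fun _ b => q b)) /=.
by apply: big1 => i _.
Qed.

Lemma prod_kernel_pmf (I A B : finType) (k : A -> B -> R) (a : {ffun I -> A}) :
  (forall a, is_pmf (k a)) -> is_pmf (fun b : {ffun I -> B} => \prod_i k (a i) (b i)).
Proof.
move=> kp; split=> [b|]; first by apply: prodr_ge0 => i _; have [] := kp (a i).
rewrite -(bigA_distr_bigA (fun i b => k (a i) b)) /=.
by apply: big1 => i _; have [] := kp (a i).
Qed.

Lemma prod_at (I B : finType) (g : B -> R) (w : {ffun I -> B}) i0 :
  \prod_i (if i == i0 then g (w i) else 1) = g (w i0).
Proof. by rewrite -big_mkcond big_pred1_eq. Qed.

Lemma prod_expect1 (I B : finType) (q g : B -> R) (i0 : I) : is_pmf q ->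
  \sum_(w : {ffun I -> B}) (\prod_i q (w i)) * g (w i0) = \sum_b q b * g b.
Proof.
move=> [q0 q1]; under eq_bigr => w _ do rewrite -(prod_at g w i0).
rewrite (prod_expect q (fun i b => if i == i0 then g b else 1)) (bigD1 i0) //= eqxx.
rewrite [X in _ * X]big1 ?mulr1 // => i /negPf->.
by under eq_bigr do rewrite mulr1.
Qed.

Lemma prod_expect2 (I B : finType) (q g k : B -> R) (i0 j0 : I) : is_pmf q -> i0 != j0 ->
  \sum_(w : {ffun I -> B}) (\prod_i q (w i)) * (g (w i0) * k (w j0))
  = (\sum_b q b * g b) * (\sum_b q b * k b).
Proof.
move=> [q0 q1] ij; under eq_bigr => w _ do rewrite -(prod_at g w i0) -(prod_at k w j0) -big_split /=.
rewrite (prod_expect q (fun i b => (if i == i0 then g b else 1) * (if i == j0 then k b else 1))).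
rewrite (bigD1 i0) //= (bigD1 j0) /=; last by rewrite eq_sym.
rewrite eqxx (negPf ij) eq_sym (negPf ij) eqxx.
rewrite [X in _ * (_ * X)]big1 ?mulr1 => [|i /andP[/negPf-> /negPf->]]; last first.
  by under eq_bigr do rewrite !mulr1.
by congr (_ * _); apply: eq_bigr => b _; rewrite ?mulr1 ?mul1r.
Qed.

End ProductMeasure.

Section Renormalize.
Variable R : realType.

(** Falling back on [a] when [S] is null keeps this a probability law for every hash. *)
Definition renorm (T : finType) (S : pred T) (a : T -> R) (t : T) : R :=
  if \sum_(t' | S t') a t' == 0 then a t
  else (S t)%:R * a t / \sum_(t' | S t') a t'.

Lemma renorm_pmf (T : finType) (S : pred T) (a : T -> R) :
  is_pmf a -> is_pmf (renorm S a).
Proof.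
move=> ap; have [a0 a1] := ap; rewrite /renorm /is_pmf; case: eqP => // /eqP n0.
split=> [t|]; first by rewrite divr_ge0 ?mulr_ge0 ?ler0n ?sumr_ge0.
rewrite -mulr_suml (eq_bigr (fun t => if S t then a t else 0)) => [|t _].
  by rewrite -big_mkcond mulfV.
by case: (S t); rewrite ?mul1r ?mul0r.
Qed.

Lemma pmf_le1 (T : finType) (a : T -> R) t : is_pmf a -> a t <= 1.
Proof. by move=> [a0 <-]; rewrite (bigD1 t) //= lerDl sumr_ge0. Qed.

Lemma pmf_sumD1 (T : finType) (a : T -> R) t : is_pmf a -> \sum_(i | i != t) a i = 1 - a t.
Proof. by move=> [_ <-]; rewrite [in RHS](bigD1 t) //= addrAC subrr add0r. Qed.

Lemma renormE (T : finType) (S : pred T) (a : T -> R) t :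
  is_pmf a -> S t -> 0 < a t ->
  0 < \sum_(t' | S t') a t' /\ renorm S a t = a t / \sum_(t' | S t') a t'.
Proof.
move=> [a0 _] St at0.
have s0 : 0 < \sum_(t' | S t') a t'.
  by rewrite (bigD1 t) //=; apply: ltr_wpDr => //; exact: sumr_ge0.
by split=> //; rewrite /renorm gt_eqF // St mul1r.
Qed.

End Renormalize.

(** * Random hashing of one auxiliary variable *)

Section HashStage.
Variables (R : realType) (T : finType) (F M : nat).
Hypothesis M0 : (0 < M)%N.
Let bin := ('I_F.+1 * 'I_M)%type.
Let FR : R := F.+1%:R.
Let NR : R := F.+1%:R * M%:R.

Definition hash_weight (h : {ffun T -> bin}) : R := \prod_(t : T) (fun _ : bin => NR^-1) (h t).

Definition hash_enc (h : {ffun T -> bin}) (a : T -> R) : T -> R :=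
  renorm (fun t => (h t).1 == ord0) a.

Definition hash_dec (h : {ffun T -> bin}) (m : 'I_M) (a : T -> R) : T -> R :=
  renorm (fun t => h t == (ord0, m)) a.

Let FR0 : 0 < FR. Proof. by rewrite ltr0n. Qed.
Let NR0 : 0 < NR. Proof. by rewrite mulr_gt0 ?ltr0n. Qed.

Lemma unif_pmf : is_pmf (fun _ : bin => NR^-1).
Proof.
split=> [_|]; first by rewrite invr_ge0 ltW.
rewrite sumr_const -[_ *+ _]mulr_natl card_prod !card_ord natrM mulfV //.
by rewrite gt_eqF.
Qed.

Lemma hash_weight_pmf : is_pmf hash_weight.
Proof. exact: prod_pmf unif_pmf. Qed.

Lemma unif_ord0 : \sum_(b : bin) NR^-1 * (b.1 == ord0)%:R = FR^-1.
Proof.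
rewrite -(pair_bigA _ (fun (f : 'I_F.+1) (m : 'I_M) => NR^-1 * (f == ord0)%:R)) /=.
rewrite (bigD1 ord0) //= [X in _ + X]big1 ?addr0 => [|f /negPf->]; last first.
  by rewrite big1 // => m _; rewrite mulr0.
rewrite sumr_const card_ord mulr1 -[_ *+ _]mulr_natl /NR invfM mulrCA mulfV ?mulr1 //.
by rewrite pnatr_eq0 -lt0n.
Qed.

Lemma hash_expect_ord0 t :
  \sum_h hash_weight h * ((h t).1 == ord0)%:R = FR^-1.
Proof.
by rewrite (prod_expect1 (fun b => (b.1 == ord0)%:R) t unif_pmf) unif_ord0.
Qed.

(** Given that [t] has first index 0, any other letter has it with probability [1 / FR]; this is the
    conditional mean of the encoder's normalisation constant, times the probability of the
    condition. *)
Lemma hash_expect_enc t (a : T -> R) : is_pmf a ->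
  \sum_h hash_weight h * (((h t).1 == ord0)%:R * \sum_(t' | (h t').1 == ord0) a t')
  = FR^-1 * (a t + (1 - a t) / FR).
Proof.
move=> [a0 a1].
transitivity (\sum_t' a t' * \sum_h hash_weight h * (((h t).1 == ord0)%:R * ((h t').1 == ord0)%:R)).
  under [RHS]eq_bigr do rewrite mulr_sumr; rewrite exchange_big /=; apply: eq_bigr => h _.
  rewrite [\sum_(t' | _) _]big_mkcond /= !mulr_sumr; apply: eq_bigr => t' _.
  by case: ((h t').1 == ord0); rewrite ?mulr1 ?mulr0 //; ring.
rewrite (bigD1 t) //= (eq_bigr (fun h => hash_weight h * ((h t).1 == ord0)%:R)); last first.
  by move=> h _; case: ((h t).1 == ord0); rewrite ?mulr1 ?mulr0.
rewrite hash_expect_ord0 (eq_bigr (fun t' => a t' * (FR^-1 * FR^-1))) => [|t' nt].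
  by rewrite -mulr_suml pmf_sumD1 //; ring.
rewrite (prod_expect2 (fun b => (b.1 == ord0)%:R) (fun b => (b.1 == ord0)%:R) unif_pmf); last by rewrite eq_sym.
by rewrite unif_ord0.
Qed.

Lemma unif_eq (b : bin) : \sum_(b' : bin) NR^-1 * (b' == b)%:R = NR^-1.
Proof.
rewrite (bigD1 b) //= eqxx mulr1 big1 ?addr0 // => b' /negPf->.
by rewrite mulr0.
Qed.

(** The analogue for a decoder: another letter shares the full bin of [t] with probability
    [1 / NR]. *)
Lemma hash_expect_dec t (a : T -> R) : is_pmf a ->
  \sum_h hash_weight h * (((h t).1 == ord0)%:R * \sum_(t' | h t' == h t) a t')
  = FR^-1 * (a t + (1 - a t) / NR).
Proof.
move=> [a0 a1].
transitivity (\sum_t' a t' * \sum_h hash_weight h * (((h t).1 == ord0)%:R * (h t' == h t)%:R)).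
  under [RHS]eq_bigr do rewrite mulr_sumr; rewrite exchange_big /=; apply: eq_bigr => h _.
  rewrite [\sum_(t' | _) _]big_mkcond /= !mulr_sumr; apply: eq_bigr => t' _.
  by case: (h t' == h t); rewrite ?mulr1 ?mulr0 //; ring.
rewrite (bigD1 t) //= (eq_bigr (fun h => hash_weight h * ((h t).1 == ord0)%:R)); last first.
  by move=> h _; rewrite eqxx mulr1.
rewrite hash_expect_ord0 (eq_bigr (fun t' => a t' * (FR^-1 * NR^-1))) => [|t' nt].
  by rewrite -mulr_suml pmf_sumD1 //; ring.
congr (_ * _).
(* Splitting over the value of the common bin turns the collision into a product of events about two
   independent letters. *)
transitivity (\sum_(b : bin) (b.1 == ord0)%:R *
   \sum_h hash_weight h * ((h t == b)%:R * (h t' == b)%:R)).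
  under [RHS]eq_bigr do rewrite mulr_sumr; rewrite exchange_big /=; apply: eq_bigr => h _.
  rewrite (bigD1 (h t)) //= eqxx mul1r big1 ?addr0 => [|b nb]; first by ring.
  by rewrite [h t == b]eq_sym (negPf nb) mul0r !mulr0.
rewrite (eq_bigr (fun b : bin => NR^-1 * (b.1 == ord0)%:R * NR^-1)) => [|b _].
  by rewrite -mulr_suml unif_ord0.
rewrite (prod_expect2 (fun b' => (b' == b)%:R) (fun b' => (b' == b)%:R) unif_pmf); last by rewrite eq_sym.
by rewrite unif_eq; ring.
Qed.

(** The tangent plane of [1 / (r1 r2 r3)] at [(1, 1, 1)]: write the left factor as an exponential,
    then use [1 + x <= exp x] and [ln r <= r - 1]. *)
Lemma inv3_tangent (r1 r2 r3 : R) : 0 < r1 -> 0 < r2 -> 0 < r3 ->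
  4 - r1 - r2 - r3 <= (r1 * r2 * r3)^-1.
Proof.
move=> h1 h2 h3.
have l (r : R) : 0 < r -> ln r <= r - 1.
  by move=> r0; have := @le_ln1Dx _ (r - 1); rewrite addrCA subrr addr0; apply; lra.
have -> : (r1 * r2 * r3)^-1 = expR (- (ln r1 + ln r2 + ln r3)).
  by rewrite expRN !expRD !lnK ?posrE.
apply: le_trans (expR_ge1Dx _).
by have := l _ h1; have := l _ h2; have := l _ h3; lra.
Qed.


(* Jensen's inequality for the convex function 1/(s1 s2 s3), through its tangent plane at
   the means of the three random normalisation constants. *)
Lemma hash_stage (a b c : T -> R) t (eta : R) :
  is_pmf a -> is_pmf b -> is_pmf c -> 0 <= eta ->
  F%:R * a t <= eta -> 1 <= eta * (NR * b t) -> 1 <= eta * (NR * c t) ->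
  a t / (1 + eta) ^+ 3 <= \sum_h hash_weight h *
    (hash_enc h a t * hash_dec h (h t).2 b t * hash_dec h (h t).2 c t).
Proof.
move=> ap bp cp e0 Ha Hb Hc.
have [a0 _] := ap; have [b0 _] := bp; have [c0 _] := cp.
have [w0 w1] := hash_weight_pmf.
have enc0 h : 0 <= hash_enc h a t by case: (renorm_pmf (fun t => (h t).1 == ord0) ap) => + _; apply.
have dec0 h m (d : T -> R) : is_pmf d -> 0 <= hash_dec h m d t.
  by move=> dp; case: (renorm_pmf (fun t => h t == (ord0, m)) dp) => + _; apply.
have := a0 t; rewrite le0r => /orP[/eqP E|at0].
  by rewrite E mul0r; apply: sumr_ge0 => h _; rewrite !mulr_ge0 ?dec0.
have pos (d : T -> R) : (forall t, 0 <= d t) -> 1 <= eta * (NR * d t) -> 0 < d t.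
  move=> d0 Hd; have := d0 t; rewrite le0r => /orP[/eqP E|//].
  by move: Hd; rewrite E !mulr0; lra.
have bt0 := pos _ b0 Hb; have ct0 := pos _ c0 Hc.
pose m1 := a t + (1 - a t) / FR; pose m2 := b t + (1 - b t) / NR.
pose m3 := c t + (1 - c t) / NR.
have mpos (d : T -> R) (K : R) : is_pmf d -> 0 < d t -> 0 < K -> 0 < d t + (1 - d t) / K.
  move=> dp d0 K0; apply: ltr_pwDl => //; rewrite divr_ge0 ?(ltW K0) // subr_ge0.
  exact: pmf_le1.
have m10 : 0 < m1 by exact: mpos.
have m20 : 0 < m2 by exact: mpos.
have m30 : 0 < m3 by exact: mpos.
pose s1 (h : {ffun T -> bin}) := \sum_(t' | (h t').1 == ord0) a t'.
pose s2 (h : {ffun T -> bin}) := \sum_(t' | h t' == h t) b t'.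
pose s3 (h : {ffun T -> bin}) := \sum_(t' | h t' == h t) c t'.
(* The value of the integrand when the constants [s1], [s2], [s3] sit at their conditional means
   [m1], [m2], [m3]. *)
pose K := a t * b t * c t / (m1 * m2 * m3).
have step h : hash_weight h * (((h t).1 == ord0)%:R * K * (4 - s1 h / m1 - s2 h / m2 - s3 h / m3))
   <= hash_weight h * (hash_enc h a t * hash_dec h (h t).2 b t * hash_dec h (h t).2 c t).
  rewrite ler_wpM2l //.
  case: (eqVneq (h t).1 ord0) => [E|_]; last by rewrite !mul0r !mulr_ge0 ?dec0.
  have Eh : h t = (ord0, (h t).2) by rewrite -E -surjective_pairing.
  have [p1 e1] := renormE (S := fun t => (h t).1 == ord0) ap (introT eqP E) at0.
  have [p2 e2] := renormE (S := fun t' => h t' == (ord0, (h t).2)) bp (introT eqP Eh) bt0.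
  have [p3 e3] := renormE (S := fun t' => h t' == (ord0, (h t).2)) cp (introT eqP Eh) ct0.
  rewrite /hash_enc /hash_dec e1 e2 e3 mul1r -Eh.
  rewrite -Eh in p2 p3; rewrite -/(s1 h) -/(s2 h) -/(s3 h).
  have := inv3_tangent (divr_gt0 p1 m10) (divr_gt0 p2 m20) (divr_gt0 p3 m30).
  rewrite -/(s1 h) -/(s2 h) -/(s3 h) => tang.
  apply: (@le_trans _ _ (K * (s1 h / m1 * (s2 h / m2) * (s3 h / m3))^-1)).
    by rewrite ler_wpM2l // divr_ge0 ?mulr_ge0 // ltW.
  rewrite le_eqVlt; apply/orP; left; apply/eqP; rewrite /K; field.
  by rewrite ?gt_eqF.
apply: le_trans (ler_sum _ (fun h _ => step h)).
have -> : \sum_h hash_weight h * (((h t).1 == ord0)%:R * K * (4 - s1 h / m1 - s2 h / m2 - s3 h / m3))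
  = K * (4 * (\sum_h hash_weight h * ((h t).1 == ord0)%:R)
     - (\sum_h hash_weight h * (((h t).1 == ord0)%:R * s1 h)) / m1
     - (\sum_h hash_weight h * (((h t).1 == ord0)%:R * s2 h)) / m2
     - (\sum_h hash_weight h * (((h t).1 == ord0)%:R * s3 h)) / m3).
  rewrite !mulr_suml !mulr_sumr -!sumrB !mulr_sumr; apply: eq_bigr => h _; ring.
rewrite hash_expect_ord0 /s1 /s2 /s3 hash_expect_enc // !hash_expect_dec // -/m1 -/m2 -/m3.
(* Each of the three linear terms, divided by its mean, averages to [FR^-1], so [4 - 3 = 1] copy of
   [K / FR] remains. *)
have -> : K * (4 * FR^-1 - FR^-1 * m1 / m1 - FR^-1 * m2 / m2 - FR^-1 * m3 / m3)
    = a t * ((FR * m1)^-1 * (m2 / b t)^-1 * (m3 / c t)^-1).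
  rewrite /K; field; by rewrite ?gt_eqF.
(* [FR * m1] is exactly [1 + F * a t]: hence [F.+1] first indices but a threshold on [F], which may
   be 0. *)
have q1 : FR * m1 <= 1 + eta.
  have -> : FR * m1 = 1 + F%:R * a t.
    by rewrite /m1 /FR -natr1; field; rewrite natr1 pnatr_eq0.
  by lra.
have q2 (d : T -> R) : is_pmf d -> 0 < d t -> 1 <= eta * (NR * d t) ->
    (d t + (1 - d t) / NR) / d t <= 1 + eta.
  move=> [d0 d1] dt0 Hd; rewrite ler_pdivrMr // [(1 + eta) * _]mulrDl mul1r lerD2l ler_pdivrMr //.
  by have := d0 t; lra.
have eta1 : 0 < 1 + eta by lra.
rewrite ler_pM2l // -exprVn exprS expr2 -[leRHS]mulrA.
have i1 : (1 + eta)^-1 <= (FR * m1)^-1 by rewrite lef_pV2 ?posrE // mulr_gt0.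
have i2 : (1 + eta)^-1 <= (m2 / b t)^-1 by rewrite lef_pV2 ?posrE ?divr_gt0 // q2.
have i3 : (1 + eta)^-1 <= (m3 / c t)^-1 by rewrite lef_pV2 ?posrE ?divr_gt0 // q2.
have i0 : 0 <= (1 + eta)^-1 by rewrite invr_ge0 ltW.
by apply: ler_pM => //; rewrite ?mulr_ge0 //; apply: ler_pM.
Qed.

End HashStage.

(** * The one-shot coding theorem *)

Section OneShot.
Variable R : realType.

Lemma derand_average (O H : finType) (g a : O -> R) (A : H -> O -> R) (w : H -> R) :
  is_pmf w -> (forall o, 0 <= g o) ->
  (forall o, g o != 0 -> a o <= \sum_h w h * A h o) ->
  exists h, \sum_o g o * a o <= \sum_o g o * A h o.
Proof.
move=> wp g0 Ha; have [h Hh] := derand_pick (fun h => \sum_o g o * A h o) wp.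
exists h; apply: le_trans Hh.
under [leRHS]eq_bigr do rewrite mulr_sumr; rewrite exchange_big /=.
apply: ler_sum => o _; have [->|n0] := eqVneq (g o) 0.
  by rewrite mul0r; under eq_bigr do rewrite mul0r mulr0; rewrite big1.
apply: (le_trans (ler_wpM2l (g0 o) (Ha _ n0))); rewrite mulr_sumr.
by rewrite le_eqVlt; apply/orP; left; apply/eqP; apply: eq_bigr => h' _; ring.
Qed.

Lemma sum_graph (A B : finType) (g : A * B -> R) (f : A -> B) :
  \sum_o g o * (f o.1 == o.2)%:R = \sum_a g (a, f a).
Proof.
rewrite (eq_bigr (fun o => g (o.1, o.2) * (f o.1 == o.2)%:R)) => [|[a b] _ //].
rewrite -(pair_bigA _ (fun a b => g (a, b) * (f a == b)%:R)) /=.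
apply: eq_bigr => a _; rewrite (bigD1 (f a)) //= eqxx mulr1 big1 ?addr0 // => b.
by rewrite eq_sym => /negPf->; rewrite mulr0.
Qed.

(** Three stages lose [(1 + eta) ^+ 3] each, whence the ninth power. U has two receivers and so two
    posteriors [ez] and [ex]; V and W have one receiver each. Since User Z can compute V, [ew] and
    [d3] take [v] as an input. *)
Lemma one_shot (X Y Z U V W : finType) (p : X * Y * Z -> R)
    (qu : Y -> U -> R) (ez : Z -> U -> R) (ex : X -> U -> R)
    (qv : U -> Z -> V -> R) (ev : U -> X -> V -> R)
    (qw : U -> V -> X -> W -> R) (ew : U -> V -> Z -> W -> R)
    (F1 F2 F3 M1 M2 M3 : nat) (G : pred (X * Y * Z * U * V * W)) (eta : R) :
  (forall t, 0 <= p t) -> 0 <= eta -> (0 < M1)%N -> (0 < M2)%N -> (0 < M3)%N ->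
  (forall y, is_pmf (qu y)) -> (forall z, is_pmf (ez z)) -> (forall x, is_pmf (ex x)) ->
  (forall u z, is_pmf (qv u z)) -> (forall u x, is_pmf (ev u x)) ->
  (forall u v x, is_pmf (qw u v x)) -> (forall u v z, is_pmf (ew u v z)) ->
  (forall x y z u v w, G (x, y, z, u, v, w) ->
    [/\ F1%:R * qu y u <= eta, 1 <= eta * (F1.+1%:R * M1%:R * ez z u)
      & 1 <= eta * (F1.+1%:R * M1%:R * ex x u)] /\
    [/\ F2%:R * qv u z v <= eta, 1 <= eta * (F2.+1%:R * M2%:R * ev u x v),
        F3%:R * qw u v x w <= eta & 1 <= eta * (F3.+1%:R * M3%:R * ew u v z w)]) ->
  exists (k1 : Y -> U) (b1 : U -> 'I_M1) (dZ : Z -> 'I_M1 -> U) (dX : X -> 'I_M1 -> U)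
    (k2 : U -> Z -> V) (b2 : V -> 'I_M2) (d2 : U -> X -> 'I_M2 -> V)
    (k3 : U -> V -> X -> W) (b3 : W -> 'I_M3) (d3 : U -> V -> Z -> 'I_M3 -> W),
  (\sum_(o | G o) aux_pmf p qu qv qw o) / (1 + eta) ^+ 9 <=
  \sum_(t : X * Y * Z) p t *
    (let u := k1 t.1.2 in let v := k2 u t.2 in let w := k3 u v t.1.1 in
     [&& G (t, u, v, w), dZ t.2 (b1 u) == u, dX t.1.1 (b1 u) == u,
         d2 u t.1.1 (b2 v) == v & d3 u v t.2 (b3 w) == w] : bool)%:R.
Proof.
move=> p0 e0 M10 M20 M30 qup ezp exp qvp evp qwp ewp HG.
pose oX (o : X * Y * Z * U * V * W) := o.1.1.1.1.1.
pose oY (o : X * Y * Z * U * V * W) := o.1.1.1.1.2.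
pose oZ (o : X * Y * Z * U * V * W) := o.1.1.1.2.
pose oU (o : X * Y * Z * U * V * W) := o.1.1.2.
pose oV (o : X * Y * Z * U * V * W) := o.1.2.
pose oW (o : X * Y * Z * U * V * W) := o.2.
pose g (o : X * Y * Z * U * V * W) := (G o)%:R * p o.1.1.1.
have g0 o : 0 <= g o by rewrite mulr_ge0 // ler0n.
have gG o : g o != 0 -> G o.
  by rewrite /g; case: (G o) => //; rewrite mul0r eqxx.
have e1 : 0 < (1 + eta) ^+ 3 by rewrite exprn_gt0 //; lra.
have qu0 y u : 0 <= qu y u by case: (qup y) => + _; apply.
have qv0 u z v : 0 <= qv u z v by case: (qvp u z) => + _; apply.
have qw0 u v x w : 0 <= qw u v x w by case: (qwp u v x) => + _; apply.
have -> : (\sum_(o | G o) aux_pmf p qu qv qw o) / (1 + eta) ^+ 9 =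
  \sum_o (g o * (qv (oU o) (oZ o) (oV o) / (1 + eta) ^+ 3)
     * (qw (oU o) (oV o) (oX o) (oW o) / (1 + eta) ^+ 3))
     * (qu (oY o) (oU o) / (1 + eta) ^+ 3).
  rewrite big_mkcond mulr_suml; apply: eq_bigr => -[[[[[x y] z] u] v] w] _.
  rewrite /g /aux_pmf /oX /oY /oZ /oU /oV /oW /=.
  case: (G _); rewrite ?mul0r // mul1r; field.
  by rewrite gt_eqF //; lra.
pose A1 (h : {ffun U -> 'I_F1.+1 * 'I_M1}) o := hash_enc h (qu (oY o)) (oU o) * hash_dec h (h (oU o)).2 (ez (oZ o)) (oU o)
   * hash_dec h (h (oU o)).2 (ex (oX o)) (oU o).
(* The hashes are fixed stage by stage; the stages still to come enter the weight with their ideal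
   probabilities. *)
have [|o n0|h1 Hh1] := derand_average (A := A1) (hash_weight_pmf R U F1 M10)
    (g := fun o => g o * (qv (oU o) (oZ o) (oV o) / (1 + eta) ^+ 3)
       * (qw (oU o) (oV o) (oX o) (oW o) / (1 + eta) ^+ 3))
    (a := fun o => qu (oY o) (oU o) / (1 + eta) ^+ 3).
- by move=> o; rewrite !mulr_ge0 // ?invr_ge0 ltW.
- have gn : g o != 0 by apply: contraNneq n0 => ->; rewrite !mul0r.
  case: o n0 gn => [[[[[x y] z] u] v] w] n0 gn.
  by have [[? ? ?] _] := HG _ _ _ _ _ _ (gG _ gn); exact: hash_stage.
(* V has one decoder, entered twice so that the three-factor bound of [hash_stage] applies; likewise
   for W below. *)
pose A2 (h : {ffun V -> 'I_F2.+1 * 'I_M2}) o := hash_enc h (qv (oU o) (oZ o)) (oV o)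
   * hash_dec h (h (oV o)).2 (ev (oU o) (oX o)) (oV o)
   * hash_dec h (h (oV o)).2 (ev (oU o) (oX o)) (oV o).
have enc0 (T : finType) F M (h : {ffun T -> 'I_F.+1 * 'I_M}) (a : T -> R) t :
    is_pmf a -> 0 <= hash_enc h a t <= 1.
  move=> ap; have rp := renorm_pmf (fun t => (h t).1 == ord0) ap.
  by rewrite /hash_enc pmf_le1 // andbT; case: rp => + _; apply.
have dec0 (T : finType) F M (h : {ffun T -> 'I_F.+1 * 'I_M}) m (a : T -> R) t :
    is_pmf a -> 0 <= hash_dec h m a t <= 1.
  move=> ap; have rp := renorm_pmf (fun t => h t == (ord0, m)) ap.
  by rewrite /hash_dec pmf_le1 // andbT; case: rp => + _; apply.
have enc0' := fun T F M h a t ap => proj1 (andP (enc0 T F M h a t ap)).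
have dec0' := fun T F M h m a t ap => proj1 (andP (dec0 T F M h m a t ap)).
have A10 o : 0 <= A1 h1 o by rewrite !mulr_ge0 ?enc0' ?dec0'.
have [|o n0|h2 Hh2] := derand_average (A := A2) (hash_weight_pmf R V F2 M20)
    (g := fun o => g o * A1 h1 o * (qw (oU o) (oV o) (oX o) (oW o) / (1 + eta) ^+ 3))
    (a := fun o => qv (oU o) (oZ o) (oV o) / (1 + eta) ^+ 3).
- by move=> o; apply: mulr_ge0; [exact: mulr_ge0|rewrite mulr_ge0 // invr_ge0 ltW].
- have gn : g o != 0 by apply: contraNneq n0 => ->; rewrite !mul0r.
  case: o n0 gn => [[[[[x y] z] u] v] w] n0 gn.
  by have [_ [? ? ? ?]] := HG _ _ _ _ _ _ (gG _ gn); exact: hash_stage.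
have A20 o : 0 <= A2 h2 o by rewrite !mulr_ge0 ?enc0' ?dec0'.
pose A3 (h : {ffun W -> 'I_F3.+1 * 'I_M3}) o := hash_enc h (qw (oU o) (oV o) (oX o)) (oW o)
   * hash_dec h (h (oW o)).2 (ew (oU o) (oV o) (oZ o)) (oW o)
   * hash_dec h (h (oW o)).2 (ew (oU o) (oV o) (oZ o)) (oW o).
have [|o n0|h3 Hh3] := derand_average (A := A3) (hash_weight_pmf R W F3 M30)
    (g := fun o => g o * A1 h1 o * A2 h2 o)
    (a := fun o => qw (oU o) (oV o) (oX o) (oW o) / (1 + eta) ^+ 3).
- by move=> o; apply: mulr_ge0 => //; exact: mulr_ge0.
- have gn : g o != 0 by apply: contraNneq n0 => ->; rewrite !mul0r.
  case: o n0 gn => [[[[[x y] z] u] v] w] n0 gn.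
  by have [_ [? ? ? ?]] := HG _ _ _ _ _ _ (gG _ gn); exact: hash_stage.
pose K1 y := hash_enc h1 (qu y).
pose KZ (t : Z * 'I_M1) := hash_dec h1 t.2 (ez t.1).
pose KX (t : X * 'I_M1) := hash_dec h1 t.2 (ex t.1).
pose K2 (t : U * Z) := hash_enc h2 (qv t.1 t.2).
pose D2 (t : U * X * 'I_M2) := hash_dec h2 t.2 (ev t.1.1 t.1.2).
pose K3 (t : U * V * X) := hash_enc h3 (qw t.1.1 t.1.2 t.2).
pose D3 (t : U * V * Z * 'I_M3) := hash_dec h3 t.2 (ew t.1.1.1 t.1.1.2 t.1.2).
pose b1 u := (h1 u).2; pose b2 v := (h2 v).2; pose b3 w := (h3 w).2.
have K1p t : is_pmf (K1 t) by exact: renorm_pmf.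
have KZp t : is_pmf (KZ t) by exact: renorm_pmf.
have KXp t : is_pmf (KX t) by exact: renorm_pmf.
have K2p t : is_pmf (K2 t) by exact: renorm_pmf.
have D2p t : is_pmf (D2 t) by exact: renorm_pmf.
have K3p t : is_pmf (K3 t) by exact: renorm_pmf.
have D3p t : is_pmf (D3 t) by exact: renorm_pmf.
pose aZ o := (oZ o, b1 (oU o)); pose aX o := (oX o, b1 (oU o)).
pose a2 o := (oU o, oZ o); pose c2 o := (oU o, oX o, b2 (oV o)).
pose a3 o := (oU o, oV o, oX o); pose c3 o := (oU o, oV o, oZ o, b3 (oW o)).
(* Seven kernels are frozen in turn; the weight holds the point masses already chosen and the
   kernels that are still random. *)
have [k1 Hk1] := derand (fun o => g o * KZ (aZ o) (oU o) * KX (aX o) (oU o)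
   * K2 (a2 o) (oV o) * D2 (c2 o) (oV o) * K3 (a3 o) (oW o) * D3 (c3 o) (oW o)) oY oU K1p.
have [dZ HdZ] := derand (fun o => g o * (k1 (oY o) == oU o)%:R * KX (aX o) (oU o)
   * K2 (a2 o) (oV o) * D2 (c2 o) (oV o) * K3 (a3 o) (oW o) * D3 (c3 o) (oW o)) aZ oU KZp.
have [dX HdX] := derand (fun o => g o * (k1 (oY o) == oU o)%:R * (dZ (aZ o) == oU o)%:R
   * K2 (a2 o) (oV o) * D2 (c2 o) (oV o) * K3 (a3 o) (oW o) * D3 (c3 o) (oW o)) aX oU KXp.
have [k2 Hk2] := derand (fun o => g o * (k1 (oY o) == oU o)%:R * (dZ (aZ o) == oU o)%:R
   * (dX (aX o) == oU o)%:R * D2 (c2 o) (oV o) * K3 (a3 o) (oW o) * D3 (c3 o) (oW o)) a2 oV K2p.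
have [d2 Hd2] := derand (fun o => g o * (k1 (oY o) == oU o)%:R * (dZ (aZ o) == oU o)%:R
   * (dX (aX o) == oU o)%:R * (k2 (a2 o) == oV o)%:R * K3 (a3 o) (oW o) * D3 (c3 o) (oW o)) c2 oV D2p.
have [k3 Hk3] := derand (fun o => g o * (k1 (oY o) == oU o)%:R * (dZ (aZ o) == oU o)%:R
   * (dX (aX o) == oU o)%:R * (k2 (a2 o) == oV o)%:R * (d2 (c2 o) == oV o)%:R * D3 (c3 o) (oW o)) a3 oW K3p.
have [d3 Hd3] := derand (fun o => g o * (k1 (oY o) == oU o)%:R * (dZ (aZ o) == oU o)%:R
   * (dX (aX o) == oU o)%:R * (k2 (a2 o) == oV o)%:R * (d2 (c2 o) == oV o)%:R
   * (k3 (a3 o) == oW o)%:R) c3 oW D3p.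
exists k1, b1, (fun z m => dZ (z, m)), (fun x m => dX (x, m)),
  (fun u z => k2 (u, z)), b2, (fun u x m => d2 (u, x, m)),
  (fun u v x => k3 (u, v, x)), b3, (fun u v z m => d3 (u, v, z, m)).
have L (f f' : X * Y * Z * U * V * W -> R) : (forall o, f o = f' o) -> \sum_o f o <= \sum_o f' o.
  by move=> E; under eq_bigr do rewrite E.
apply: (le_trans Hh1); apply: le_trans (le_trans (L _ _ _) Hh2) _; first by move=> o; ring.
apply: le_trans (le_trans (L _ _ _) Hh3) _; first by move=> o; ring.
(* The duplicated decoder factors of V and W are at most 1 and are dropped here. *)
apply: le_trans (le_trans _ Hk1) _.
  apply: ler_sum => o _.
  have D20 := dec0 _ _ _ h2 (h2 (oV o)).2 _ (oV o) (evp (oU o) (oX o)).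
  have D30 := dec0 _ _ _ h3 (h3 (oW o)).2 _ (oW o) (ewp (oU o) (oV o) (oZ o)).
  have /andP[D20l D20r] := D20; have /andP[D30l D30r] := D30.
  have -> : g o * A1 h1 o * A2 h2 o * A3 h3 o =
    g o * KZ (aZ o) (oU o) * KX (aX o) (oU o) * K2 (a2 o) (oV o) * D2 (c2 o) (oV o)
     * K3 (a3 o) (oW o) * D3 (c3 o) (oW o) * K1 (oY o) (oU o)
     * (hash_dec h2 (h2 (oV o)).2 (ev (oU o) (oX o)) (oV o)
        * hash_dec h3 (h3 (oW o)).2 (ew (oU o) (oV o) (oZ o)) (oW o)).
    by rewrite /A1 /A2 /A3 /KZ /KX /K2 /D2 /K3 /D3 /K1 /aZ /aX /a2 /c2 /a3 /c3 /b1 /b2 /b3 /=; ring.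
  rewrite ler_piMr //; last by apply: mulr_ile1.
  by rewrite !mulr_ge0 ?enc0' ?dec0'.
apply: le_trans (le_trans (L _ _ _) HdZ) _; first by move=> o; ring.
apply: le_trans (le_trans (L _ _ _) HdX) _; first by move=> o; ring.
apply: le_trans (le_trans (L _ _ _) Hk2) _; first by move=> o; ring.
apply: le_trans (le_trans (L _ _ _) Hd2) _; first by move=> o; ring.
apply: le_trans (le_trans (L _ _ _) Hk3) _; first by move=> o; ring.
apply: le_trans (le_trans (L _ _ _) Hd3) _; first by move=> o; ring.
(* With deterministic encoders the sum over tuples collapses to their graph, eliminating [w], then
   [v], then [u]. *)
pose P3 o := g o * (k1 (oY o) == oU o)%:R * (dZ (aZ o) == oU o)%:R
   * (dX (aX o) == oU o)%:R * (k2 (a2 o) == oV o)%:R * (d2 (c2 o) == oV o)%:R * (d3 (c3 o) == oW o)%:R.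
pose P2 o := g o * (k1 (oY o) == oU o)%:R * (dZ (aZ o) == oU o)%:R
   * (dX (aX o) == oU o)%:R * (d2 (c2 o) == oV o)%:R * (d3 (c3 o) == oW o)%:R.
pose P1 o := g o * (dZ (aZ o) == oU o)%:R
   * (dX (aX o) == oU o)%:R * (d2 (c2 o) == oV o)%:R * (d3 (c3 o) == oW o)%:R.
pose w3 (a : X * Y * Z * U * V) := k3 (a.1.2, a.2, a.1.1.1.1).
pose v2 (a : X * Y * Z * U) := k2 (a.2, a.1.2).
pose u1 (a : X * Y * Z) := k1 a.1.2.
rewrite (eq_bigr (fun o => P3 o * (w3 o.1 == o.2)%:R)); last by move=> o _; rewrite /P3; ring.
rewrite sum_graph (eq_bigr (fun a => P2 (a, w3 a) * (v2 a.1 == a.2)%:R)); last first.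
  by move=> a _; rewrite /P3 /P2; ring.
rewrite (sum_graph (fun a => P2 (a, w3 a))).
rewrite (eq_bigr (fun a => P1 (a, v2 a, w3 (a, v2 a)) * (u1 a.1 == a.2)%:R)); last first.
  by move=> a _; rewrite /P2 /P1; ring.
rewrite (sum_graph (fun a => P1 (a, v2 a, w3 (a, v2 a)))).
rewrite le_eqVlt; apply/orP; left; apply/eqP; apply: eq_bigr => -[[x y] z] _.
rewrite /P1 /g /aZ /aX /c2 /c3 /oX /oY /oZ /oU /oV /oW /u1 /v2 /w3 /=.
by case: (G _); case: (dZ _ == _); case: (dX _ == _); case: (d2 _ == _); case: (d3 _ == _);
  rewrite ?mul0r ?mulr0 ?mul1r ?mulr1.
Qed.

End OneShot.

(** * Typical sets and rate parameters *)

Section LLN.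
Variable R : realType.

(** Independence and zero mean kill the cross terms. *)
Lemma sum_sq_expect (O : finType) (P h : O -> R) n : is_pmf P -> \sum_o P o * h o = 0 ->
  \sum_(w : {ffun 'I_n -> O}) (\prod_i P (w i)) * (\sum_i h (w i)) ^+ 2
  = n%:R * \sum_o P o * h o ^+ 2.
Proof.
move=> Pp h0.
transitivity (\sum_(i < n) \sum_(j < n)
    \sum_(w : {ffun 'I_n -> O}) (\prod_i P (w i)) * (h (w i) * h (w j))).
  under [RHS]eq_bigr do rewrite exchange_big; rewrite exchange_big /=; apply: eq_bigr => w _.
  by rewrite expr2 big_distrlr /= mulr_sumr; apply: eq_bigr => i _; rewrite mulr_sumr.
rewrite (eq_bigr (fun=> \sum_o P o * h o ^+ 2)) => [|i _].
  by rewrite sumr_const card_ord mulr_natl.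
rewrite (bigD1 i) //= [X in _ + X]big1 ?addr0 => [|j ji]; last first.
  by rewrite prod_expect2 // 1?eq_sym // h0 mul0r.
by under eq_bigr do rewrite -expr2; rewrite (prod_expect1 (fun o => h o ^+ 2)).
Qed.

Lemma lln (O : finType) (P g : O -> R) (d e : R) : is_pmf P -> 0 < d -> 0 < e ->
  exists N, forall n, (N <= n)%N ->
  \sum_(w : {ffun 'I_n -> O} | n%:R * d < `|\sum_i g (w i) - n%:R * expect P g|)
     \prod_i P (w i) <= e.
Proof.
move=> Pp d0 e0; have [P0 P1] := Pp.
pose mu := expect P g; pose h o := g o - mu.
pose v := \sum_o P o * h o ^+ 2.
have h0 : \sum_o P o * h o = 0.
  under eq_bigr do rewrite mulrBr; rewrite sumrB -mulr_suml P1 mul1r.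
  by rewrite /mu /expect subrr.
have v0 : 0 <= v by apply: sumr_ge0 => o _; rewrite mulr_ge0 // sqr_ge0.
(* Chebyshev's bound is [v / (n d^2)], at most [e] from here on; the successor keeps [n]
   positive. *)
exists (Num.bound (v / (d ^+ 2 * e))).+1 => n Hn.
have n0 : 0 < n%:R :> R by rewrite ltr0n; apply: leq_trans Hn.
have Hv : v / (d ^+ 2 * e) <= n%:R.
  have /ltW/le_trans-> // : v / (d ^+ 2 * e) < (Num.bound (v / (d ^+ 2 * e)))%:R.
    by rewrite archi_boundP // divr_ge0 // mulr_ge0 ?sqr_ge0 // ltW.
  by rewrite ler_nat ltnW.
have nd0 : 0 < (n%:R * d) ^+ 2 by rewrite exprn_gt0 // mulr_gt0.
apply: (@le_trans _ _ (n%:R * v / (n%:R * d) ^+ 2)); last first.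
  rewrite ler_pdivrMr // exprMn.
  move: Hv; rewrite ler_pdivrMr ?mulr_gt0 ?exprn_gt0 // => Hv.
  have -> : e * (n%:R ^+ 2 * d ^+ 2) = n%:R * (n%:R * (d ^+ 2 * e)) by ring.
  by rewrite ler_wpM2l // ltW.
rewrite /v -(sum_sq_expect _ Pp h0) mulr_suml big_mkcond /=; apply: ler_sum => w _.
have pw0 : 0 <= \prod_i P (w i) by apply: prodr_ge0.
case: ifPn => [Hw|_]; last first.
  by apply: divr_ge0; [apply: mulr_ge0 => //; exact: sqr_ge0|exact: ltW].
have -> : \sum_i h (w i) = \sum_i g (w i) - n%:R * mu.
  by rewrite /h sumrB sumr_const card_ord mulr_natl.
rewrite -mulrA ler_peMr // ler_pdivlMr // mul1r -[leRHS]real_normK ?num_real //.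
by rewrite ler_pXn2r ?nnegrE ?mulr_ge0 // ltW.
Qed.

(** Positivity is included because the logarithms among the test functions are meaningful only at
    letters of positive mass. *)
Definition typical (O J : finType) (P : O -> R) (g : J -> O -> R) (d : R) n
    (w : {ffun 'I_n -> O}) : bool :=
  [forall j, `|\sum_i g j (w i) - n%:R * expect P (g j)| <= n%:R * d]
  && (0 < \prod_i P (w i)).

Lemma typical_prob (O J : finType) (P : O -> R) (g : J -> O -> R) (d e : R) :
  is_pmf P -> 0 < d -> 0 < e ->
  exists N, forall n, (N <= n)%N ->
  1 - e <= \sum_(w : {ffun 'I_n -> O} | typical P g d w) \prod_i P (w i).
Proof.
move=> Pp d0 e0; have [P0 P1] := Pp.
(* The error is shared out for a union bound over [J]; the successor covers an empty [J]. *)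
have e'0 : 0 < e / #|J|.+1%:R by rewrite divr_gt0.
have /choice[N HN] j := lln (g j) Pp d0 e'0.
exists (\max_j N j) => n Hn.
have [pr0 pr1] := prod_pmf 'I_n Pp.
have := pr1; rewrite (bigID (fun w => typical P g d w)) /= => E.
rewrite lerBlDr -[leLHS]E; apply: lerD => //.
apply: (@le_trans _ _ (\sum_j \sum_(w : {ffun 'I_n -> O} |
    n%:R * d < `|\sum_i g j (w i) - n%:R * expect P (g j)|) \prod_i P (w i))); last first.
  apply: (@le_trans _ _ (\sum_(j : J) e / #|J|.+1%:R)).
    by apply: ler_sum => j _; apply: HN; apply: leq_trans Hn; exact: leq_bigmax.
  rewrite sumr_const -[_ *+ _]mulr_natl mulrCA ler_piMr ?(ltW e0) //.
  by rewrite ler_pdivrMr ?ltr0n // mul1r ler_nat.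
under [leRHS]eq_bigr do rewrite big_mkcond; rewrite exchange_big /= big_mkcond /=.
apply: ler_sum => w _; have t0 j : 0 <= (if n%:R * d < `|\sum_i g j (w i) - n%:R * expect P (g j)|
   then \prod_i P (w i) else 0) by case: ifP => // _; exact: pr0.
rewrite /typical; case: ifPn => [|_]; last exact: sumr_ge0.
rewrite negb_and => /orP[/forallPn[j]|]; last first.
  rewrite -leNgt => le0; have -> : \prod_i P (w i) = 0 by apply/eqP; rewrite eq_le le0; exact: pr0.
  by apply: sumr_ge0 => j _; case: ifP.
by rewrite -ltNge => Hj; rewrite (bigD1 j) //= Hj lerDl; apply: sumr_ge0.
Qed.

Lemma prod_pow2_bounds (O : finType) (k : O -> R) (mu d : R) n (w : {ffun 'I_n -> O}) :
  (forall i, 0 < k (w i)) -> `|\sum_i log2 (k (w i)) - n%:R * mu| <= n%:R * d ->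
  2 `^ (n%:R * (mu - d)) <= \prod_i k (w i) <= 2 `^ (n%:R * (mu + d)).
Proof.
move=> k0; have pr0 : 0 < \prod_i k (w i) by apply: prodr_gt0.
have -> : \sum_i log2 (k (w i)) = log2 (\prod_i k (w i)).
  have : forall r : seq 'I_n, \sum_(i <- r) log2 (k (w i)) = log2 (\prod_(i <- r) k (w i)).
    elim=> [|i r IH]; first by rewrite !big_nil log2_1.
    by rewrite !big_cons IH log2M // prodr_gt0.
  exact.
rewrite ler_norml => /andP[l1 l2].
rewrite -[X in _ <= X <= _]pow2_log2 // !ler_powR ?ler1n //; lra.
Qed.

Lemma pow2_large (d K : R) : 0 < d -> exists N, forall n, (N <= n)%N -> K <= 2 `^ (n%:R * d).
Proof.
move=> d0; have dl : 0 < d * ln 2 by rewrite mulr_gt0 // ln2_gt0.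
exists (Num.bound (`|K| / (d * ln 2))) => n Hn.
rewrite /powR pnatr_eq0 /=; apply: le_trans (expR_ge1Dx _).
have : `|K| / (d * ln 2) <= n%:R.
  by apply: le_trans (ltW (archi_boundP _)) _; rewrite ?ler_nat // divr_ge0 // ltW.
rewrite ler_pdivrMr // -mulrA => H; have := ler_norm K; lra.
Qed.

(** [mua] and [mue] stand for the mean logarithms, per letter, of the encoder kernel and of a
    decoder posterior. [F] and [M] are chosen before [mue], so both decoders of U can share them. Of
    the slack [4 * d], [2 * d] keeps [F] small, one [d] is the decoder's typicality, and one beats
    the constant [2 / eta]. *)
Lemma rate_params (d eta : R) : 0 < d -> 0 < eta -> exists N, forall n, (N <= n)%N ->
  forall mua r : R, 0 <= r -> exists F M : nat,
  [/\ (0 < M)%N, M%:R <= 2 `^ (n%:R * r),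
     (forall a, a <= 2 `^ (n%:R * (mua + d)) -> F%:R * a <= eta)
   & (forall mue e, mua - mue + 4 * d <= r -> 2 `^ (n%:R * (mue - d)) <= e ->
        1 <= eta * (F.+1%:R * M%:R * e))].
Proof.
move=> d0 e0; have [N HN] := pow2_large (2 / eta) d0; exists N => n Hn mua r r0.
have {HN}H1 := HN _ Hn.
have pD (x y : R) : 2 `^ (x + y) = 2 `^ x * 2 `^ y :> R by rewrite powRD // pnatr_eq0 implybT.
have p0 x : 0 < 2 `^ x :> R by rewrite powR_gt0.
(* One [d] in [F] offsets the typicality of the encoder kernel, the other brings [F * a] down to
   [2 ^ (- n d) <= eta]. *)
exists (Num.trunc (2 `^ (n%:R * (- mua - 2 * d)) : R)), (Num.trunc (2 `^ (n%:R * r) : R)).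
have /andP[F1 F2] := truncn_itv (ltW (p0 (n%:R * (- mua - 2 * d)))).
have /andP[M1 M2] := truncn_itv (ltW (p0 (n%:R * r))).
set F := Num.trunc _ in F1 F2 *; set M := Num.trunc _ in M1 M2 *.
have ge1 : 1 <= 2 `^ (n%:R * r) :> R.
  by rewrite -[leLHS](powRr0 2) ler_powR ?ler1n // mulr_ge0.
have M0 : (0 < M)%N.
  by rewrite lt0n; apply: contraTneq M2 => ->; rewrite -leNgt.
have M1' : 1 <= M%:R :> R by rewrite ler1n.
(* As [r >= 0], rounding down loses at most a factor 2, which the 2 in [2 / eta] pays for. *)
have M3 : 2 `^ (n%:R * r) <= 2 * M%:R :> R by move: M2; rewrite -natr1; lra.
split => //.
- move=> a Ha; apply: (@le_trans _ _ (2 `^ (n%:R * (- mua - 2 * d)) * 2 `^ (n%:R * (mua + d)))).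
    apply: (le_trans (ler_wpM2l (ler0n _ _) Ha)).
    by rewrite ler_wpM2r // ltW.
  rewrite -pD; have -> : n%:R * (- mua - 2 * d) + n%:R * (mua + d) = - (n%:R * d) by ring.
  rewrite powRN -[leRHS]invrK lef_pV2 ?posrE ?invr_gt0 //; apply: le_trans H1.
  by rewrite ler_peMl ?invr_ge0 ?(ltW e0) // ler1n.
move=> mue e Hr He.
rewrite mulrC -ler_pdivrMr // div1r.
apply: (@le_trans _ _ (2 `^ (n%:R * d) / 2)).
  by rewrite ler_pdivlMr // mulrC.
rewrite ler_pdivrMr //.
apply: (@le_trans _ _ (2 `^ (n%:R * (- mua - 2 * d)) * 2 `^ (n%:R * r) * 2 `^ (n%:R * (mue - d)))).
  rewrite -!pD -!mulrDr; apply: ler_powR; first by rewrite ler1n.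
  by rewrite ler_wpM2l //; lra.
have -> : F.+1%:R * M%:R * e * 2 = F.+1%:R * (2 * M%:R) * e by ring.
by rewrite ler_pM ?mulr_ge0 ?(ltW (p0 _)) // ler_pM ?(ltW (p0 _)) // ltW.
Qed.

End LLN.

(** * The single-letter joint law *)

Section AuxLaw.
Variables (R : realType) (X Y Z U V W : finType) (p : X * Y * Z -> R).
Variables (qu : Y -> U -> R) (qv : U -> Z -> V -> R) (qw : U -> V -> X -> W -> R).
Hypothesis pp : is_pmf p.
Hypothesis qup : forall y, is_pmf (qu y).
Hypothesis qvp : forall u z, is_pmf (qv u z).
Hypothesis qwp : forall u v x, is_pmf (qw u v x).

Notation O := (X * Y * Z * U * V * W)%type.
Notation P := (aux_pmf p qu qv qw).
Let oX (o : O) := o.1.1.1.1.1.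
Let oY (o : O) := o.1.1.1.1.2.
Let oZ (o : O) := o.1.1.1.2.
Let oU (o : O) := o.1.1.2.
Let oV (o : O) := o.1.2.
Let oW (o : O) := o.2.

Lemma aux_push5 x y z u v :
  pushpmf P fst (x, y, z, u, v) = p (x, y, z) * qu y u * qv u z v.
Proof.
by rewrite pushpmf_fst /= -mulr_sumr; have [_ ->] := qwp u v x; rewrite mulr1.
Qed.

Lemma aux_push4 x y z u :
  pushpmf P (fun o => o.1.1) (x, y, z, u) = p (x, y, z) * qu y u.
Proof.
rewrite (pushpmf_comp P fst fst) pushpmf_fst; under eq_bigr do rewrite aux_push5.
by rewrite -mulr_sumr; have [_ ->] := qvp u z; rewrite mulr1.
Qed.

Lemma aux_push3 t : pushpmf P (fun o => o.1.1.1) t = p t.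
Proof.
rewrite (pushpmf_comp P (fun o => o.1.1) fst) pushpmf_fst; case: t => [[x y] z].
under eq_bigr do rewrite aux_push4.
by rewrite -mulr_sumr; have [_ ->] := qup y; rewrite mulr1.
Qed.

Lemma aux_pmf_ge0 o : 0 <= P o.
Proof.
case: o => [[[[[x y] z] u] v] w] /=; have [p0 _] := pp.
have [a0 _] := qup y; have [b0 _] := qvp u z; have [c0 _] := qwp u v x.
by rewrite !mulr_ge0.
Qed.

Lemma aux_pmf_is_pmf : is_pmf P.
Proof.
split; first exact: aux_pmf_ge0.
rewrite -(sum_pushpmf1 P (fun o => o.1.1.1)); under eq_bigr do rewrite aux_push3.
by have [] := pp.
Qed.

Lemma aux_kernel_W :
  kernel_of P oW (fun o => (oY o, oZ o)) (fun o => (oU o, oV o, oX o))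
    (fun c w => qw c.1.1 c.1.2 c.2 w).
Proof.
move=> w [y z] [[u v] x].
rewrite (pushpmf_inj P id (x, y, z, u, v, w)
  (g := fun o => (oW o, (oY o, oZ o), (oU o, oV o, oX o)))); last first.
  rewrite /oW /oY /oZ /oU /oV /oX.
  by move=> [[[[[? ?] ?] ?] ?] ?] [[[[[? ?] ?] ?] ?] ?] /= [] -> -> -> -> -> ->.
rewrite (pushpmf_inj P fst (x, y, z, u, v)
  (g := fun o => ((o.1.1.1.2, o.1.1.2), (o.1.2, o.2, o.1.1.1.1)))); last first.
  by move=> [[[[? ?] ?] ?] ?] [[[[? ?] ?] ?] ?] [] -> -> -> -> ->.
by rewrite aux_push5 /pushpmf big_pred1_eq.
Qed.

Lemma aux_kernel_V :
  kernel_of P oV (fun o => (oX o, oY o)) (fun o => (oU o, oZ o))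
    (fun c v => qv c.1 c.2 v).
Proof.
move=> v [x y] [u z].
rewrite (pushpmf_inj P fst (x, y, z, u, v)
  (g := fun o => (o.2, (o.1.1.1.1, o.1.1.1.2), (o.1.2, o.1.1.2)))); last first.
  by move=> [[[[? ?] ?] ?] ?] [[[[? ?] ?] ?] ?] [] -> -> -> -> ->.
rewrite (pushpmf_inj P (fun o => o.1.1) (x, y, z, u)
  (g := fun o => ((o.1.1.1, o.1.1.2), (o.2, o.1.2)))); last first.
  by move=> [[[? ?] ?] ?] [[[? ?] ?] ?] [] -> -> -> ->.
by rewrite aux_push5 aux_push4.
Qed.

Lemma aux_kernel_U : kernel_of P oU (fun o => (oX o, oZ o)) oY qu.
Proof.
move=> u [x z] y.
rewrite (pushpmf_inj P (fun o => o.1.1) (x, y, z, u)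
  (g := fun o => (o.2, (o.1.1.1, o.1.2), o.1.1.2))); last first.
  by move=> [[[? ?] ?] ?] [[[? ?] ?] ?] [] -> -> -> ->.
rewrite (pushpmf_inj P (fun o => o.1.1.1) (x, y, z)
  (g := fun o => ((o.1.1, o.2), o.1.2))); last first.
  by move=> [[? ?] ?] [[? ?] ?] [] -> -> ->.
by rewrite aux_push4 aux_push3.
Qed.

Lemma aux_cmi1E : cmi P oY oU oZ = \sum_o P o * log2 (qu (oY o) (oU o)
   * pushpmf P oZ (oZ o) / pushpmf P (fun o => (oU o, oZ o)) (oU o, oZ o)).
Proof.
apply: (cmi_kernelE (D := fun y _ => y)) => [|o _]; first exact: aux_pmf_ge0.
rewrite (pushpmf_eq_at P (f := fun o => (oY o, oU o, oZ o)) (g := fun o => (oU o, oZ o, oY o))); last first.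
  by move=> o' /=; rewrite !xpair_eqE; case: (oY o' == _); case: (oU o' == _); case: (oZ o' == _).
rewrite (pushpmf_eq_at P (f := fun o => (oY o, oZ o)) (g := fun o => (oZ o, oY o))); last first.
  by move=> o' /=; rewrite !xpair_eqE; case: (oY o' == _); case: (oZ o' == _).
exact: (kernel_of_fun (fun b _ => b.2) aux_kernel_U).
Qed.

Lemma aux_cmi2E : cmi P oZ oV (fun o => (oU o, oX o)) =
  \sum_o P o * log2 (qv (oU o) (oZ o) (oV o)
   * pushpmf P (fun o => (oU o, oX o)) (oU o, oX o)
   / pushpmf P (fun o => (oV o, (oU o, oX o))) (oV o, (oU o, oX o))).
Proof.
apply: (cmi_kernelE (D := fun z (c : U * X) => (c.1, z)) (k := fun d v => qv d.1 d.2 v))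
  => [|o _]; first exact: aux_pmf_ge0.
rewrite (pushpmf_eq_at P (f := fun o => (oZ o, oV o, (oU o, oX o))) (g := fun o => (oV o, oX o, (oU o, oZ o)))); last first.
  by move=> o' /=; rewrite !xpair_eqE; case: (oZ o' == _); case: (oV o' == _); case: (oU o' == _); case: (oX o' == _).
rewrite (pushpmf_eq_at P (f := fun o => (oZ o, (oU o, oX o))) (g := fun o => (oX o, (oU o, oZ o)))); last first.
  by move=> o' /=; rewrite !xpair_eqE; case: (oZ o' == _); case: (oU o' == _); case: (oX o' == _).
exact: (kernel_of_fun (fun b _ => b.1) aux_kernel_V).
Qed.

Lemma aux_cmi3E : cmi P oX oW (fun o => (oU o, oV o, oZ o)) =
  \sum_o P o * log2 (qw (oU o) (oV o) (oX o) (oW o)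
   * pushpmf P (fun o => (oU o, oV o, oZ o)) (oU o, oV o, oZ o)
   / pushpmf P (fun o => (oW o, (oU o, oV o, oZ o))) (oW o, (oU o, oV o, oZ o))).
Proof.
apply: (cmi_kernelE (D := fun x (c : U * V * Z) => (c.1.1, c.1.2, x))
   (k := fun d w => qw d.1.1 d.1.2 d.2 w)) => [|o _]; first exact: aux_pmf_ge0.
rewrite (pushpmf_eq_at P (f := fun o => (oX o, oW o, (oU o, oV o, oZ o))) (g := fun o => (oW o, oZ o, (oU o, oV o, oX o)))); last first.
  by move=> o' /=; rewrite !xpair_eqE; case: (oX o' == _); case: (oW o' == _); case: (oU o' == _); case: (oV o' == _); case: (oZ o' == _).
rewrite (pushpmf_eq_at P (f := fun o => (oX o, (oU o, oV o, oZ o))) (g := fun o => (oZ o, (oU o, oV o, oX o)))); last first.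
  by move=> o' /=; rewrite !xpair_eqE; case: (oX o' == _); case: (oU o' == _); case: (oV o' == _); case: (oZ o' == _).
exact: (kernel_of_fun (fun b _ => b.2) aux_kernel_W).
Qed.

(** U is drawn from Y alone, and Y is independent of Z given X. *)
Lemma aux_cind_UZX : markov_YXZ p -> cind P oU oZ oX.
Proof.
move=> mk u z x.
pose q (t : X * Y * Z * U) := p t.1 * qu t.1.1.2 t.2.
have pushq (T : finType) (f : X * Y * Z * U -> T) t :
    pushpmf P (fun o => f o.1.1) t = pushpmf q f t.
  rewrite (pushpmf_comp P (fun o => o.1.1) f); apply: eq_bigr => -[[[x' y'] z'] u'] _.
  exact: aux_push4.
have E1 : pushpmf P (fun o => (oU o, oZ o, oX o)) (u, z, x) = \sum_y p (x, y, z) * qu y u.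
  rewrite (pushq _ (fun t => (t.2, t.1.2, t.1.1.1))).
  rewrite /pushpmf (reindex_onto (fun y => (x, y, z, u)) (fun t => t.1.1.2)) /=; last first.
    by move=> [[[x' y'] z'] u'] /= /eqP[-> -> ->].
  by apply: eq_bigl => y; rewrite !eqxx.
have E2 : pushpmf P oX x = \sum_y' \sum_z' p (x, y', z').
  rewrite (pushpmf_comp P (fun o => o.1.1.1) (fun t => t.1.1)).
  rewrite {1}/pushpmf; under eq_bigr do rewrite aux_push3.
  rewrite pair_bigA /= (reindex_onto (fun t : Y * Z => (x, t.1, t.2)) (fun t => (t.1.2, t.2))) /=; last first.
    by move=> [[x' y'] z'] /= /eqP->.
  by apply: eq_bigl => -[y' z']; rewrite !eqxx.
have E3 : pushpmf P (fun o => (oU o, oX o)) (u, x) = \sum_y (\sum_z' p (x, y, z')) * qu y u.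
  rewrite (pushq _ (fun t => (t.2, t.1.1.1))).
  under eq_bigr do rewrite mulr_suml; rewrite pair_bigA /=.
  rewrite /pushpmf (reindex_onto (fun t : Y * Z => (x, t.1, t.2, u)) (fun t => (t.1.1.2, t.1.2))) /=; last first.
    by move=> [[[x' y'] z'] u'] /= /eqP[-> ->].
  by apply: eq_bigl => -[y z'] /=; rewrite !eqxx.
have E4 : pushpmf P (fun o => (oZ o, oX o)) (z, x) = \sum_y p (x, y, z).
  rewrite (pushpmf_comp P (fun o => o.1.1.1) (fun t => (t.2, t.1.1))).
  rewrite {1}/pushpmf; under eq_bigr do rewrite aux_push3.
  rewrite (reindex_onto (fun y => (x, y, z)) (fun t => t.1.2)) /=; last first.
    by move=> [[x' y'] z'] /= /eqP[-> ->].
  by apply: eq_bigl => y; rewrite !eqxx.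
rewrite E1 E2 E3 E4 !mulr_suml; apply: eq_bigr => y _.
by rewrite mulrAC mk mulrAC.
Qed.

(** This is [H(U|X) <= H(U|Z)], data processing along [U - X - Z]. It lets the rate [I(Y;U|Z)] serve
    the decoder at User X as well. *)
Lemma aux_log_decoders u0 : markov_YXZ p ->
  \sum_o P o * log2 (condk P oU oZ u0 (oZ o) (oU o))
  <= \sum_o P o * log2 (condk P oU oX u0 (oX o) (oU o)).
Proof.
move=> mk; have [P0 P1] := aux_pmf_is_pmf.
have c0 (T : finType) (C : O -> T) o : 0 < P o -> 0 < condk P oU C u0 (C o) (oU o).
  move=> Po; have C0 := pushpmf_gt0 C P0 Po.
  rewrite /condk gt_eqF // divr_gt0 //.
  exact: (pushpmf_gt0 (fun o => (oU o, C o)) P0 Po).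
rewrite -subr_le0 -sumrB.
pose h (t : U * Z * X) := condk P oU oZ u0 t.1.2 t.1.1 / condk P oU oX u0 t.2 t.1.1.
rewrite (eq_bigr (fun o => P o * log2 (h (oU o, oZ o, oX o)))); last first.
  move=> o _; have := P0 o; rewrite le0r => /orP[/eqP->|Po]; first by rewrite !mul0r subr0.
  by rewrite -mulrBr log2_div ?c0.
apply: gibbs => // [t Pt|]; first by rewrite divr_gt0 ?c0.
rewrite -(sum_pushpmf P (fun o => (oU o, oZ o, oX o)) h).
(* The law of [(U, Z, X)] factors through the posterior of U given X, which cancels the denominator
   of [h]. *)
have K := cind_kernel u0 P0 (aux_cind_UZX mk).
pose zx := pushpmf P (fun o => (oZ o, oX o)).
have zx0 t : 0 <= zx t by exact: pushpmf_ge0.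
have ez0 z u : 0 <= condk P oU oZ u0 z u by case: (condk_pmf oU oZ u0 z P0) => + _; apply.
apply: (@le_trans _ _ (\sum_(t : U * Z * X) zx (t.1.2, t.2) * condk P oU oZ u0 t.1.2 t.1.1)).
  apply: ler_sum => -[[u z] x] _; rewrite K /h /= -/zx.
  have [->|n0] := eqVneq (condk P oU oX u0 x u) 0.
    by rewrite invr0 !mulr0 mulr_ge0.
  by rewrite -mulrA [_ * (_ / _)]mulrCA mulfV // mulr1.
rewrite -(pair_bigA _ (fun uz x => zx (uz.2, x) * condk P oU oZ u0 uz.2 uz.1)) /=.
rewrite -(pair_bigA _ (fun u z => \sum_x zx (z, x) * condk P oU oZ u0 z u)) /=.
rewrite exchange_big /=.
rewrite (eq_bigr (fun z => \sum_x zx (z, x))) => [|z _].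
  rewrite pair_bigA /= (eq_bigr zx) => [|[z x] _ //].
  by rewrite /zx sum_pushpmf1.
rewrite exchange_big /=; apply: eq_bigr => x _.
by rewrite -mulr_sumr; have [_ ->] := condk_pmf oU oZ u0 z P0; rewrite mulr1.
Qed.

End AuxLaw.

(** * Achievability *)

Section Achievability.
Variable R : realType.

(** [B] is the worst-case distortion, paid only on failure. *)
Lemma expect_success_bound (T : finType) (Q f : T -> R) (s : pred T) (B D e : R) :
  is_pmf Q -> 0 <= B -> 0 <= D -> (forall t, f t <= B) ->
  (forall t, s t -> f t <= D) -> 1 - e <= \sum_t Q t * (s t)%:R ->
  expect Q f <= D + B * e.
Proof.
move=> [Q0 Q1] B0 D0 fB fD He.
apply: (@le_trans _ _ (\sum_t Q t * (D + B * (1 - (s t)%:R)))).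
  apply: ler_sum => t _; rewrite ler_wpM2l //.
  case: (boolP (s t)) => [st|_]; first by rewrite subrr mulr0 addr0 fD.
  by rewrite subr0 mulr1; have := fB t; lra.
have -> : \sum_t Q t * (D + B * (1 - (s t)%:R)) =
    D * (\sum_t Q t) + B * (\sum_t Q t - \sum_t Q t * (s t)%:R).
  by rewrite -sumrB !mulr_sumr -big_split /=; apply: eq_bigr => t _;
    move: ((s t)%:R : R) => b; ring.
by rewrite Q1 mulr1 lerD2l ler_wpM2l //; lra.
Qed.

Lemma avg_dist_le (A B : finType) (d : A -> B -> R) n (a : {ffun 'I_n -> A})
    (b : {ffun 'I_n -> B}) (K : R) :
  0 <= K -> (forall i, d (a i) (b i) <= K) -> avg_dist d a b <= K.
Proof.
move=> K0 dK; rewrite /avg_dist; case: n a b dK => [|n] a b dK.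
  by rewrite big_ord0 mulr0.
rewrite mulrC ler_pdivrMr ?ltr0n //.
apply: (le_trans (ler_sum _ (fun i _ => dK i))).
by rewrite sumr_const card_ord -[_ *+ _]mulr_natr.
Qed.

Lemma dist_le_total (A B : finType) (d : A -> B -> R) a b :
  (forall a b, 0 <= d a b) -> d a b <= \sum_a \sum_b d a b.
Proof.
move=> d0; rewrite (bigD1 a) //= (bigD1 b) //= -addrA lerDl addr_ge0 ?sumr_ge0 //.
by move=> a' _; apply: sumr_ge0.
Qed.

Lemma inv_exp9_ge (eta : R) : 0 <= eta -> 1 - 9 * eta <= ((1 + eta) ^+ 9)^-1.
Proof.
move=> e0; apply: (@le_trans _ _ (expR (- (9 * eta)))).
  by apply: le_trans (expR_ge1Dx _); lra.
rewrite expRN lef_pV2 ?posrE ?expR_gt0 //; last by rewrite exprn_gt0 //; lra.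
by rewrite expRM_natl lerXn2r ?nnegrE ?expR_ge0 ?expR_ge1Dx //; lra.
Qed.

Lemma prod_ge_1sub (e A I : R) : 0 < e -> 0 <= A -> 0 <= I -> 1 - e / 2 <= A ->
  1 - e / 2 <= I -> 1 - e <= A * I.
Proof.
move=> e0 A0 I0 HA HI.
have [h|h] := leP 1 (e / 2); first by have := mulr_ge0 A0 I0; lra.
have : (1 - e / 2) * (1 - e / 2) <= A * I by apply: ler_pM => //; lra.
by have := mulr_ge0 (ltW e0) (ltW e0); lra.
Qed.

Section Fixed.
Variables (X Y Z U V W Xh Zh : finType) (p : X * Y * Z -> R).
Variables (qu : Y -> U -> R) (qv : U -> Z -> V -> R) (qw : U -> V -> X -> W -> R).
Variables (dx : X -> Xh -> R) (dz : Z -> Zh -> R).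
Variables (xh : U -> W -> Z -> Xh) (zh : U -> V -> X -> Zh).
Hypothesis pp : is_pmf p.
Hypothesis mk : markov_YXZ p.
Hypothesis qup : forall y, is_pmf (qu y).
Hypothesis qvp : forall u z, is_pmf (qv u z).
Hypothesis qwp : forall u v x, is_pmf (qw u v x).
Hypothesis dx0 : forall x xh, 0 <= dx x xh.
Hypothesis dz0 : forall z zh, 0 <= dz z zh.

Notation O := (X * Y * Z * U * V * W)%type.
Notation P := (aux_pmf p qu qv qw).
Let oX (o : O) := o.1.1.1.1.1.
Let oY (o : O) := o.1.1.1.1.2.
Let oZ (o : O) := o.1.1.1.2.
Let oU (o : O) := o.1.1.2.
Let oV (o : O) := o.1.2.
Let oW (o : O) := o.2.
Variables (u0 : U) (v0 : V) (w0 : W).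

Let ez := condk P oU oZ u0.
Let ex := condk P oU oX u0.
Let ev u x := condk P oV (fun o => (oU o, oX o)) v0 (u, x).
Let ew u v z := condk P oW (fun o => (oU o, oV o, oZ o)) w0 (u, v, z).

Let P0 := aux_pmf_ge0 pp qup qvp qwp.

Lemma condk_gt0 (TA TC : finType) (A : O -> TA) (C : O -> TC) a0 o :
  0 < P o -> 0 < condk P A C a0 (C o) (A o).
Proof.
move=> Po; have C0 := pushpmf_gt0 C P0 Po.
rewrite /condk gt_eqF // divr_gt0 //.
exact: (pushpmf_gt0 (fun o => (A o, C o)) P0 Po).
Qed.

Lemma aux_factors_gt0 o : 0 < P o ->
  [/\ 0 < qu (oY o) (oU o), 0 < qv (oU o) (oZ o) (oV o) & 0 < qw (oU o) (oV o) (oX o) (oW o)].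
Proof.
case: o => [[[[[x y] z] u] v] w]; rewrite /oX /oY /oZ /oU /oV /oW /=.
have [a0 _] := qup y; have [b0 _] := qvp u z; have [c0 _] := qwp u v x.
have {a0}a0 := a0 u; have {b0}b0 := b0 v; have {c0}c0 := c0 w.
move=> H; split; rewrite lt0r ?a0 ?b0 ?c0 andbT; apply: contraTneq H => ->;
  by rewrite ?(mulr0, mul0r) ltxx.
Qed.

(** Splits a rate into the two mean logarithms that [rate_params] takes as [mua] and [mue]. *)
Lemma log_ratio_condk (TA TC : finType) (A : O -> TA) (C : O -> TC) a0 (k : O -> R) :
  (forall o, 0 < P o -> 0 < k o) ->
  \sum_o P o * log2 (k o * pushpmf P C (C o) / pushpmf P (fun o => (A o, C o)) (A o, C o))
  = expect P (fun o => log2 (k o)) - expect P (fun o => log2 (condk P A C a0 (C o) (A o))).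
Proof.
move=> k0; rewrite /expect -sumrB; apply: eq_bigr => o _.
have := P0 o; rewrite le0r => /orP[/eqP->|Po]; first by rewrite !mul0r subr0.
have C0 := pushpmf_gt0 C P0 Po.
have A0 := pushpmf_gt0 (fun o => (A o, C o)) P0 Po.
rewrite -mulrBr /condk gt_eqF // !log2_div ?mulr_gt0 ?k0 // log2M ?k0 //.
by congr (_ * _); ring.
Qed.

(** The seven logarithms control the hash thresholds and the last two entries the distortions, so
    that a single typical set handles both. *)
Definition typ_fun (j : 'I_9) (o : O) : R :=
  nth 0 [:: log2 (qu (oY o) (oU o)); log2 (ez (oZ o) (oU o)); log2 (ex (oX o) (oU o));
    log2 (qv (oU o) (oZ o) (oV o)); log2 (ev (oU o) (oX o) (oV o));
    log2 (qw (oU o) (oV o) (oX o) (oW o)); log2 (ew (oU o) (oV o) (oZ o) (oW o));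
    dx (oX o) (xh (oU o) (oW o) (oZ o)); dz (oZ o) (zh (oU o) (oV o) (oX o))] j.

(** [one_shot] treats blocks as letters of a six-fold product, whereas typicality concerns a block
    of six-tuples. *)
Definition zip6 n (t : {ffun 'I_n -> X} * {ffun 'I_n -> Y} * {ffun 'I_n -> Z}
    * {ffun 'I_n -> U} * {ffun 'I_n -> V} * {ffun 'I_n -> W}) : {ffun 'I_n -> O} :=
  [ffun i => (t.1.1.1.1.1 i, t.1.1.1.1.2 i, t.1.1.1.2 i, t.1.1.2 i, t.1.2 i, t.2 i)].

Lemma zip6_bij n : bijective (@zip6 n).
Proof.
exists (fun w : {ffun 'I_n -> O} => ([ffun i => oX (w i)], [ffun i => oY (w i)], [ffun i => oZ (w i)],
   [ffun i => oU (w i)], [ffun i => oV (w i)], [ffun i => oW (w i)])).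
  move=> [[[[[x y] z] u] v] w]; rewrite /zip6 /oX /oY /oZ /oU /oV /oW /=.
  by congr (_, _, _, _, _, _); apply/ffunP => i; rewrite !ffunE.
move=> w; apply/ffunP => i; rewrite /zip6 !ffunE /= /oX /oY /oZ /oU /oV /oW.
by case: (w i) => [[[[[]]]]].
Qed.

Let pn n (t : {ffun 'I_n -> X} * {ffun 'I_n -> Y} * {ffun 'I_n -> Z}) : R :=
  \prod_i p (t.1.1 i, t.1.2 i, t.2 i).
Let qun n (y : {ffun 'I_n -> Y}) (u : {ffun 'I_n -> U}) : R := \prod_i qu (y i) (u i).
Let ezn n (z : {ffun 'I_n -> Z}) (u : {ffun 'I_n -> U}) : R := \prod_i ez (z i) (u i).
Let exn n (x : {ffun 'I_n -> X}) (u : {ffun 'I_n -> U}) : R := \prod_i ex (x i) (u i).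
Let qvn n (u : {ffun 'I_n -> U}) (z : {ffun 'I_n -> Z}) (v : {ffun 'I_n -> V}) : R :=
  \prod_i qv (u i) (z i) (v i).
Let evn n (u : {ffun 'I_n -> U}) (x : {ffun 'I_n -> X}) (v : {ffun 'I_n -> V}) : R :=
  \prod_i ev (u i) (x i) (v i).
Let qwn n (u : {ffun 'I_n -> U}) (v : {ffun 'I_n -> V}) (x : {ffun 'I_n -> X})
  (w : {ffun 'I_n -> W}) : R := \prod_i qw (u i) (v i) (x i) (w i).
Let ewn n (u : {ffun 'I_n -> U}) (v : {ffun 'I_n -> V}) (z : {ffun 'I_n -> Z})
  (w : {ffun 'I_n -> W}) : R := \prod_i ew (u i) (v i) (z i) (w i).

Lemma prod_kernel2_pmf n (A B C : finType) (k : A -> B -> C -> R) (a : {ffun 'I_n -> A})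
   (b : {ffun 'I_n -> B}) : (forall a b, is_pmf (k a b)) ->
  is_pmf (fun c : {ffun 'I_n -> C} => \prod_i k (a i) (b i) (c i)).
Proof.
move=> kp.
have := prod_kernel_pmf (k := fun t : A * B => k t.1 t.2) [ffun i => (a i, b i)] (fun t => kp t.1 t.2).
by under eq_fun => c do under eq_bigr do rewrite ffunE.
Qed.

Lemma prod_kernel3_pmf n (A B D C : finType) (k : A -> B -> D -> C -> R) (a : {ffun 'I_n -> A})
   (b : {ffun 'I_n -> B}) (d : {ffun 'I_n -> D}) : (forall a b d, is_pmf (k a b d)) ->
  is_pmf (fun c : {ffun 'I_n -> C} => \prod_i k (a i) (b i) (d i) (c i)).
Proof.
move=> kp.
have := prod_kernel_pmf (k := fun t : A * B * D => k t.1.1 t.1.2 t.2)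
  [ffun i => (a i, b i, d i)] (fun t => kp t.1.1 t.1.2 t.2).
by under eq_fun => c do under eq_bigr do rewrite ffunE.
Qed.

Lemma aux_pmf_zip6 n t :
  aux_pmf (@pn n) (@qun n) (@qvn n) (@qwn n) t = \prod_i P (zip6 t i).
Proof.
case: t => [[[[[x y] z] u] v] w]; rewrite /aux_pmf /pn /qun /qvn /qwn /= -!big_split /=.
by apply: eq_bigr => i _; rewrite ffunE.
Qed.

Let D1 := expect P (fun o => dx (oX o) (xh (oU o) (oW o) (oZ o))).
Let D2 := expect P (fun o => dz (oZ o) (zh (oU o) (oV o) (oX o))).

Lemma single_letter_achievable (Dx Dz : R) (r : R * R * R) (gam : R) :
  0 < gam -> cmi P oY oU oZ <= r.1.1 -> cmi P oZ oV (fun o => (oU o, oX o)) <= r.1.2 ->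
  cmi P oX oW (fun o => (oU o, oV o, oZ o)) <= r.2 -> D1 <= Dx -> D2 <= Dz ->
  achievable p dx dz Dx Dz (r.1.1 + gam, r.1.2 + gam, r.2 + gam).
Proof.
move=> gam0 r1 r2 r3 dD1 dD2 eps eps0.
have Pp := aux_pmf_is_pmf pp qup qvp qwp.
pose Bx := \sum_x \sum_xh dx x xh; pose Bz := \sum_z \sum_zh dz z zh.
have Bx0 : 0 <= Bx by apply: sumr_ge0 => x _; apply: sumr_ge0.
have Bz0 : 0 <= Bz by apply: sumr_ge0 => x _; apply: sumr_ge0.
(* The failure probability: it costs at most [eps / 2] in either distortion. The added 1 keeps the
   denominator positive when both measures vanish. *)
pose e2 := eps / (2 * (Bx + Bz + 1)).
have B0 : 0 < 2 * (Bx + Bz + 1) by lra.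
have e20 : 0 < e2 by rewrite divr_gt0.
have e2B : (Bx + Bz + 1) * e2 = eps / 2 by rewrite /e2; field; rewrite gt_eqF //; lra.
(* The hash loss is at most [9 * eta = e2 / 2]; the atypical set takes the other half of [e2]. *)
pose eta := e2 / 18; have eta0 : 0 < eta by rewrite divr_gt0.
(* The first bound covers the slack [4 * d] of [rate_params], the second the distortion of a typical
   block. *)
pose d := Num.min (gam / 4) (eps / 2).
have d0 : 0 < d by rewrite lt_min !divr_gt0.
have dgam : 4 * d <= gam.
  suff : d <= gam / 4 by lra.
  by rewrite ge_min lexx.
have deps : d <= eps / 2 by rewrite ge_min lexx orbT.
have D10 : 0 <= Dx + d.
  by apply/addr_ge0/ltW => //; apply: le_trans dD1; apply: sumr_ge0 => o _; rewrite mulr_ge0 // P0.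
have D20 : 0 <= Dz + d.
  by apply/addr_ge0/ltW => //; apply: le_trans dD2; apply: sumr_ge0 => o _; rewrite mulr_ge0 // P0.
have HBx : Dx + d + Bx * e2 <= Dx + eps.
  have : Bx * e2 <= (Bx + Bz + 1) * e2 by rewrite ler_wpM2r ?(ltW e20) //; lra.
  by rewrite e2B; lra.
have HBz : Dz + d + Bz * e2 <= Dz + eps.
  have : Bz * e2 <= (Bx + Bz + 1) * e2 by rewrite ler_wpM2r ?(ltW e20) //; lra.
  by rewrite e2B; lra.
have e22 : 0 < e2 / 2 by rewrite divr_gt0.
have [N1 HN1] := typical_prob typ_fun Pp d0 e22.
have [N2 HN2] := rate_params d0 eta0.
exists (maxn N1 (maxn N2 1)) => n; rewrite !geq_max => /and3P[nN1 nN2 n1].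
have n0 : 0 < n%:R :> R by rewrite ltr0n.
have rt1 : 0 <= r.1.1 + gam.
  by rewrite addr_ge0 ?(ltW gam0) //; apply: le_trans r1; apply: cmi_ge0.
have rt2 : 0 <= r.1.2 + gam.
  by rewrite addr_ge0 ?(ltW gam0) //; apply: le_trans r2; apply: cmi_ge0.
have rt3 : 0 <= r.2 + gam.
  by rewrite addr_ge0 ?(ltW gam0) //; apply: le_trans r3; apply: cmi_ge0.
pose mu j := expect P (typ_fun j).
pose j0 := @Ordinal 9 0 isT; pose j1 := @Ordinal 9 1 isT; pose j2 := @Ordinal 9 2 isT.
pose j3 := @Ordinal 9 3 isT; pose j4 := @Ordinal 9 4 isT; pose j5 := @Ordinal 9 5 isT.
pose j6 := @Ordinal 9 6 isT; pose j7 := @Ordinal 9 7 isT; pose j8 := @Ordinal 9 8 isT.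
have [F1 [M1 [M10 M1r F1a F1e]]] := HN2 n nN2 (mu j0) _ rt1.
have [F2 [M2 [M20 M2r F2a F2e]]] := HN2 n nN2 (mu j3) _ rt2.
have [F3 [M3 [M30 M3r F3a F3e]]] := HN2 n nN2 (mu j5) _ rt3.
exists M1, M2, M3; split => //.
have c1 : mu j0 - mu j1 + 4 * d <= r.1.1 + gam.
  suff : cmi P oY oU oZ = mu j0 - mu j1 by move=> E; lra.
  rewrite (aux_cmi1E pp qup qvp qwp) (log_ratio_condk oU oZ u0 (k := fun o => qu (oY o) (oU o))) //.
  by move=> o /aux_factors_gt0[].
have c1' : mu j0 - mu j2 + 4 * d <= r.1.1 + gam.
  by have le12 : mu j1 <= mu j2 := aux_log_decoders pp qup qvp qwp u0 mk; lra.
have c2 : mu j3 - mu j4 + 4 * d <= r.1.2 + gam.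
  suff : cmi P oZ oV (fun o => (oU o, oX o)) = mu j3 - mu j4 by move=> E; lra.
  rewrite (aux_cmi2E pp qup qvp qwp) (log_ratio_condk oV (fun o => (oU o, oX o)) v0
     (k := fun o => qv (oU o) (oZ o) (oV o))) //.
  by move=> o /aux_factors_gt0[].
have c3 : mu j5 - mu j6 + 4 * d <= r.2 + gam.
  suff : cmi P oX oW (fun o => (oU o, oV o, oZ o)) = mu j5 - mu j6 by move=> E; lra.
  rewrite (aux_cmi3E pp qup qvp qwp) (log_ratio_condk oW (fun o => (oU o, oV o, oZ o)) w0
     (k := fun o => qw (oU o) (oV o) (oX o) (oW o))) //.
  by move=> o /aux_factors_gt0[].
pose G (t : {ffun 'I_n -> X} * {ffun 'I_n -> Y} * {ffun 'I_n -> Z}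
    * {ffun 'I_n -> U} * {ffun 'I_n -> V} * {ffun 'I_n -> W}) := typical P typ_fun d (zip6 t).
have HG x y z u v w : G (x, y, z, u, v, w) ->
    [/\ F1%:R * qun y u <= eta, 1 <= eta * (F1.+1%:R * M1%:R * ezn z u)
      & 1 <= eta * (F1.+1%:R * M1%:R * exn x u)] /\
    [/\ F2%:R * qvn u z v <= eta, 1 <= eta * (F2.+1%:R * M2%:R * evn u x v),
        F3%:R * qwn u v x w <= eta & 1 <= eta * (F3.+1%:R * M3%:R * ewn u v z w)].
  move=> /andP[/forallP T Ppos].
  have Pi i : 0 < P (zip6 (x, y, z, u, v, w) i).
    rewrite lt0r P0 andbT; apply: contraTneq Ppos => E.
    by rewrite (bigD1 i) //= E mul0r ltxx.
  have E (k : O -> R) : \prod_i k (zip6 (x, y, z, u, v, w) i) =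
      \prod_i k (x i, y i, z i, u i, v i, w i) by apply: eq_bigr => i _; rewrite ffunE.
  have B (k : O -> R) j : (forall o, 0 < P o -> 0 < k o) ->
      (forall o, typ_fun j o = log2 (k o)) ->
      2 `^ (n%:R * (mu j - d)) <= \prod_i k (x i, y i, z i, u i, v i, w i)
        <= 2 `^ (n%:R * (mu j + d)).
    move=> k0 kj; rewrite -E; apply: prod_pow2_bounds => [i|]; first exact/k0/Pi.
    by have := T j; rewrite /mu; under eq_bigr do rewrite kj.
  have k0 o : 0 < P o -> _ := @aux_factors_gt0 o.
  have /andP[_ b0] := B (fun o => qu (oY o) (oU o)) j0 (fun o h => let: And3 a _ _ := k0 o h in a) (fun=> erefl).
  have /andP[b1 _] := B (fun o => ez (oZ o) (oU o)) j1 (fun o h => condk_gt0 oU oZ u0 h) (fun=> erefl).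
  have /andP[b2 _] := B (fun o => ex (oX o) (oU o)) j2 (fun o h => condk_gt0 oU oX u0 h) (fun=> erefl).
  have /andP[_ b3] := B (fun o => qv (oU o) (oZ o) (oV o)) j3 (fun o h => let: And3 _ a _ := k0 o h in a) (fun=> erefl).
  have /andP[b4 _] := B (fun o => ev (oU o) (oX o) (oV o)) j4
    (fun o h => condk_gt0 oV (fun o => (oU o, oX o)) v0 h) (fun=> erefl).
  have /andP[_ b5] := B (fun o => qw (oU o) (oV o) (oX o) (oW o)) j5 (fun o h => let: And3 _ _ a := k0 o h in a) (fun=> erefl).
  have /andP[b6 _] := B (fun o => ew (oU o) (oV o) (oZ o) (oW o)) j6
    (fun o h => condk_gt0 oW (fun o => (oU o, oV o, oZ o)) w0 h) (fun=> erefl).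
  split; split.
  - exact: F1a b0.
  - exact: F1e c1 b1.
  - exact: F1e c1' b2.
  - exact: F2a b3.
  - exact: F2e c2 b4.
  - exact: F3a b5.
  - exact: F3e c3 b6.
have [p0 _] := pp.
have pn0 t : 0 <= @pn n t by apply: prodr_ge0.
have [k1 [b1 [dZ [dX [k2 [b2 [d2 [k3 [b3 [d3 HS]]]]]]]]]] :=
  one_shot pn0 (ltW eta0) M10 M20 M30
   (fun y => prod_kernel_pmf y qup)
   (fun z => prod_kernel_pmf z (fun z => condk_pmf oU oZ u0 z P0))
   (fun x => prod_kernel_pmf x (fun x => condk_pmf oU oX u0 x P0))
   (fun u z => prod_kernel2_pmf u z qvp)
   (fun u x => prod_kernel2_pmf u x (fun u x => condk_pmf oV (fun o => (oU o, oX o)) v0 (u, x) P0))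
   (fun u v x => prod_kernel3_pmf u v x qwp)
   (fun u v z => prod_kernel3_pmf u v z
      (fun u v z => condk_pmf oW (fun o => (oU o, oV o, oZ o)) w0 (u, v, z) P0)) HG.
pose succ (t : {ffun 'I_n -> X} * {ffun 'I_n -> Y} * {ffun 'I_n -> Z}) : bool :=
    (let u := k1 t.1.2 in let v := k2 u t.2 in let w := k3 u v t.1.1 in
     [&& G (t, u, v, w), dZ t.2 (b1 u) == u, dX t.1.1 (b1 u) == u,
         d2 u t.1.1 (b2 v) == v & d3 u v t.2 (b3 w) == w]).
pose s3 (w : {ffun 'I_n -> X * Y * Z}) := succ (xseq w, yseq w, zseq w).
have s3bij : bijective (fun w : {ffun 'I_n -> X * Y * Z} => (xseq w, yseq w, zseq w)).
  exists (fun t : {ffun 'I_n -> X} * {ffun 'I_n -> Y} * {ffun 'I_n -> Z} =>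
    [ffun i => (t.1.1 i, t.1.2 i, t.2 i)]).
    by move=> w; apply/ffunP => i; rewrite !ffunE /=; case: (w i) => [[]].
  by move=> [[x y] z]; congr (_, _, _); apply/ffunP => i; rewrite !ffunE.
have Hs3 : 1 - e2 <= \sum_(w : {ffun 'I_n -> X * Y * Z}) iid_pmf p w * (s3 w)%:R.
  have -> : \sum_(w : {ffun 'I_n -> X * Y * Z}) iid_pmf p w * (s3 w)%:R
     = \sum_t pn t * (succ t)%:R.
    rewrite [RHS](reindex _ (onW_bij _ s3bij)) /=; apply: eq_bigr => w _; congr (_ * _).
    by rewrite /iid_pmf /pn; apply: eq_bigr => i _; rewrite !ffunE /=; case: (w i) => [[]].
  have HS' : (\sum_(o | G o) aux_pmf (@pn n) (@qun n) (@qvn n) (@qwn n) o) / (1 + eta) ^+ 9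
     <= \sum_t pn t * (succ t)%:R := HS.
  apply: le_trans HS'.
  have -> : \sum_(o | G o) aux_pmf (@pn n) (@qun n) (@qvn n) (@qwn n) o
     = \sum_(w : {ffun 'I_n -> O} | typical P typ_fun d w) \prod_i P (w i).
    rewrite [RHS](reindex _ (onW_bij _ (zip6_bij n))) /=; apply: eq_bigr => t _.
    exact: aux_pmf_zip6.
  have := HN1 n nN1; set A := \sum_(w | _) _ => HA.
  have A0 : 0 <= A by apply: sumr_ge0 => w _; apply: prodr_ge0 => i _; exact: P0.
  have I1 := inv_exp9_ge (ltW eta0).
  have I0 : 0 <= ((1 + eta) ^+ 9)^-1 by rewrite invr_ge0 exprn_ge0 // addr_ge0 // ltW.
  have e9 : 9 * eta = e2 / 2 by rewrite /eta; field.
  move: I1 I0; set I := _^-1 => I1 I0; rewrite e9 in I1.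
  exact: prod_ge_1sub.
have iidp : is_pmf (@iid_pmf R X Y Z p n) := prod_pmf 'I_n pp.
(* User Z obtains [v] by applying [k2] to its own block; User X has to use its decoded [u] and [v],
   both in its message and in its reconstruction. On success they are the true ones. *)
exists (fun y => b1 (k1 y)), (fun z m => b2 (k2 (dZ z m) z)),
  (fun x m1 m2 => b3 (k3 (dX x m1) (d2 (dX x m1) x m2) x)),
  (fun x m1 m2 => [ffun i => zh (dX x m1 i) (d2 (dX x m1) x m2 i) (x i)]),
  (fun z m1 m3 => [ffun i => xh (dZ z m1 i) (d3 (dZ z m1) (k2 (dZ z m1) z) z m3 i) (z i)]).
have Tavg j (f : 'I_n -> R) x y z u v w : G (x, y, z, u, v, w) ->
   (forall i, f i = typ_fun j (x i, y i, z i, u i, v i, w i)) ->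
   n%:R^-1 * \sum_i f i <= mu j + d.
  move=> /andP[/forallP/(_ j) T _] fj; rewrite mulrC ler_pdivrMr // mulrDl.
  move: T; rewrite -/(mu j) ler_norml => /andP[_ T].
  under eq_bigr do rewrite fj.
  have <- : \sum_i typ_fun j (zip6 (x, y, z, u, v, w) i) =
      \sum_i typ_fun j (x i, y i, z i, u i, v i, w i) by apply: eq_bigr => i _; rewrite ffunE.
  by rewrite -lerBlDl [mu j * _]mulrC [d * _]mulrC.
cbv zeta; split.
- apply: (@le_trans _ _ (Dx + d + Bx * e2)) => //.
  apply: (expect_success_bound (s := s3)) => //.
    by move=> w; apply: avg_dist_le => // i; exact: dist_le_total.
  move=> w; rewrite /s3 /succ; move: (xseq w) (yseq w) (zseq w) => x y z /= /and5P[HGw /eqP E1 /eqP E2 /eqP E3 /eqP E4].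
  rewrite E1 E2 E3 E4; apply: (@le_trans _ _ (mu j7 + d)); last by rewrite lerD2r.
  by rewrite /avg_dist; apply: (Tavg j7 _ x y z _ _ _ HGw) => i; rewrite ffunE.
apply: (@le_trans _ _ (Dz + d + Bz * e2)) => //.
apply: (expect_success_bound (s := s3)) => //.
  by move=> w; apply: avg_dist_le => // i; exact: dist_le_total.
move=> w; rewrite /s3 /succ; move: (xseq w) (yseq w) (zseq w) => x y z /= /and5P[HGw /eqP E1 /eqP E2 /eqP E3 /eqP E4].
rewrite E1 E2 E3; apply: (@le_trans _ _ (mu j8 + d)); last by rewrite lerD2r.
by rewrite /avg_dist; apply: (Tavg j8 _ x y z _ _ _ HGw) => i; rewrite ffunE.
Qed.

End Fixed.

Lemma region_sub_RO (X Y Z Xh Zh : finType)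
  (p : X * Y * Z -> R) (dx : X -> Xh -> R) (dz : Z -> Zh -> R) (Dx Dz : R) r :
  is_pmf p -> markov_YXZ p ->
  (forall x xh, 0 <= dx x xh) -> (forall z zh, 0 <= dz z zh) ->
  region p dx dz Dx Dz r -> RO p dx dz Dx Dz r.
Proof.
move=> pp mk dx0 dz0 [U [V [W [qu [qv [qw [xh [zh /= [qup [qvp [qwp [r1 [r2 [r3 [h1 h2]]]]]]]]]]]]]]].
have [[[x y] z] _] := pmf_inhabited pp.
have [u0 _] := pmf_inhabited (qup y).
have [v0 _] := pmf_inhabited (qvp u0 z).
have [w0 _] := pmf_inhabited (qwp u0 v0 x).
move=> B /nbhs_ballP[e /= e0 Be].
exists (r.1.1 + e / 2, r.1.2 + e / 2, r.2 + e / 2); split.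
  by apply: (single_letter_achievable pp mk qup qvp qwp dx0 dz0 u0 v0 w0 (xh := xh) (zh := zh)) => //; rewrite divr_gt0.
apply: Be; rewrite /ball /=.
have b a : `|a - (a + e / 2)| < e.
  by rewrite opprD addrA subrr add0r normrN ger0_norm ?divr_ge0 ?(ltW e0) //; move: e0; lra.
by split; [split|]; exact: b.
Qed.

End Achievability.

(** * Cardinality bounds *)

Section Caratheodory.
Variable R : realType.

(** More points than constraints force a linear dependency; its sign is chosen so that some entry is
    positive. *)
Lemma kernel_vector (J T : finType) (A : J -> T -> R) (S : {set T}) : (#|J| < #|S|)%N ->
  exists mu : T -> R, [/\ forall j, \sum_t mu t * A j t = 0, forall t, t \notin S -> mu t = 0
    & exists t, 0 < mu t].
Proof.
move=> JS.
pose B : 'M[R]_(#|S|, #|J|) := \matrix_(i, j) A (enum_val j) (enum_val i).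
have : kermx B != 0.
  rewrite kermx_eq0 /row_free; apply/negP => /eqP E.
  by have := rank_leq_col B; rewrite E leqNgt JS.
case/rowV0Pn => v /sub_kermxP vB v0.
have [i vi] : exists i, v ord0 i != 0.
  apply/existsP; apply: contraNT v0; rewrite negb_exists => /forallP H.
  by apply/eqP/rowP => i; rewrite mxE; move: (H i); rewrite negbK => /eqP.
pose mu s t : R := s * \sum_i v ord0 i * (enum_val i == t)%:R.
have mu_val s k : mu s (enum_val k) = s * v ord0 k.
  congr (_ * _); rewrite (bigD1 k) //= eqxx mulr1 big1 ?addr0 // => l lk.
  by rewrite (inj_eq enum_val_inj) (negPf lk) mulr0.
have mu0 s j : \sum_t mu s t * A j t = 0.
  have E : (v *m B) ord0 (enum_rank j) = 0 by rewrite vB mxE.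
  rewrite -[RHS](mulr0 s) -[in RHS]E mxE !mulr_sumr.
  under eq_bigr do rewrite -mulrA mulr_suml mulr_sumr.
  rewrite exchange_big /=; apply: eq_bigr => k _; rewrite mxE enum_rankK.
  rewrite (bigD1 (enum_val k)) //= eqxx mulr1 big1 ?addr0 // => t /negPf tk.
  by rewrite eq_sym tk mulr0 mul0r mulr0.
have muS s t : t \notin S -> mu s t = 0.
  move=> tS; rewrite /mu big1 ?mulr0 // => k _.
  case: eqP => [E|_]; last by rewrite mulr0.
  by move: tS; rewrite -E enum_valP.
have [vp|vn] := ltP 0 (v ord0 i).
  by exists (mu 1); split; [exact: mu0|exact: muS|exists (enum_val i); rewrite mu_val mul1r].
exists (mu (-1)); split; [exact: mu0|exact: muS|exists (enum_val i)]; rewrite mu_val mulN1r oppr_gt0.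
by rewrite lt_neqAle vi.
Qed.

(** Moving along a dependency changes none of the sums; one stops when a coordinate first reaches 0,
    which shrinks the support. *)
Lemma support_reduction (J T : finType) (A : J -> T -> R) (la : T -> R) :
  (forall t, 0 <= la t) ->
  exists la' : T -> R, [/\ forall t, 0 <= la' t,
    forall j, \sum_t la' t * A j t = \sum_t la t * A j t
    & (#|[set t | la' t != 0%R]| <= #|J|)%N].
Proof.
move: {2}#|_|.+1 (ltnSn #|[set t | la t != 0]|) => n.
elim: n la => // n IH la Hn la0.
have [le|lt] := leqP #|[set t | la t != 0]| #|J|; first by exists la.
have [mu [mu0 muS [t1 mut1]]] := kernel_vector A lt.
(* The smallest ratio marks the coordinate that vanishes first, so the others stay nonnegative. *)
have [t2 mut2 tmin] := @arg_minP _ _ T t1 (fun t => 0 < mu t) (fun t => la t / mu t) mut1.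
pose th := la t2 / mu t2.
have th0 : 0 <= th by rewrite divr_ge0 // ltW.
pose la2 t := la t - th * mu t.
have la20 t : 0 <= la2 t.
  rewrite subr_ge0; have [mup|mun] := ltP 0 (mu t); last first.
    by apply: le_trans (la0 t); rewrite mulr_ge0_le0.
  by rewrite -ler_pdivlMr //; exact: tmin.
have [|la' [h1 h2 h3]] := IH la2 _ la20.
  rewrite ltnS in Hn; apply: leq_trans Hn; apply: proper_card; apply/properP; split.
    apply/fintype.subsetP => t; rewrite !inE; apply: contraNneq => E.
    by rewrite /la2 E muS ?mulr0 ?subrr // inE E eqxx.
  exists t2; rewrite !inE; last by rewrite /la2 /th divfK ?subrr ?eqxx // gt_eqF.
  apply: contraTneq mut2 => E; rewrite -leNgt muS // inE E eqxx //.
exists la'; split=> // j; rewrite h2.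
under eq_bigr do rewrite mulrBl; rewrite sumrB.
by under [X in _ - X]eq_bigr do rewrite -mulrA; rewrite -mulr_sumr mu0 mulr0 subr0.
Qed.

(** The conic form, started from unit weights: normalisation is one of the constraints the caller
    lists in [J], so there is no extra point. Smaller supports are padded with zero weights. *)
Lemma caratheodory (J T : finType) (A : J -> T -> R) (t0 : T) :
  exists (t : 'I_#|J| -> T) (la : 'I_#|J| -> R),
    (forall k, 0 <= la k) /\ forall j, \sum_k la k * A j (t k) = \sum_t A j t.
Proof.
have [|la [la0 laE laS]] := @support_reduction J T A (fun=> 1).
  by move=> _; exact: ler01.
set S := [set t | la t != 0] in laS.
exists (fun k => nth t0 (enum S) k), (fun k => if (k < #|S|)%N then la (nth t0 (enum S) k) else 0).
split=> [k|j]; first by case: ifP.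
transitivity (\sum_t la t * A j t); last first.
  by rewrite laE; apply: eq_bigr => t _; rewrite mul1r.
transitivity (\sum_(t in S) la t * A j t); last first.
  rewrite [RHS](bigID (mem S)) /= [X in _ = _ + X]big1 ?addr0 // => t.
  by rewrite inE negbK => /eqP->; rewrite mul0r.
rewrite -[RHS]big_enum /= [RHS](big_nth t0) -cardE.
rewrite -(big_mkord xpredT (fun k => (if (k < #|S|)%N then la (nth t0 (enum S) k) else 0) * A j (nth t0 (enum S) k))).
rewrite (big_cat_nat (n := #|S|)) //= [X in _ + X]big_nat_cond [X in _ + X]big1 ?addr0.
  by apply: eq_big_nat => k /andP[_ ->].
by move=> k /andP[/andP[]]; rewrite leqNgt => /negPf->; rewrite mul0r.
Qed.

End Caratheodory.

(** * Rates and distortions as sums of homogeneous functions of kernel columns *)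

Section Functionals.
Variables (R : realType) (X Y Z Xh Zh : finType) (p : X * Y * Z -> R).
Variables (dx : X -> Xh -> R) (dz : Z -> Zh -> R).
Implicit Types (c : Y -> R) (e : Z -> R) (g : X -> R) (t : X * Y * Z).

(* Contributions of single values of [U], [V], [W] to the three rates and the two
   distortions; c, e and g are the corresponding columns of the kernels. *)
Definition Fu c : R := \sum_t p t * c t.1.2 *
  log2 (c t.1.2 * (\sum_(s | s.2 == t.2) p s) / \sum_(s | s.2 == t.2) p s * c s.1.2).
Definition Fv c e : R := \sum_t p t * c t.1.2 * e t.2 *
  log2 (e t.2 * (\sum_(s | s.1.1 == t.1.1) p s * c s.1.2)
        / \sum_(s | s.1.1 == t.1.1) p s * c s.1.2 * e s.2).
Definition Fw c e g : R := \sum_t p t * c t.1.2 * e t.2 * g t.1.1 *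
  log2 (g t.1.1 * (\sum_(s | s.2 == t.2) p s * c s.1.2 * e s.2)
        / \sum_(s | s.2 == t.2) p s * c s.1.2 * e s.2 * g s.1.1).
Definition Gx c e g (h : Z -> Xh) : R :=
  \sum_t p t * c t.1.2 * e t.2 * g t.1.1 * dx t.1.1 (h t.2).
Definition Gz c e (h : X -> Zh) : R :=
  \sum_t p t * c t.1.2 * e t.2 * dz t.2 (h t.1.1).

Lemma ratio_scale (l a b d : R) : l != 0 -> l * a * b / (l * d) = a * b / d.
Proof. by move=> l0; rewrite -[l * a * b]mulrA -mulf_div divff // mul1r. Qed.

Lemma ratio_scale_r (l a b d : R) : l != 0 -> a * (l * b) / (l * d) = a * b / d.
Proof. by move=> l0; rewrite mulrCA -mulf_div divff // mul1r. Qed.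

Lemma sum_scale (Q : pred (X * Y * Z)) (f f' : X * Y * Z -> R) l :
  (forall s, f s = l * f' s) -> \sum_(s | Q s) f s = l * \sum_(s | Q s) f' s.
Proof. by move=> E; rewrite mulr_sumr; apply: eq_bigr. Qed.

(** A nonzero scale cancels inside the logarithm; at [l = 0] the factor in front vanishes. The same
    division recurs in the next lemmas. *)
Lemma Fu_scale l c : Fu (fun y => l * c y) = l * Fu c.
Proof.
rewrite /Fu mulr_sumr; apply: eq_bigr => t _.
have [->|l0] := eqVneq l 0; first by rewrite !(mul0r, mulr0).
rewrite (sum_scale _ (f := fun s => p s * (l * c s.1.2)) (f' := fun s => p s * c s.1.2) (l := l)) => [|s]; last by ring.
by rewrite ratio_scale //; ring.
Qed.

Lemma Fv_scale_u l c e : Fv (fun y => l * c y) e = l * Fv c e.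
Proof.
rewrite /Fv mulr_sumr; apply: eq_bigr => t _.
have [->|l0] := eqVneq l 0; first by rewrite !(mul0r, mulr0).
rewrite (sum_scale _ (f := fun s => p s * (l * c s.1.2)) (f' := fun s => p s * c s.1.2) (l := l)) => [|s]; last by ring.
rewrite (sum_scale _ (f := fun s => p s * (l * c s.1.2) * e s.2)
   (f' := fun s => p s * c s.1.2 * e s.2) (l := l)) => [|s]; last by ring.
by rewrite ratio_scale_r //; ring.
Qed.

Lemma Fv_scale_v l c e : Fv c (fun z => l * e z) = l * Fv c e.
Proof.
rewrite /Fv mulr_sumr; apply: eq_bigr => t _.
have [->|l0] := eqVneq l 0; first by rewrite !(mul0r, mulr0).
rewrite (sum_scale _ (f := fun s => p s * c s.1.2 * (l * e s.2))
   (f' := fun s => p s * c s.1.2 * e s.2) (l := l)) => [|s]; last by ring.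
by rewrite ratio_scale //; ring.
Qed.

Lemma Fw_scale_u l c e g : Fw (fun y => l * c y) e g = l * Fw c e g.
Proof.
rewrite /Fw mulr_sumr; apply: eq_bigr => t _.
have [->|l0] := eqVneq l 0; first by rewrite !(mul0r, mulr0).
rewrite (sum_scale _ (f := fun s => p s * (l * c s.1.2) * e s.2)
   (f' := fun s => p s * c s.1.2 * e s.2) (l := l)) => [|s]; last by ring.
rewrite (sum_scale _ (f := fun s => p s * (l * c s.1.2) * e s.2 * g s.1.1)
   (f' := fun s => p s * c s.1.2 * e s.2 * g s.1.1) (l := l)) => [|s]; last by ring.
by rewrite ratio_scale_r //; ring.
Qed.

Lemma Fw_scale_v l c e g : Fw c (fun z => l * e z) g = l * Fw c e g.
Proof.
rewrite /Fw mulr_sumr; apply: eq_bigr => t _.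
have [->|l0] := eqVneq l 0; first by rewrite !(mul0r, mulr0).
rewrite (sum_scale _ (f := fun s => p s * c s.1.2 * (l * e s.2))
   (f' := fun s => p s * c s.1.2 * e s.2) (l := l)) => [|s]; last by ring.
rewrite (sum_scale _ (f := fun s => p s * c s.1.2 * (l * e s.2) * g s.1.1)
   (f' := fun s => p s * c s.1.2 * e s.2 * g s.1.1) (l := l)) => [|s]; last by ring.
by rewrite ratio_scale_r //; ring.
Qed.

Lemma Fw_scale_w l c e g : Fw c e (fun x => l * g x) = l * Fw c e g.
Proof.
rewrite /Fw mulr_sumr; apply: eq_bigr => t _.
have [->|l0] := eqVneq l 0; first by rewrite !(mul0r, mulr0).
rewrite (sum_scale _ (f := fun s => p s * c s.1.2 * e s.2 * (l * g s.1.1))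
   (f' := fun s => p s * c s.1.2 * e s.2 * g s.1.1) (l := l)) => [|s]; last by ring.
by rewrite ratio_scale //; ring.
Qed.

Lemma Gx_scale_u l c e g h : Gx (fun y => l * c y) e g h = l * Gx c e g h.
Proof. by apply: sum_scale => s; ring. Qed.

Lemma Gx_scale_v l c e g h : Gx c (fun z => l * e z) g h = l * Gx c e g h.
Proof. by apply: sum_scale => s; ring. Qed.

Lemma Gx_scale_w l c e g h : Gx c e (fun x => l * g x) h = l * Gx c e g h.
Proof. by apply: sum_scale => s; ring. Qed.

Lemma Gz_scale_u l c e h : Gz (fun y => l * c y) e h = l * Gz c e h.
Proof. by apply: sum_scale => s; ring. Qed.

Lemma Gz_scale_v l c e h : Gz c (fun z => l * e z) h = l * Gz c e h.
Proof. by apply: sum_scale => s; ring. Qed.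

Section Sums.
Variables (U V W : finType).
Variables (qu : Y -> U -> R) (qv : U -> Z -> V -> R) (qw : U -> V -> X -> W -> R).
Hypothesis pp : is_pmf p.
Hypothesis qup : forall y, is_pmf (qu y).
Hypothesis qvp : forall u z, is_pmf (qv u z).
Hypothesis qwp : forall u v x, is_pmf (qw u v x).

Notation O := (X * Y * Z * U * V * W)%type.
Notation P := (aux_pmf p qu qv qw).
Let oX (o : O) := o.1.1.1.1.1.
Let oY (o : O) := o.1.1.1.1.2.
Let oZ (o : O) := o.1.1.1.2.
Let oU (o : O) := o.1.1.2.
Let oV (o : O) := o.1.2.
Let oW (o : O) := o.2.

Lemma sum_aux4 (f : X * Y * Z * U -> R) :
  \sum_o P o * f o.1.1 = \sum_u \sum_t p t * qu t.1.2 u * f (t, u).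
Proof.
rewrite -(sum_pushpmf P (fun o => o.1.1) f) exchange_big /= pair_bigA /=.
by apply: eq_bigr => -[[[x y] z] u] _; rewrite (aux_push4 p qu qvp qwp).
Qed.

Lemma sum_aux5 (f : X * Y * Z * U * V -> R) :
  \sum_o P o * f o.1 = \sum_u \sum_v \sum_t p t * qu t.1.2 u * qv u t.2 v * f (t, u, v).
Proof.
rewrite -(sum_pushpmf P fst f).
rewrite (eq_bigr (fun o => p o.1.1 * qu o.1.1.1.2 o.1.2 * qv o.1.2 o.1.1.2 o.2 * f (o.1.1, o.1.2, o.2))).
  rewrite -(pair_bigA _ (fun tu v => p tu.1 * qu tu.1.1.2 tu.2 * qv tu.2 tu.1.2 v * f (tu.1, tu.2, v))) /=.
  rewrite -(pair_bigA _ (fun t u => \sum_v p t * qu t.1.2 u * qv u t.2 v * f (t, u, v))) /=.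
  by rewrite exchange_big /=; apply: eq_bigr => u _; rewrite exchange_big.
by move=> [[[[x y] z] u] v] _; rewrite (aux_push5 p qu qv qwp).
Qed.

Lemma sum_aux6 (f : O -> R) :
  \sum_o P o * f o = \sum_u \sum_v \sum_w \sum_t
     p t * qu t.1.2 u * qv u t.2 v * qw u v t.1.1 w * f (t, u, v, w).
Proof.
rewrite (eq_bigr (fun o => p o.1.1.1 * qu o.1.1.1.1.2 o.1.1.2 * qv o.1.1.2 o.1.1.1.2 o.1.2
   * qw o.1.1.2 o.1.2 o.1.1.1.1.1 o.2 * f (o.1.1.1, o.1.1.2, o.1.2, o.2))); last first.
  by move=> [[[[[x y] z] u] v] w] _.
rewrite -(pair_bigA _ (fun tuv w => p tuv.1.1 * qu tuv.1.1.1.2 tuv.1.2 * qv tuv.1.2 tuv.1.1.2 tuv.2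
   * qw tuv.1.2 tuv.2 tuv.1.1.1.1 w * f (tuv.1.1, tuv.1.2, tuv.2, w))) /=.
rewrite -(pair_bigA _ (fun tu v => \sum_w p tu.1 * qu tu.1.1.2 tu.2 * qv tu.2 tu.1.2 v
   * qw tu.2 v tu.1.1.1 w * f (tu.1, tu.2, v, w))) /=.
rewrite -(pair_bigA _ (fun t u => \sum_v \sum_w p t * qu t.1.2 u * qv u t.2 v
   * qw u v t.1.1 w * f (t, u, v, w))) /=.
rewrite exchange_big /=; apply: eq_bigr => u _; rewrite exchange_big; apply: eq_bigr => v _.
by rewrite exchange_big.
Qed.

Lemma push_sum (T : finType) (f : O -> T) a : pushpmf P f a = \sum_o P o * (f o == a)%:R.
Proof.
by rewrite /pushpmf big_mkcond; apply: eq_bigr => o _; case: eqP; rewrite ?mulr1 ?mulr0.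
Qed.

Lemma sum_ind (T : finType) (u : T) (F : T -> R) : \sum_u' F u' * (u' == u)%:R = F u.
Proof.
rewrite (bigD1 u) //= eqxx mulr1 big1 ?addr0 // => u' /negPf->.
by rewrite mulr0.
Qed.

Lemma push_UZ u z :
  pushpmf P (fun o => (oU o, oZ o)) (u, z) = \sum_(s | s.2 == z) p s * qu s.1.2 u.
Proof.
rewrite push_sum (sum_aux4 (fun o => ((o.2, o.1.2) == (u, z))%:R)) /=.
rewrite -(sum_ind u (fun u => \sum_(s | s.2 == z) p s * qu s.1.2 u)); apply: eq_bigr => u' _.
rewrite mulr_suml [RHS]big_mkcond; apply: eq_bigr => t _; rewrite xpair_eqE.
by case: (u' == u); case: (t.2 == z); rewrite ?mulr1 ?mulr0.
Qed.

Lemma push_UX u x :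
  pushpmf P (fun o => (oU o, oX o)) (u, x) = \sum_(s | s.1.1 == x) p s * qu s.1.2 u.
Proof.
rewrite push_sum (sum_aux4 (fun o => ((o.2, o.1.1.1) == (u, x))%:R)) /=.
rewrite -(sum_ind u (fun u => \sum_(s | s.1.1 == x) p s * qu s.1.2 u)); apply: eq_bigr => u' _.
rewrite mulr_suml [RHS]big_mkcond; apply: eq_bigr => t _; rewrite xpair_eqE.
by case: (u' == u); case: (t.1.1 == x); rewrite ?mulr1 ?mulr0.
Qed.

Lemma push_VUX u v x : pushpmf P (fun o => (oV o, (oU o, oX o))) (v, (u, x))
  = \sum_(s | s.1.1 == x) p s * qu s.1.2 u * qv u s.2 v.
Proof.
rewrite push_sum (sum_aux5 (fun o => ((o.2, (o.1.2, o.1.1.1.1)) == (v, (u, x)))%:R)) /=.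
rewrite -(sum_ind u (fun u => \sum_(s | s.1.1 == x) p s * qu s.1.2 u * qv u s.2 v)); apply: eq_bigr => u' _.
rewrite -(sum_ind v (fun v => \sum_(s | s.1.1 == x) p s * qu s.1.2 u' * qv u' s.2 v)) mulr_suml.
apply: eq_bigr => v' _.
rewrite !mulr_suml [RHS]big_mkcond; apply: eq_bigr => t _; rewrite !xpair_eqE.
by case: (u' == u); case: (v' == v); case: (t.1.1 == x); rewrite ?mulr1 ?mulr0.
Qed.

Lemma push_UVZ u v z : pushpmf P (fun o => (oU o, oV o, oZ o)) (u, v, z)
  = \sum_(s | s.2 == z) p s * qu s.1.2 u * qv u s.2 v.
Proof.
rewrite push_sum (sum_aux5 (fun o => ((o.1.2, o.2, o.1.1.2) == (u, v, z))%:R)) /=.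
rewrite -(sum_ind u (fun u => \sum_(s | s.2 == z) p s * qu s.1.2 u * qv u s.2 v)); apply: eq_bigr => u' _.
rewrite -(sum_ind v (fun v => \sum_(s | s.2 == z) p s * qu s.1.2 u' * qv u' s.2 v)) mulr_suml.
apply: eq_bigr => v' _.
rewrite !mulr_suml [RHS]big_mkcond; apply: eq_bigr => t _; rewrite !xpair_eqE.
by case: (u' == u); case: (v' == v); case: (t.2 == z); rewrite ?mulr1 ?mulr0.
Qed.

Lemma push_WUVZ u v w z : pushpmf P (fun o => (oW o, (oU o, oV o, oZ o))) (w, (u, v, z))
  = \sum_(s | s.2 == z) p s * qu s.1.2 u * qv u s.2 v * qw u v s.1.1 w.
Proof.
rewrite push_sum (sum_aux6 (fun o => ((o.2, (o.1.1.2, o.1.2, o.1.1.1.2)) == (w, (u, v, z)))%:R)) /=.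
rewrite -(sum_ind u (fun u => \sum_(s | s.2 == z) p s * qu s.1.2 u * qv u s.2 v * qw u v s.1.1 w)).
apply: eq_bigr => u' _.
rewrite -(sum_ind v (fun v => \sum_(s | s.2 == z) p s * qu s.1.2 u' * qv u' s.2 v * qw u' v s.1.1 w)) mulr_suml.
apply: eq_bigr => v' _.
rewrite -(sum_ind w (fun w => \sum_(s | s.2 == z) p s * qu s.1.2 u' * qv u' s.2 v' * qw u' v' s.1.1 w)) !mulr_suml.
apply: eq_bigr => w' _.
rewrite !mulr_suml [RHS]big_mkcond; apply: eq_bigr => t _; rewrite !xpair_eqE.
by case: (u' == u); case: (v' == v); case: (w' == w); case: (t.2 == z); rewrite ?mulr1 ?mulr0.
Qed.

Lemma push_Z z : pushpmf P oZ z = \sum_(s | s.2 == z) p s.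
Proof.
rewrite (pushpmf_comp P (fun o => o.1.1.1) snd); apply: eq_bigr => t _.
exact: aux_push3.
Qed.

Lemma cmi1_sum : cmi P oY oU oZ = \sum_u Fu (fun y => qu y u).
Proof.
rewrite (aux_cmi1E pp qup qvp qwp).
rewrite (sum_aux4 (fun o => log2 (qu o.1.1.2 o.2 * pushpmf P oZ o.1.2
   / pushpmf P (fun o => (oU o, oZ o)) (o.2, o.1.2)))).
by apply: eq_bigr => u _; apply: eq_bigr => t _; rewrite push_UZ push_Z.
Qed.

Lemma cmi2_sum : cmi P oZ oV (fun o => (oU o, oX o))
  = \sum_u \sum_v Fv (fun y => qu y u) (fun z => qv u z v).
Proof.
rewrite (aux_cmi2E pp qup qvp qwp).
rewrite (sum_aux5 (fun o => log2 (qv o.1.2 o.1.1.2 o.2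
   * pushpmf P (fun o => (oU o, oX o)) (o.1.2, o.1.1.1.1)
   / pushpmf P (fun o => (oV o, (oU o, oX o))) (o.2, (o.1.2, o.1.1.1.1))))).
by apply: eq_bigr => u _; apply: eq_bigr => v _; apply: eq_bigr => t _; rewrite push_UX push_VUX.
Qed.

Lemma cmi3_sum : cmi P oX oW (fun o => (oU o, oV o, oZ o))
  = \sum_u \sum_v \sum_w Fw (fun y => qu y u) (fun z => qv u z v) (fun x => qw u v x w).
Proof.
rewrite (aux_cmi3E pp qup qvp qwp) sum_aux6.
by apply: eq_bigr => u _; apply: eq_bigr => v _; apply: eq_bigr => w _; apply: eq_bigr => t _;
  rewrite push_UVZ push_WUVZ.
Qed.

Lemma expect_dx_sum (xh : U -> W -> Z -> Xh) :
  expect P (fun o => dx (oX o) (xh (oU o) (oW o) (oZ o)))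
  = \sum_u \sum_v \sum_w Gx (fun y => qu y u) (fun z => qv u z v) (fun x => qw u v x w) (xh u w).
Proof. by rewrite /expect sum_aux6. Qed.

Lemma expect_dz_sum (zh : U -> V -> X -> Zh) :
  expect P (fun o => dz (oZ o) (zh (oU o) (oV o) (oX o)))
  = \sum_u \sum_v Gz (fun y => qu y u) (fun z => qv u z v) (zh u v).
Proof.
by rewrite /expect (sum_aux5 (fun o => dz o.1.1.2 (zh o.1.2 o.2 o.1.1.1.1))).
Qed.

End Sums.

(** [region] with the alphabets as parameters, so that limits can be taken among kernels of one
    type. *)
Definition region_on (U V W : finType) (Dx Dz : R) (r : R * R * R) : Prop :=
  exists (qu : Y -> U -> R) (qv : U -> Z -> V -> R) (qw : U -> V -> X -> W -> R)
     (xh : U -> W -> Z -> Xh) (zh : U -> V -> X -> Zh),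
     let P := aux_pmf p qu qv qw in
     let oX (o : X * Y * Z * U * V * W) := o.1.1.1.1.1 in
     let oY (o : X * Y * Z * U * V * W) := o.1.1.1.1.2 in
     let oZ (o : X * Y * Z * U * V * W) := o.1.1.1.2 in
     let oU (o : X * Y * Z * U * V * W) := o.1.1.2 in
     let oV (o : X * Y * Z * U * V * W) := o.1.2 in
     let oW (o : X * Y * Z * U * V * W) := o.2 in
     (forall y, is_pmf (qu y)) /\
     (forall u z, is_pmf (qv u z)) /\
     (forall u v x, is_pmf (qw u v x)) /\
     cmi P oY oU oZ <= r.1.1 /\
     cmi P oZ oV (fun o => (oU o, oX o)) <= r.1.2 /\
     cmi P oX oW (fun o => (oU o, oV o, oZ o)) <= r.2 /\
     expect P (fun o => dx (oX o) (xh (oU o) (oW o) (oZ o))) <= Dx /\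
     expect P (fun o => dz (oZ o) (zh (oU o) (oV o) (oX o))) <= Dz.

(** [caratheodory] selects values of W for each [(u, v)], of V for each [u], and of U. Each index
    set lists what must survive: the kernel entries, so that rows still sum to 1, and the
    functionals already summed over the inner variables, which are 2 for W, 4 for V and 5 for U. The
    points selected for W depend on [v], which [xh] is not given, hence the product alphabet for
    W. *)
Lemma region_cardinality (Dx Dz : R) r : is_pmf p -> region p dx dz Dx Dz r ->
  region_on 'I_#|{: Y + option (bool * bool)}| 'I_#|{: Z + bool * bool}|
    ('I_#|{: Z + bool * bool}| * 'I_#|{: X + bool}|)%type Dx Dz r.
Proof.
move=> pp [U [V [W [qu [qv [qw [xh [zh]]]]]]]] /= [qup [qvp [qwp]]].
rewrite (cmi1_sum pp qup qvp qwp) (cmi2_sum pp qup qvp qwp) (cmi3_sum pp qup qvp qwp).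
rewrite expect_dx_sum (expect_dz_sum _ _ qwp) => -[r1 [r2 [r3 [h1 h2]]]].
have [[[x0 y0] z0] _] := pmf_inhabited pp.
have [u0 _] := pmf_inhabited (qup y0).
pose c u y := qu y u; pose e u v z := qv u z v; pose g u v w x := qw u v x w.
pose AW u v (j : X + bool) w := match j with
  | inl x => qw u v x w
  | inr true => Fw (c u) (e u v) (g u v w)
  | inr false => Gx (c u) (e u v) (g u v w) (xh u w) end.
have HW uv : exists tl : ('I_#|{: X + bool}| -> W) * ('I_#|{: X + bool}| -> R),
    (forall k, 0 <= tl.2 k) /\
    forall j, \sum_k tl.2 k * AW uv.1 uv.2 j (tl.1 k) = \sum_w AW uv.1 uv.2 j w.
  have [w0 _] := pmf_inhabited (qwp uv.1 uv.2 x0).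
  by have [t [la H]] := caratheodory (AW uv.1 uv.2) w0; exists (t, la).
have {HW}/choice[tlW HW] := HW.
pose AV u (j : Z + bool * bool) v := match j with
  | inl z => qv u z v
  | inr (true, true) => Fv (c u) (e u v)
  | inr (true, false) => \sum_w Fw (c u) (e u v) (g u v w)
  | inr (false, true) => \sum_w Gx (c u) (e u v) (g u v w) (xh u w)
  | inr (false, false) => Gz (c u) (e u v) (zh u v) end.
have HV u : exists tl : ('I_#|{: Z + bool * bool}| -> V) * ('I_#|{: Z + bool * bool}| -> R),
    (forall k, 0 <= tl.2 k) /\ forall j, \sum_k tl.2 k * AV u j (tl.1 k) = \sum_v AV u j v.
  have [v0 _] := pmf_inhabited (qvp u z0).
  by have [t [la H]] := caratheodory (AV u) v0; exists (t, la).
have {HV}/choice[tlV HV] := HV.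
pose AU (j : Y + option (bool * bool)) u := match j with
  | inl y => qu y u
  | inr None => Fu (c u)
  | inr (Some (true, true)) => \sum_v Fv (c u) (e u v)
  | inr (Some (true, false)) => \sum_v \sum_w Fw (c u) (e u v) (g u v w)
  | inr (Some (false, true)) => \sum_v \sum_w Gx (c u) (e u v) (g u v w) (xh u w)
  | inr (Some (false, false)) => \sum_v Gz (c u) (e u v) (zh u v) end.
have [tU [lU [lU0 HU]]] := caratheodory AU u0.
pose tV u := (tlV u).1; pose lV u := (tlV u).2.
pose tW u v := (tlW (u, v)).1; pose lW u v := (tlW (u, v)).2.
have qup' y : is_pmf (fun k => lU k * qu y (tU k)).
  split=> [k|]; first by rewrite mulr_ge0 //; case: (qup y) => + _; apply.
  by have := HU (inl y); rewrite /AU => ->; case: (qup y).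
have qvp' k z : is_pmf (fun l => lV (tU k) l * qv (tU k) z (tV (tU k) l)).
  have [l0 HVu] := HV (tU k).
  split=> [l|]; first by apply: mulr_ge0; [exact: l0|case: (qvp (tU k) z) => + _; apply].
  by have := HVu (inl z); rewrite /AV => ->; case: (qvp (tU k) z).
pose qw0 u v x m := lW u v m * qw u v x (tW u v m).
have qwp0 u v x : is_pmf (qw0 u v x).
  have [l0 HWu] := HW (u, v).
  split=> [m|]; first by apply: mulr_ge0; [exact: l0|case: (qwp u v x) => + _; apply].
  by have := HWu (inl x); rewrite /AW /= => ->; case: (qwp u v x).
have sum_diag (T S : finType) (l : T) (f : T * S -> R) :
    (forall l' m, l' != l -> f (l', m) = 0) -> \sum_w f w = \sum_m f (l, m).
  move=> f0; rewrite (eq_bigr (fun w => f (w.1, w.2))) => [|[] //].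
  rewrite -(pair_bigA _ (fun a b => f (a, b))) /= (bigD1 l) //= [X in _ + X]big1 ?addr0 //.
  by move=> l' nl; apply: big1 => m _; exact: f0.
have qwp' k l x : is_pmf (fun w : 'I_#|{: Z + bool * bool}| * 'I_#|{: X + bool}| =>
    (w.1 == l)%:R * qw0 (tU k) (tV (tU k) l) x w.2).
  have [q0 q1] := qwp0 (tU k) (tV (tU k) l) x.
  split=> [w|]; first by rewrite mulr_ge0 ?ler0n.
  rewrite (sum_diag _ _ l) => [|l' m /negPf->]; last by rewrite mul0r.
  by under eq_bigr do rewrite eqxx mul1r.
(* The first component of [w] is the copy of the index of V. *)
pose xh' k (w : 'I_#|{: Z + bool * bool}| * 'I_#|{: X + bool}|) z :=
  xh (tU k) (tW (tU k) (tV (tU k) w.1) w.2) z.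
pose zh' k l x := zh (tU k) (tV (tU k) l) x.
exists (fun y k => lU k * qu y (tU k)), (fun k z l => lV (tU k) l * qv (tU k) z (tV (tU k) l)),
  (fun k l x w => (w.1 == l)%:R * qw0 (tU k) (tV (tU k) l) x w.2),
  xh', zh' => /=.
rewrite (cmi1_sum pp qup' qvp' qwp') (cmi2_sum pp qup' qvp' qwp') (cmi3_sum pp qup' qvp' qwp').
rewrite (expect_dx_sum _ _ _ xh') (expect_dz_sum _ _ qwp' zh').
have EW u v : (\sum_m lW u v m * Fw (c u) (e u v) (g u v (tW u v m)) = \sum_w Fw (c u) (e u v) (g u v w))
   * (\sum_m lW u v m * Gx (c u) (e u v) (g u v (tW u v m)) (xh u (tW u v m))
      = \sum_w Gx (c u) (e u v) (g u v w) (xh u w)).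
  by have [_ H] := HW (u, v); split; [exact: (H (inr true))|exact: (H (inr false))].
do 3 split=> //; repeat split.
- apply: le_trans r1; rewrite le_eqVlt; apply/orP; left; apply/eqP.
  rewrite -(HU (inr None)); apply: eq_bigr => k _.
  exact: (Fu_scale (lU k) (c (tU k))).
- apply: le_trans r2; rewrite le_eqVlt; apply/orP; left; apply/eqP.
  rewrite -(HU (inr (Some (true, true)))); apply: eq_bigr => k _ /=.
  rewrite -((HV (tU k)).2 (inr (true, true))) mulr_sumr; apply: eq_bigr => l _ /=.
  rewrite (Fv_scale_u (lU k) (c (tU k))); congr (_ * _).
  exact: (Fv_scale_v (lV (tU k) l) _ (e (tU k) (tV (tU k) l))).
- apply: le_trans r3; rewrite le_eqVlt; apply/orP; left; apply/eqP.
  rewrite -(HU (inr (Some (true, false)))); apply: eq_bigr => k _ /=.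
  rewrite -((HV (tU k)).2 (inr (true, false))) mulr_sumr; apply: eq_bigr => l _ /=.
  (* Columns whose copy of the index is wrong are zero, so homogeneity with scale 0 removes their
     terms. *)
  rewrite -(EW _ _).1 !mulr_sumr (sum_diag _ _ l) => [|l' m /negPf->]; last first.
    by rewrite (Fw_scale_w 0 _ _ (fun x => qw0 (tU k) (tV (tU k) l) x m)) mul0r.
  apply: eq_bigr => m _; rewrite (Fw_scale_u (lU k) (c (tU k))); congr (_ * _).
  rewrite (Fw_scale_v (lV (tU k) l) _ (e (tU k) (tV (tU k) l))); congr (_ * _).
  rewrite eqxx (Fw_scale_w 1 _ _ (fun x => qw0 (tU k) (tV (tU k) l) x m)) mul1r.
  exact: (Fw_scale_w _ _ _ (g (tU k) (tV (tU k) l) (tW (tU k) (tV (tU k) l) m))).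
- apply: le_trans h1; rewrite le_eqVlt; apply/orP; left; apply/eqP.
  rewrite -(HU (inr (Some (false, true)))); apply: eq_bigr => k _ /=.
  rewrite -((HV (tU k)).2 (inr (false, true))) mulr_sumr; apply: eq_bigr => l _ /=.
  rewrite -(EW _ _).2 !mulr_sumr (sum_diag _ _ l) => [|l' m /negPf->]; last first.
    by rewrite (Gx_scale_w 0 _ _ (fun x => qw0 (tU k) (tV (tU k) l) x m)) mul0r.
  apply: eq_bigr => m _; rewrite (Gx_scale_u (lU k) (c (tU k))); congr (_ * _).
  rewrite (Gx_scale_v (lV (tU k) l) _ (e (tU k) (tV (tU k) l))); congr (_ * _).
  rewrite eqxx (Gx_scale_w 1 _ _ (fun x => qw0 (tU k) (tV (tU k) l) x m)) mul1r.
  exact: (Gx_scale_w _ _ _ (g (tU k) (tV (tU k) l) (tW (tU k) (tV (tU k) l) m))).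
apply: le_trans h2; rewrite le_eqVlt; apply/orP; left; apply/eqP.
rewrite -(HU (inr (Some (false, false)))); apply: eq_bigr => k _ /=.
rewrite -((HV (tU k)).2 (inr (false, false))) mulr_sumr; apply: eq_bigr => l _ /=.
rewrite (Gz_scale_u (lU k) (c (tU k))); congr (_ * _).
exact: (Gz_scale_v (lV (tU k) l) _ (e (tU k) (tV (tU k) l))).
Qed.

End Functionals.

(** * Information inequalities and single-letterisation *)

Section Information.
Variable R : realType.
Variables (Om : finType) (P : Om -> R).
Hypothesis P0 : forall w, 0 <= P w.

Lemma cmi_sym (TA TB TC : finType) (A : Om -> TA) (B : Om -> TB) (C : Om -> TC) :
  cmi P A B C = cmi P B A C.
Proof.
rewrite /cmi (entropy_eqrel P (f := fun w => (A w, B w, C w)) (g := fun w => (B w, A w, C w))).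
  by ring.
by move=> w w'; rewrite !xpair_eqE; case: (A w == _); case: (B w == _).
Qed.

(** [A] and [B] need to carry the same information as [A'] and [B'] only jointly with the
    condition. *)
Lemma cmi_eqrel (TA TB TC TA' TB' TC' : finType) (A : Om -> TA) (B : Om -> TB) (C : Om -> TC)
    (A' : Om -> TA') (B' : Om -> TB') (C' : Om -> TC') :
  (forall w w', C w == C w' = (C' w == C' w')) ->
  (forall w w', (A w == A w') && (C w == C w') = (A' w == A' w') && (C' w == C' w')) ->
  (forall w w', (B w == B w') && (C w == C w') = (B' w == B' w') && (C' w == C' w')) ->
  cmi P A B C = cmi P A' B' C'.
Proof.
move=> hC hA hB; rewrite /cmi.
rewrite (entropy_eqrel P (f := C) (g := C')) //.
rewrite (entropy_eqrel P (f := fun w => (A w, C w)) (g := fun w => (A' w, C' w))); last first.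
  by move=> w w'; rewrite !xpair_eqE hA.
rewrite (entropy_eqrel P (f := fun w => (B w, C w)) (g := fun w => (B' w, C' w))); last first.
  by move=> w w'; rewrite !xpair_eqE hB.
rewrite (entropy_eqrel P (f := fun w => (A w, B w, C w)) (g := fun w => (A' w, B' w, C' w))) //.
move=> w w'; rewrite !xpair_eqE; have := hA w w'; have := hB w w'; have := hC w w'.
by case: (A w == _); case: (B w == _); case: (C w == _); case: (A' w == _);
  case: (B' w == _); case: (C' w == _).
Qed.

Lemma cmi_chain (TA TB TC TD : finType) (A : Om -> TA) (B : Om -> TB) (C : Om -> TC)
    (D : Om -> TD) :
  cmi P A (fun w => (B w, D w)) C = cmi P A D C + cmi P A B (fun w => (C w, D w)).
Proof.
rewrite /cmi.
rewrite (entropy_eqrel P (f := fun w => (A w, (C w, D w))) (g := fun w => (A w, D w, C w))); last first.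
  by move=> w w'; rewrite !xpair_eqE; case: (A w == _); case: (D w == _); case: (C w == _).
rewrite (entropy_eqrel P (f := fun w => (B w, (C w, D w))) (g := fun w => (B w, D w, C w))); last first.
  by move=> w w'; rewrite !xpair_eqE; case: (B w == _); case: (D w == _); case: (C w == _).
rewrite (entropy_eqrel P (f := fun w => (A w, B w, (C w, D w))) (g := fun w => (A w, (B w, D w), C w))); last first.
  by move=> w w'; rewrite !xpair_eqE; case: (A w == _); case: (B w == _); case: (D w == _); case: (C w == _).
rewrite (entropy_eqrel P (f := fun w => (C w, D w)) (g := fun w => (D w, C w))); last first.
  by move=> w w'; rewrite !xpair_eqE; case: (D w == _); case: (C w == _).
by ring.
Qed.

Lemma cmi_le_r (TA TB TB' TC : finType) (A : Om -> TA) (B : Om -> TB) (B' : Om -> TB')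
    (C : Om -> TC) :
  (forall w w', B w = B w' -> B' w = B' w') -> cmi P A B' C <= cmi P A B C.
Proof.
move=> h.
have -> : cmi P A B C = cmi P A (fun w => (B w, B' w)) C.
  apply: cmi_eqrel => // w w'; congr (_ && _); rewrite xpair_eqE.
  by case: eqP => // /h ->; rewrite eqxx.
by rewrite cmi_chain lerDl cmi_ge0.
Qed.

Lemma cmi_le_l (TA TA' TB TC : finType) (A : Om -> TA) (A' : Om -> TA') (B : Om -> TB)
    (C : Om -> TC) :
  (forall w w', A w = A w' -> A' w = A' w') -> cmi P A' B C <= cmi P A B C.
Proof. by move=> h; rewrite cmi_sym [leRHS]cmi_sym; exact: cmi_le_r. Qed.

(** When [I(A;D|C) = 0] the chain rule gives [I(A;B,D|C) = I(A;B|C,D)], and the left side dominates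
    [I(A;B|C)]. *)
Lemma cmi_add_cond (TA TB TC TD : finType) (A : Om -> TA) (B : Om -> TB) (C : Om -> TC)
    (D : Om -> TD) : cind P A D C ->
  cmi P A B C <= cmi P A B (fun w => (C w, D w)).
Proof.
move=> ci; have := cmi_chain A B C D; rewrite (cind_cmi0 P0 ci) add0r => <-.
by apply: cmi_le_r => w w' [].
Qed.

Lemma cind_sym (TA TB TC : finType) (A : Om -> TA) (B : Om -> TB) (C : Om -> TC) :
  cind P A B C -> cind P B A C.
Proof.
move=> ci b a c; rewrite mulrC -[RHS]mulrC -ci [RHS]mulrC; congr (_ * _).
by apply: eq_bigl => w; rewrite !xpair_eqE; case: (A w == _); case: (B w == _).
Qed.

(* H(A | C) *)
Definition hcond (T S : finType) (A : Om -> T) (C : Om -> S) : R :=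
  entropy P (fun w => (A w, C w)) - entropy P C.

Lemma hcond_ge0 (T S : finType) (A : Om -> T) (C : Om -> S) : 0 <= hcond A C.
Proof.
have := cmi_ge0 A A C P0; rewrite /cmi /hcond.
rewrite (entropy_eqrel P (f := fun w => (A w, A w, C w)) (g := fun w => (A w, C w))); last first.
  by move=> w w'; rewrite !xpair_eqE andbb.
by rewrite addrK.
Qed.

Lemma hcond_le (T S : finType) (A : Om -> T) (C : Om -> S) : is_pmf P ->
  hcond A C <= log2 #|T|%:R.
Proof.
move=> Pp; have := cmi_ge0 A C (fun=> tt) P0; rewrite /cmi /hcond.
have -> : entropy P (fun=> tt) = 0.
  have [_ P1] := Pp; rewrite entropyE -mulr_suml P1 mul1r.
  by rewrite /pushpmf (eq_bigl xpredT) // P1 log2_1 oppr0.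
rewrite (entropy_eqrel P (f := fun w => (A w, tt)) (g := A)); last first.
  by move=> w w'; rewrite !xpair_eqE andbT.
rewrite (entropy_eqrel P (f := fun w => (C w, tt)) (g := C)); last first.
  by move=> w w'; rewrite !xpair_eqE andbT.
rewrite (entropy_eqrel P (f := fun w => (A w, C w, tt)) (g := fun w => (A w, C w))); last first.
  by move=> w w'; rewrite !xpair_eqE andbT.
by have := entropy_le_card A Pp; lra.
Qed.

Lemma cmi_hcond (TA TB TC : finType) (A : Om -> TA) (B : Om -> TB) (C : Om -> TC) :
  cmi P A B C = hcond B C - hcond B (fun w => (A w, C w)).
Proof.
rewrite /cmi /hcond.
rewrite (entropy_eqrel P (f := fun w => (B w, (A w, C w))) (g := fun w => (A w, B w, C w))).
  by ring.
by move=> w w'; rewrite !xpair_eqE; case: (A w == _); case: (B w == _).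
Qed.

Lemma hcond_eqrel (T S S' : finType) (A : Om -> T) (C : Om -> S) (C' : Om -> S') :
  (forall w w', C w == C w' = (C' w == C' w')) -> hcond A C = hcond A C'.
Proof.
move=> h; rewrite /hcond (entropy_eqrel P h).
rewrite (entropy_eqrel P (f := fun w => (A w, C w)) (g := fun w => (A w, C' w))) //.
by move=> w w'; rewrite !xpair_eqE h.
Qed.

End Information.

(** * Transfer between laws and construction of points of the region *)

Section Transfer.
Variable R : realType.

Lemma cmi_law (Om Om' T TA TB TC : finType) (P : Om -> R) (P' : Om' -> R) (f : Om -> T)
    (f' : Om' -> T) (a : T -> TA) (b : T -> TB) (c : T -> TC) :
  pushpmf P f =1 pushpmf P' f' ->
  cmi P (fun w => a (f w)) (fun w => b (f w)) (fun w => c (f w))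
  = cmi P' (fun w => a (f' w)) (fun w => b (f' w)) (fun w => c (f' w)).
Proof.
move=> E; have H (S : finType) (g : T -> S) :
    entropy P (fun w => g (f w)) = entropy P' (fun w => g (f' w)).
  apply: entropy_law => s; rewrite (pushpmf_comp P f g) (pushpmf_comp P' f' g).
  by rewrite /pushpmf; apply: eq_bigr => t _; exact: E.
rewrite /cmi (H _ (fun t => (a t, c t))) (H _ (fun t => (b t, c t))).
by rewrite (H _ (fun t => (a t, b t, c t))) (H _ c).
Qed.

Lemma expect_law (Om Om' T : finType) (P : Om -> R) (P' : Om' -> R) (f : Om -> T)
    (f' : Om' -> T) (g : T -> R) :
  pushpmf P f =1 pushpmf P' f' ->
  expect P (fun w => g (f w)) = expect P' (fun w => g (f' w)).
Proof.
by move=> E; rewrite (expect_push P f g) (expect_push P' f' g); apply: eq_bigr => t _; rewrite E.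
Qed.

(** Given [S], the extra observation [T] is independent of the target [A] and so acts as private
    randomness; fixing its best value for each [s] does no worse. *)
Lemma reconstruct (Om TA TS TR B : finType) (P : Om -> R) (A : Om -> TA) (S : Om -> TS)
    (T : Om -> TR) (h : Om -> B) (d : TA -> B -> R) : is_pmf P ->
  (forall w w', S w = S w' -> T w = T w' -> h w = h w') -> cind P T A S ->
  exists f : TS -> B, expect P (fun w => d (A w) (f (S w))) <= expect P (fun w => d (A w) (h w)).
Proof.
move=> Pp hST ci; have [P0 _] := Pp; have [w0 _] := pmf_inhabited Pp.
pose G s t := if [pick w | (S w == s) && (T w == t)] is Some w then h w else h w0.
have hG w : h w = G (S w) (T w).
  rewrite /G; case: pickP => [w' /andP[/eqP e1 /eqP e2]|/(_ w)]; last by rewrite !eqxx.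
  exact: hST.
have K := cind_kernel (T w0) P0 ci.
pose k := condk P T S (T w0).
have kp s : is_pmf (k s) by exact: condk_pmf.
pose q := pushpmf P (fun w => (A w, S w)).
(* [derand] maximises, so the cost enters with a minus sign. *)
have [rho Hr] := derand (fun o : TR * TA * TS => - (q (o.1.2, o.2) * d o.1.2 (G o.2 o.1.1)))
   (fun o => o.2) (fun o => o.1.1) kp.
exists (fun s => G s (rho s)).
have E1 : expect P (fun w => d (A w) (h w)) =
    \sum_(o : TR * TA * TS) q (o.1.2, o.2) * d o.1.2 (G o.2 o.1.1) * k o.2 o.1.1.
  transitivity (expect P (fun w => (fun o : TR * TA * TS => d o.1.2 (G o.2 o.1.1)) (T w, A w, S w))).
    by apply: eq_bigr => w _; rewrite hG.
  rewrite (expect_push P (fun w => (T w, A w, S w)) (fun o => d o.1.2 (G o.2 o.1.1))).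
  apply: eq_bigr => -[[t a] s] _ /=; rewrite K -/q -/k.
  by ring.
have E2 : expect P (fun w => d (A w) (G (S w) (rho (S w)))) =
    \sum_(o : TR * TA * TS) q (o.1.2, o.2) * d o.1.2 (G o.2 o.1.1) * (rho o.2 == o.1.1)%:R.
  transitivity (expect P (fun w => (fun o : TA * TS => d o.1 (G o.2 (rho o.2))) (A w, S w))) => //.
  rewrite (expect_push P (fun w => (A w, S w)) (fun o => d o.1 (G o.2 (rho o.2)))) -/q /expect.
  rewrite -(pair_bigA _ (fun ta s => q (ta.2, s) * d ta.2 (G s ta.1) * (rho s == ta.1)%:R)) /=.
  rewrite -(pair_bigA _ (fun t a => \sum_s q (a, s) * d a (G s t) * (rho s == t)%:R)) /=.
  rewrite exchange_big /= (eq_bigr (fun o => q (o.1, o.2) * d o.1 (G o.2 (rho o.2)))) => [|[a s] _ //].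
  rewrite -(pair_bigA _ (fun a s => q (a, s) * d a (G s (rho s)))) /=; apply: eq_bigr => a _.
  rewrite exchange_big; apply: eq_bigr => s _; rewrite (bigD1 (rho s)) //= eqxx mulr1.
  by rewrite big1 ?addr0 // => t; rewrite eq_sym => /negPf->; rewrite mulr0.
rewrite E1 E2 -lerN2 -!sumrN.
by under eq_bigr do rewrite -mulNr; under [leRHS]eq_bigr do rewrite -mulNr.
Qed.

(** Independence of [vW] is asked from [vZ] only, so the rebuilt law agrees with [P] on the two
    marginals [l5] and [l6]. The first two rates and the [dz] distortion are determined by the
    former, the third rate and the [dx] distortion by the latter. *)
Lemma region_intro (X Y Z Xh Zh U V W Om : finType) (p : X * Y * Z -> R)
    (dx : X -> Xh -> R) (dz : Z -> Zh -> R) (Dx Dz : R) (r : R * R * R) (P : Om -> R)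
    (vX : Om -> X) (vY : Om -> Y) (vZ : Om -> Z) (vU : Om -> U) (vV : Om -> V) (vW : Om -> W)
    (xh : U -> W -> Z -> Xh) (zh : U -> V -> X -> Zh) :
  is_pmf P -> is_pmf p ->
  (forall t, pushpmf P (fun w => (vX w, vY w, vZ w)) t = p t) ->
  cind P vU (fun w => (vX w, vZ w)) vY ->
  cind P vV (fun w => (vX w, vY w)) (fun w => (vU w, vZ w)) ->
  cind P vW vZ (fun w => (vU w, vV w, vX w)) ->
  cmi P vY vU vZ <= r.1.1 ->
  cmi P vZ vV (fun w => (vU w, vX w)) <= r.1.2 ->
  cmi P vX vW (fun w => (vU w, vV w, vZ w)) <= r.2 ->
  expect P (fun w => dx (vX w) (xh (vU w) (vW w) (vZ w))) <= Dx ->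
  expect P (fun w => dz (vZ w) (zh (vU w) (vV w) (vX w))) <= Dz ->
  region p dx dz Dx Dz r.
Proof.
move=> Pp pp law c1 c2 c3 r1 r2 r3 h1 h2; have [P0 _] := Pp.
have [w0 _] := pmf_inhabited Pp.
pose qu := condk P vU vY (vU w0).
pose qv u z := condk P vV (fun w => (vU w, vZ w)) (vV w0) (u, z).
pose qw u v x := condk P vW (fun w => (vU w, vV w, vX w)) (vW w0) (u, v, x).
have qup y : is_pmf (qu y) by exact: condk_pmf.
have qvp u z : is_pmf (qv u z) by exact: condk_pmf.
have qwp u v x : is_pmf (qw u v x) by exact: condk_pmf.
have k1 := cind_kernel (vU w0) P0 c1; have k2 := cind_kernel (vV w0) P0 c2.
have k3 := cind_kernel (vW w0) P0 c3.
have pinj (S T : finType) (f : Om -> S) (g : S -> T) s : injective g ->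
   pushpmf P f s = pushpmf P (fun w => g (f w)) (g s) by move=> ig; rewrite pushpmf_inj.
have l4 : pushpmf (aux_pmf p qu qv qw) (fun o => o.1.1) =1
    pushpmf P (fun w => (vX w, vY w, vZ w, vU w)).
  move=> [[[x y] z] u]; rewrite (aux_push4 p qu qvp qwp) -law.
  rewrite (pinj _ _ _ (fun t : X * Y * Z * U => (t.2, (t.1.1.1, t.1.2), t.1.1.2))); last first.
    by move=> [[[? ?] ?] ?] [[[? ?] ?] ?] [] -> -> -> ->.
  rewrite [RHS](k1 u (x, z) y); congr (_ * _).
  rewrite (pinj _ _ _ (fun t : X * Y * Z => ((t.1.1, t.2), t.1.2))) //.
  by move=> [[? ?] ?] [[? ?] ?] [] -> -> ->.
have l5 : pushpmf (aux_pmf p qu qv qw) fst =1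
    pushpmf P (fun w => (vX w, vY w, vZ w, vU w, vV w)).
  move=> [[[[x y] z] u] v]; rewrite (aux_push5 p qu qv qwp).
  rewrite (pinj _ _ _ (fun t : X * Y * Z * U * V => (t.2, (t.1.1.1.1, t.1.1.1.2), (t.1.2, t.1.1.2)))); last first.
    by move=> [[[[? ?] ?] ?] ?] [[[[? ?] ?] ?] ?] [] -> -> -> -> ->.
  rewrite [RHS](k2 v (x, y) (u, z)); congr (_ * _).
  rewrite -(aux_push4 p qu qvp qwp) l4.
  rewrite (pinj _ _ _ (fun t : X * Y * Z * U => ((t.1.1.1, t.1.1.2), (t.2, t.1.2)))) //.
  by move=> [[[? ?] ?] ?] [[[? ?] ?] ?] [] -> -> -> ->.
have l6 : pushpmf (aux_pmf p qu qv qw) (fun o => (o.2, o.1.1.1.2, (o.1.1.2, o.1.2, o.1.1.1.1.1))) =1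
    pushpmf P (fun w => (vW w, vZ w, (vU w, vV w, vX w))).
  move=> [[w z] [[u v] x]]; rewrite k3.
  rewrite (kernel_of_fun (fun b _ => b.2) (aux_kernel_W p qu qv qwp)) /=; congr (_ * _).
  rewrite (pushpmf_comp _ fst (fun t => (t.1.1.2, (t.1.2, t.2, t.1.1.1.1)))).
  rewrite (pushpmf_comp P (fun w => (vX w, vY w, vZ w, vU w, vV w))
    (fun t => (t.1.1.2, (t.1.2, t.2, t.1.1.1.1)))).
  by rewrite /pushpmf; apply: eq_bigr => t _; exact: l5.
exists U, V, W, qu, qv, qw, xh, zh => /=; do 3 split=> //.
split; [|split; [|split; [|split]]].
- apply: le_trans r1; rewrite le_eqVlt; apply/orP; left; apply/eqP.
  exact: (cmi_law (fun t => t.1.1.2) (fun t => t.2) (fun t => t.1.2) l4).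
- apply: le_trans r2; rewrite le_eqVlt; apply/orP; left; apply/eqP.
  exact: (cmi_law (fun t => t.1.1.2) (fun t => t.2) (fun t => (t.1.2, t.1.1.1.1)) l5).
- apply: le_trans r3; rewrite le_eqVlt; apply/orP; left; apply/eqP.
  exact: (cmi_law (fun t => t.2.2) (fun t => t.1.1) (fun t => (t.2.1.1, t.2.1.2, t.1.2)) l6).
- apply: le_trans h1; rewrite le_eqVlt; apply/orP; left; apply/eqP.
  exact: (expect_law (fun t => dx t.2.2 (xh t.2.1.1 t.1.1 t.1.2)) l6).
apply: le_trans h2; rewrite le_eqVlt; apply/orP; left; apply/eqP.
exact: (expect_law (fun t => dz t.1.1.2 (zh t.1.2 t.2 t.1.1.1.1)) l5).
Qed.

End Transfer.

(** * Exchanging letters, and the uniform time index *)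

Section Masks.
Variable n : nat.

(** Prefixes and suffixes keep the full length, so that their type does not depend on the time
    index. *)
Definition mask_seq (B : finType) (Q : pred 'I_n) (s : {ffun 'I_n -> B}) : {ffun 'I_n -> option B} :=
  [ffun j => if Q j then Some (s j) else None].

Lemma mask_seqP (B : finType) (Q : pred 'I_n) (s s' : {ffun 'I_n -> B}) :
  mask_seq Q s = mask_seq Q s' <-> forall j, Q j -> s j = s' j.
Proof.
split=> [/ffunP E j Qj|E]; first by have := E j; rewrite !ffunE Qj => -[].
by apply/ffunP => j; rewrite !ffunE; case: ifP => // /E->.
Qed.

Lemma mask_seq_add (B : finType) (Q Q' : pred 'I_n) i (s s' : {ffun 'I_n -> B}) :
  (forall j, Q j = (j == i) || Q' j) ->
  (mask_seq Q s == mask_seq Q s') = (s i == s' i) && (mask_seq Q' s == mask_seq Q' s').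
Proof.
move=> QQ; apply/eqP/andP => [/mask_seqP E|[/eqP E1 /eqP/mask_seqP E2]].
  split; apply/eqP; first by apply: E; rewrite QQ eqxx.
  by apply/mask_seqP => j Qj; apply: E; rewrite QQ Qj orbT.
by apply/mask_seqP => j; rewrite QQ => /orP[/eqP->|/E2].
Qed.

Lemma mask_seqT (B : finType) (Q : pred 'I_n) (s s' : {ffun 'I_n -> B}) :
  (forall j, Q j) -> (mask_seq Q s == mask_seq Q s') = (s == s').
Proof.
move=> QT; apply/eqP/eqP => [/mask_seqP E|-> //].
by apply/ffunP => j; apply: E.
Qed.

Lemma before_S (i j : 'I_n) : (j < i.+1)%N = (j == i) || (j < i)%N.
Proof. by rewrite ltnS leq_eqVlt. Qed.

Lemma from_S (i j : 'I_n) : (i <= j)%N = (j == i) || (i < j)%N.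
Proof. by rewrite leq_eqVlt eq_sym. Qed.

End Masks.

Section Swap.
Variables (R : realType) (X Y Z : finType) (p : X * Y * Z -> R) (n : nat).
Hypothesis pp : is_pmf p.
Hypothesis mk : markov_YXZ p.
Notation Om := {ffun 'I_n -> X * Y * Z}.

(** For fixed [x] the matrix [p (x, _, _)] has rank at most one. *)
Lemma markov_swap x y y' z z' :
  p (x, y', z) * p (x, y, z') = p (x, y, z) * p (x, y', z').
Proof.
have [p0 _] := pp; pose px := \sum_y' \sum_z' p (x, y', z').
have [E|px0] := eqVneq px 0.
  have pz a b : p (x, a, b) = 0.
    have /psumr_eq0P E1 : \sum_y' \sum_z' p (x, y', z') = 0 by [].
    have /psumr_eq0P E2 := E1 (fun y _ => sumr_ge0 _ (fun z _ => p0 (x, y, z))) a isT.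
    exact: E2.
  by rewrite !pz mulr0.
apply: (mulIf (mulf_neq0 px0 px0)).
rewrite mulrACA [RHS]mulrACA /px !mk.
by ring.
Qed.

Definition zmix (k : nat) (w w' : Om) : Om :=
  [ffun j : 'I_n => if (j < k)%N then ((w' j).1, (w j).2) else w' j].

(** The z-letters agree from [k] on, so exchanging those below [k] transplants the complete z-word,
    and only at positions where the x-letters agree, as [markov_swap] requires. *)
Lemma zmixP k (w w' : Om) :
  mask_seq (fun j => j < k)%N (xseq w) = mask_seq (fun j => j < k)%N (xseq w') ->
  mask_seq (fun j => k <= j)%N (zseq w) = mask_seq (fun j => k <= j)%N (zseq w') ->
  [/\ iid_pmf p (zmix k w w') * iid_pmf p (zmix k w' w) = iid_pmf p w * iid_pmf p w',
      xseq (zmix k w w') = xseq w', yseq (zmix k w w') = yseq w',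
      zseq (zmix k w w') = zseq w & zmix k (zmix k w w') (zmix k w' w) = w].
Proof.
move=> /mask_seqP Ex /mask_seqP Ez; split.
- rewrite /iid_pmf -!big_split; apply: eq_bigr => j _ /=; rewrite !ffunE.
  case: ifP => [jk|_]; last by rewrite mulrC.
  have := Ex _ jk; rewrite !ffunE.
  case: (w j) => [[x y] z]; case: (w' j) => [[x' y'] z'] /= <-.
  exact: markov_swap.
- by apply/ffunP => j; rewrite !ffunE; case: ifP.
- by apply/ffunP => j; rewrite !ffunE; case: ifP.
- apply/ffunP => j; rewrite !ffunE; case: ifP => //= jk.
  by have := Ez j; rewrite leqNgt jk !ffunE => /(_ isT).
apply/ffunP => j; rewrite !ffunE; case: (j < k)%N => //=.
by case: (w j).
Qed.

(** The two positions may differ because two outcomes of the mixture carry different time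
    indices. *)
Definition lmix (i i' : 'I_n) (w w' : Om) : Om :=
  [ffun j => if j == i' then w i else w' j].

Lemma lmix_iid i i' (w w' : Om) :
  iid_pmf p (lmix i i' w w') * iid_pmf p (lmix i' i w' w) = iid_pmf p w * iid_pmf p w'.
Proof.
rewrite /iid_pmf.
have E (a b : 'I_n) (v v' : Om) : \prod_j p (lmix a b v v' j) = p (v a) * \prod_(j | j != b) p (v' j).
  rewrite (bigD1 b) //= ffunE eqxx; congr (_ * _).
  by apply: eq_bigr => j /negPf jb; rewrite ffunE jb.
rewrite !E [in RHS](bigD1 i) //= [X in _ = _ * X](bigD1 i') //=.
by ring.
Qed.

Lemma lmixK i i' (w w' : Om) : lmix i' i (lmix i i' w w') (lmix i' i w' w) = w.
Proof.
by apply/ffunP => j; rewrite !ffunE !eqxx; case: eqP => [->|].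
Qed.

End Swap.

Section Mixture.
Variables (R : realType) (A : finType) (p : A -> R) (n : nat).
Hypothesis pp : is_pmf p.
Hypothesis n0 : (0 < n)%N.
Notation Om := {ffun 'I_n -> A}.
Let P (w : Om) : R := \prod_i p (w i).

Definition mixture (s : 'I_n * Om) : R := n%:R^-1 * \prod_i p (s.2 i).

Let nR : (n%:R : R) != 0. Proof. by rewrite pnatr_eq0 -lt0n. Qed.

Lemma mean_const (c : R) : n%:R^-1 * (\sum_(i < n) c) = c.
Proof. by rewrite sumr_const card_ord -(mulr_natl c n) mulKf. Qed.

Lemma mixture_sum (g : 'I_n * Om -> R) :
  \sum_s mixture s * g s = n%:R^-1 * \sum_i \sum_w P w * g (i, w).
Proof.
rewrite (eq_bigr (fun s => mixture (s.1, s.2) * g (s.1, s.2))) => [|[] //].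
rewrite -(pair_bigA _ (fun i w => mixture (i, w) * g (i, w))) /= mulr_sumr.
by apply: eq_bigr => i _; rewrite mulr_sumr; apply: eq_bigr => w _; rewrite /mixture mulrA.
Qed.

Lemma mixture_pmf : is_pmf mixture.
Proof.
have [P0 P1] := prod_pmf 'I_n pp; split=> [s|].
  by rewrite mulr_ge0 ?invr_ge0 ?ler0n // P0.
have := mixture_sum (fun=> 1); under eq_bigr do rewrite mulr1; move=> ->.
under eq_bigr do under eq_bigr do rewrite mulr1.
by rewrite (eq_bigr (fun=> 1)) // mean_const.
Qed.

Lemma mixture_push (T : finType) (f : 'I_n * Om -> T) i w :
  (forall s s', f s = f s' -> s.1 = s'.1) ->
  pushpmf mixture f (f (i, w)) = n%:R^-1 * pushpmf P (fun w => f (i, w)) (f (i, w)).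
Proof.
move=> fi.
have -> : pushpmf mixture f (f (i, w)) = \sum_s mixture s * (f s == f (i, w))%:R.
  by rewrite /pushpmf big_mkcond; apply: eq_bigr => s _; case: eqP; rewrite ?mulr1 ?mulr0.
rewrite mixture_sum; congr (_ * _).
rewrite (bigD1 i) //= [X in _ + X]big1 ?addr0 => [|i' ii]; last first.
  rewrite big1 // => w' _; case: eqP => [/fi /= E|]; last by rewrite mulr0.
  by rewrite E eqxx in ii.
by rewrite /pushpmf [RHS]big_mkcond; apply: eq_bigr => w' _; case: eqP; rewrite ?mulr1 ?mulr0.
Qed.

(** The entropy of the uniform index plus the entropy given the index, which [f] reveals. *)
Lemma entropy_mixture (T : finType) (f : 'I_n * Om -> T) :
  (forall s s', f s = f s' -> s.1 = s'.1) ->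
  entropy mixture f = log2 n%:R + n%:R^-1 * \sum_i entropy P (fun w => f (i, w)).
Proof.
move=> fi; have [P0 P1] := prod_pmf 'I_n pp.
rewrite entropyE (mixture_sum (fun s => log2 (pushpmf mixture f (f s)))).
rewrite (eq_bigr (fun i => - log2 n%:R - entropy P (fun w => f (i, w)))) => [|i _].
  by rewrite sumrB mulrBr (mean_const (- log2 n%:R)) opprB addrC opprK.
have -> : - log2 n%:R = \sum_w P w * - log2 (n%:R : R) by rewrite -mulr_suml P1 mul1r.
rewrite entropyE opprK -big_split /=; apply: eq_bigr => w _.
have : 0 <= P w by exact: P0.
rewrite le0r => /orP[/eqP->|Pw]; first by rewrite !mul0r addr0.
rewrite mixture_push // log2M ?invr_gt0 ?ltr0n //; last exact: (pushpmf_gt0 (fun w => f (i, w)) P0 Pw).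
by rewrite log2V ?ltr0n //; ring.
Qed.

Lemma sum_cmi (a b c d : 'I_n -> R) :
  \sum_i (a i + b i - c i - d i) = \sum_i a i + \sum_i b i - \sum_i c i - \sum_i d i.
Proof. by rewrite -big_split -!sumrB. Qed.

Lemma cmi_mixture (TA TB TC : finType) (a : 'I_n * Om -> TA) (b : 'I_n * Om -> TB)
    (c : 'I_n * Om -> TC) : (forall s s', c s = c s' -> s.1 = s'.1) ->
  cmi mixture a b c
  = n%:R^-1 * \sum_i cmi P (fun w => a (i, w)) (fun w => b (i, w)) (fun w => c (i, w)).
Proof.
move=> ci; rewrite /cmi !entropy_mixture //; try by move=> s s' [] *; exact: ci.
by rewrite sum_cmi /=; ring.
Qed.

Lemma push_letter i : pushpmf P (fun w => w i) =1 p.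
Proof.
move=> a; have := prod_expect1 (fun b => (b == a)%:R) i pp.
have -> : \sum_b p b * (b == a)%:R = p a.
  by rewrite (bigD1 a) //= eqxx mulr1 big1 ?addr0 // => b /negPf->; rewrite mulr0.
move=> <-; rewrite /pushpmf big_mkcond; apply: eq_bigr => w _.
by case: eqP; rewrite ?mulr1 ?mulr0.
Qed.

Lemma push_mixture_letter : pushpmf mixture (fun s => s.2 s.1) =1 p.
Proof.
move=> a.
have -> : pushpmf mixture (fun s => s.2 s.1) a = \sum_s mixture s * (s.2 s.1 == a)%:R.
  by rewrite /pushpmf big_mkcond; apply: eq_bigr => s _; case: eqP; rewrite ?mulr1 ?mulr0.
rewrite (mixture_sum (fun s => (s.2 s.1 == a)%:R)) (eq_bigr (fun=> p a)) => [|i _].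
  by rewrite mean_const.
rewrite -(push_letter i a) /pushpmf [RHS]big_mkcond; apply: eq_bigr => w _ /=.
by case: eqP; rewrite ?mulr1 ?mulr0.
Qed.

Lemma entropy_mixture_letter (T : finType) (g : A -> T) :
  entropy mixture (fun s => g (s.2 s.1)) = n%:R^-1 * \sum_i entropy P (fun w => g (w i)).
Proof.
have E i : entropy P (fun w => g (w i)) = entropy p g.
  apply: entropy_law => t; rewrite (pushpmf_comp P (fun w => w i) g).
  by apply: eq_bigr => a _; exact: push_letter.
under eq_bigr do rewrite E; rewrite mean_const.
apply: entropy_law => t; rewrite (pushpmf_comp mixture (fun s => s.2 s.1) g).
by apply: eq_bigr => a _; exact: push_mixture_letter.
Qed.

(** Here the condition does not reveal the index. The letters are identically distributed, so the
    entropies of [c] and [(a, c)] equal their averages, and the two terms that involve [b] carry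
    [log2 n] with opposite signs. *)
Lemma cmi_mixture_letter (TA TB TC : finType) (a : A -> TA) (b : 'I_n * Om -> TB)
    (c : A -> TC) : (forall s s', b s = b s' -> s.1 = s'.1) ->
  cmi mixture (fun s => a (s.2 s.1)) b (fun s => c (s.2 s.1))
  = n%:R^-1 * \sum_i cmi P (fun w => a (w i)) (fun w => b (i, w)) (fun w => c (w i)).
Proof.
move=> bi; rewrite /cmi (entropy_mixture_letter (fun x => (a x, c x))) (entropy_mixture_letter c).
rewrite !entropy_mixture; [|by move=> s s' [] *; exact: bi|by move=> s s' [] *; exact: bi].
by rewrite sum_cmi /=; ring.
Qed.

End Mixture.

(** * Compactness *)

Local Open Scope classical_set_scope.

Section Compactness.
Variable R : realType.

(** With [x = s^2], [x * |ln x| = 2 s^2 |ln s| <= 2 s], by [ln t < t] at [t = 1 / s]; hence the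
    threshold [(e / 2) ^+ 2]. *)
Lemma xlnx_small (x e : R) : 0 < x -> x < 1 -> x < (e / 2) ^+ 2 -> 0 < e -> `|x * ln x| < e.
Proof.
move=> x0 x1 xe e0; have s0 : 0 < Num.sqrt x by rewrite sqrtr_gt0.
have xs : Num.sqrt x ^+ 2 = x by rewrite sqr_sqrtr // ltW.
have se : Num.sqrt x < e / 2.
  have e20 : 0 <= e / 2 by rewrite divr_ge0 // ltW.
  by rewrite -(ltr_pXn2r (n := 2)) ?nnegrE ?(ltW s0) // xs.
have lx : ln x = ln (Num.sqrt x) *+ 2 by rewrite -{1}xs lnXn.
have l0 : ln x <= 0 by rewrite ln_le0 // ltW.
rewrite ler0_norm; last by rewrite mulr_ge0_le0 // ltW.
have li : - ln (Num.sqrt x) <= (Num.sqrt x)^-1.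
  rewrite -lnV ?posrE //; apply/ltW/ln_sublinear; by rewrite invr_gt0.
have -> : - (x * ln x) = 2 * (Num.sqrt x ^+ 2 * - ln (Num.sqrt x)).
  by rewrite lx xs mulr2n; ring.
apply: (@le_lt_trans _ _ (2 * (Num.sqrt x ^+ 2 * (Num.sqrt x)^-1))).
  by rewrite ler_wpM2l // ler_wpM2l // sqr_ge0.
by rewrite expr2 mulfK ?gt_eqF //; lra.
Qed.

Lemma continuous_xlnx : continuous (fun x : R => x * ln x).
Proof.
move=> x; have [x0|x0|->] := ltgtP x 0.
- rewrite /continuous_at (ln0 (ltW x0)) mulr0; apply: cvg_near_cst; near=> y; rewrite ln0 ?mulr0 //; apply: ltW; near: y.
  exact: lt_nbhsl.
- by apply: cvgM; [exact: cvg_id|exact: continuous_ln].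
rewrite /continuous_at mul0r; apply/cvgrPdist_lt => e e0.
have d0 : 0 < Num.min 1 ((e / 2) ^+ 2) by rewrite lt_min ltr01 exprn_gt0 // divr_gt0.
near=> y; rewrite sub0r normrN.
have [y0|y0] := leP y 0; first by rewrite ln0 // mulr0 normr0.
have : `|y| < Num.min 1 ((e / 2) ^+ 2) 
  by near: y; exists (Num.min 1 ((e / 2) ^+ 2)) => //= z /=; rewrite sub0r normrN.
by rewrite gtr0_norm // lt_min => /andP[]; move=> *; apply: xlnx_small.
Unshelve. all: by end_near.
Qed.

Lemma cvg_sum_fin (I : finType) (Q : pred I) (f : I -> nat -> R) (l : I -> R)
    (F : set_system nat) (FF : Filter F) : (forall i, f i @ F --> l i) ->
  (fun k => \sum_(i | Q i) f i k) @ F --> \sum_(i | Q i) l i.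
Proof.
move=> fl; rewrite -big_filter.
have -> : (fun k => \sum_(i | Q i) f i k) =
    (fun k => \sum_(i <- [seq i <- index_enum I | Q i]) f i k).
  by apply/funext => k; rewrite big_filter.
elim: [seq i <- _ | Q i] => [|i s IH].
  have -> : (fun k => \sum_(i <- [::]) f i k) = (fun=> 0) by apply/funext => k; rewrite big_nil.
  by rewrite big_nil; exact: cvg_cst.
have -> : (fun k => \sum_(j <- i :: s) f j k) = (fun k => f i k + \sum_(j <- s) f j k).
  by apply/funext => k; rewrite big_cons.
by rewrite big_cons; apply: cvgD.
Qed.

Lemma cvg_entropy (Om T : finType) (P : nat -> Om -> R) (P' : Om -> R) (f : Om -> T)
    (F : set_system nat) (FF : Filter F) : (forall o, (fun k => P k o) @ F --> P' o) ->
  (fun k => entropy (P k) f) @ F --> entropy P' f.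
Proof.
move=> PP; have E (Q : Om -> R) :
    entropy Q f = - (\sum_t pushpmf Q f t * ln (pushpmf Q f t)) / ln 2.
  rewrite /entropy mulNr; congr (- _); rewrite mulr_suml; apply: eq_bigr => t _.
  by rewrite /log2 mulrA; case: eqP => // ->; rewrite !mul0r.
rewrite E; under eq_fun do rewrite E.
apply: cvgM; last exact: cvg_cst.
apply: cvgN; apply: cvg_sum_fin => t.
apply: (@cvg_comp _ _ _ (fun k => pushpmf (P k) f t) (fun x => x * ln x)).
  exact: cvg_sum_fin.
exact: continuous_xlnx.
Qed.

Lemma cvg_cmi (Om TA TB TC : finType) (P : nat -> Om -> R) (P' : Om -> R)
    (A : Om -> TA) (B : Om -> TB) (C : Om -> TC)
    (F : set_system nat) (FF : Filter F) : (forall o, (fun k => P k o) @ F --> P' o) ->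
  (fun k => cmi (P k) A B C) @ F --> cmi P' A B C.
Proof.
move=> PP; rewrite /cmi; apply: cvgB; last exact: cvg_entropy.
apply: cvgB; last exact: cvg_entropy.
by apply: cvgD; exact: cvg_entropy.
Qed.

Lemma cvg_expect (Om : finType) (P : nat -> Om -> R) (P' g : Om -> R)
    (F : set_system nat) (FF : Filter F) : (forall o, (fun k => P k o) @ F --> P' o) ->
  (fun k => expect (P k) g) @ F --> expect P' g.
Proof.
by move=> PP; apply: cvg_sum_fin => o; apply: cvgM => //; exact: cvg_cst.
Qed.

(** Compactness provides a cluster point, and an ultrafilter converges to each of its cluster
    points. *)
Lemma ultra_bounded_cvg (F : set_system nat) (f : nat -> R) : UltraFilter F ->
  (forall k, 0 <= f k <= 1) -> exists l : R, f @ F --> l.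
Proof.
move=> FU fb; have [|l [_ fl]] := @segment_compact R 0 1 (f @ F).
  by apply: (@filterE _ F) => k /=; rewrite in_itv /= fb.
exists l => A Al; have [//|nA] := in_ultra_setVsetC (f @^-1` A) FU.
by have [y [ny Ay]] := fl (~` A) A nA Al; exfalso; exact: ny.
Qed.

(** Otherwise the filter contains the complement of every fibre, and these finitely many sets have
    empty intersection. *)
Lemma ultra_finite_const (T : finType) (F : set_system nat) (f : nat -> T) : UltraFilter F ->
  exists t, \forall k \near F, f k = t.
Proof.
move=> FU; apply: contrapT => /forallNP no.
have : \forall k \near F, forall t, f k <> t.
  apply: filter_forall => t; have [h|//] := in_ultra_setVsetC [set k | f k = t] FU.
  by exfalso; exact: (no t).
by move=> /filter_ex[k /(_ (f k))].
Qed.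

Section Closed.
Variables (X Y Z Xh Zh U V W : finType) (p : X * Y * Z -> R).
Variables (dx : X -> Xh -> R) (dz : Z -> Zh -> R) (Dx Dz : R) (r : R * R * R).

(** Refining the tail filter to an ultrafilter replaces nested subsequences: all kernel entries
    converge along it at once. *)
Lemma region_on_limit (e : nat -> R) : e @ \oo --> 0 ->
  (forall k, region_on p dx dz U V W (Dx + e k) (Dz + e k)
     (r.1.1 + e k, r.1.2 + e k, r.2 + e k)) ->
  region_on p dx dz U V W Dx Dz r.
Proof.
move=> e0 /choice[qu /choice[qv /choice[qw /choice[xh /choice[zh H]]]]].
have [F [FU oF]] := ultraFilterLemma (@eventually_filter).
have eF : e @ F --> 0 by move=> A /e0; exact: oF.
have kb k := proj1 (H k).
have pmf01 (T : finType) (q : T -> R) t : is_pmf q -> 0 <= q t <= 1.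
  by move=> qp; rewrite pmf_le1 // andbT; case: qp.
have Hu yu : exists l : R, (fun k => qu k yu.1 yu.2) @ F --> l.
  by apply: ultra_bounded_cvg => k; apply: pmf01; case: (H k).
have {Hu}/choice[lu Hu] := Hu.
have Hv uzv : exists l : R, (fun k => qv k uzv.1.1 uzv.1.2 uzv.2) @ F --> l.
  by apply: ultra_bounded_cvg => k; apply: pmf01; case: (H k) => _ [].
have {Hv}/choice[lv Hv] := Hv.
have Hw uvxw : exists l : R, (fun k => qw k uvxw.1.1.1 uvxw.1.1.2 uvxw.1.2 uvxw.2) @ F --> l.
  by apply: ultra_bounded_cvg => k; apply: pmf01; case: (H k) => _ [_ []].
have {Hw}/choice[lw Hw] := Hw.
(* As elements of a finite type, the reconstruction functions are constant along [F]. *)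
have [xf Hx] := ultra_finite_const (fun k => [ffun t : U * W * Z => xh k t.1.1 t.1.2 t.2]) FU.
have [zf Hz] := ultra_finite_const (fun k => [ffun t : U * V * X => zh k t.1.1 t.1.2 t.2]) FU.
have lim_pmf (T : finType) (q : nat -> T -> R) (l : T -> R) :
    (forall k, is_pmf (q k)) -> (forall t, (fun k => q k t) @ F --> l t) -> is_pmf l.
  move=> qp ql; split=> [t|].
    by apply: (cvgr_to_ge (ql t)); near=> k; case: (qp k).
  have S : (fun k => \sum_t q k t) @ F --> \sum_t l t by exact: cvg_sum_fin.
  apply/eqP; rewrite eq_le; apply/andP; split; [apply: (cvgr_to_le S)|apply: (cvgr_to_ge S)];
    by near=> k; case: (qp k) => _ ->.
pose P k := aux_pmf p (qu k) (qv k) (qw k).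
pose P' := aux_pmf p (fun y u => lu (y, u)) (fun u z v => lv (u, z, v)) (fun u v x w => lw (u, v, x, w)).
have PP o : (fun k => P k o) @ F --> P' o.
  case: o => [[[[[x y] z] u] v] w]; rewrite /P /P' /=.
  apply: cvgM; [|exact: (Hw (u, v, x, w))].
  apply: cvgM; [|exact: (Hv (u, z, v))].
  by apply: cvgM; [exact: cvg_cst|exact: (Hu (y, u))].
have lim_le (f : nat -> R) (l a : R) : f @ F --> l -> (\forall k \near F, f k <= a + e k) -> l <= a.
  move=> fl fa; rewrite -[leRHS]addr0; apply: (ler_cvg_to fl _ fa).
  by apply: cvgD => //; exact: cvg_cst.
exists (fun y u => lu (y, u)), (fun u z v => lv (u, z, v)), (fun u v x w => lw (u, v, x, w)),
  (fun u w z => xf (u, w, z)), (fun u v x => zf (u, v, x)) => /=.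
split; [|split; [|split; [|split; [|split; [|split; [|split]]]]]].
- move=> y; apply: (lim_pmf _ (fun k => qu k y)) => [k|u]; first by case: (H k).
  exact: (Hu (y, u)).
- move=> u z; apply: (lim_pmf _ (fun k => qv k u z)) => [k|v]; first by case: (H k) => _ [].
  exact: (Hv (u, z, v)).
- move=> u v x; apply: (lim_pmf _ (fun k => qw k u v x)) => [k|w]; first by case: (H k) => _ [_ []].
  exact: (Hw (u, v, x, w)).
- apply: (lim_le (fun k => cmi (P k) _ _ _)); [exact: cvg_cmi|near=> k].
  by case: (H k) => _ [_ [_ []]].
- apply: (lim_le (fun k => cmi (P k) _ _ _)); [exact: cvg_cmi|near=> k].
  by case: (H k) => _ [_ [_ [_ []]]].
- apply: (lim_le (fun k => cmi (P k) _ _ _)); [exact: cvg_cmi|near=> k].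
  by case: (H k) => _ [_ [_ [_ [_ []]]]].
- apply: (lim_le (fun k => expect (P k) _)); [exact: cvg_expect|near=> k].
  case: (H k) => _ [_ [_ [_ [_ [_ [+ _]]]]]] /=; apply: le_trans.
  rewrite le_eqVlt; apply/orP; left; apply/eqP; apply: eq_bigr => o _; congr (_ * dx _ _).
  have <- : [ffun t : U * W * Z => xh k t.1.1 t.1.2 t.2] = xf by near: k.
  by rewrite ffunE.
apply: (lim_le (fun k => expect (P k) _)); [exact: cvg_expect|near=> k].
case: (H k) => _ [_ [_ [_ [_ [_ [_ +]]]]]] /=; apply: le_trans.
rewrite le_eqVlt; apply/orP; left; apply/eqP; apply: eq_bigr => o _; congr (_ * dz _ _).
have <- : [ffun t : U * V * X => zh k t.1.1 t.1.2 t.2] = zf by near: k.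
by rewrite ffunE.
Unshelve. all: by end_near.
Qed.

End Closed.
End Compactness.

(** * Converse *)

Section Converse.
Variables (R : realType) (X Y Z Xh Zh : finType) (p : X * Y * Z -> R).
Variables (dx : X -> Xh -> R) (dz : Z -> Zh -> R).
Hypothesis pp : is_pmf p.
Hypothesis mk : markov_YXZ p.
Variables (n M1 M2 M3 : nat).
Hypothesis n0 : (0 < n)%N.
Variables (f1 : {ffun 'I_n -> Y} -> 'I_M1) (f2 : {ffun 'I_n -> Z} -> 'I_M1 -> 'I_M2)
  (f3 : {ffun 'I_n -> X} -> 'I_M1 -> 'I_M2 -> 'I_M3)
  (g2 : {ffun 'I_n -> X} -> 'I_M1 -> 'I_M2 -> {ffun 'I_n -> Zh})
  (g3 : {ffun 'I_n -> Z} -> 'I_M1 -> 'I_M3 -> {ffun 'I_n -> Xh}).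

Notation Om := {ffun 'I_n -> X * Y * Z}.
Let P : Om -> R := @iid_pmf R X Y Z p n.
Let T1 (w : Om) := f1 (yseq w).
Let T2 (w : Om) := f2 (zseq w) (T1 w).
Let T3 (w : Om) := f3 (xseq w) (T1 w) (T2 w).
Let prex (k : nat) (w : Om) := mask_seq (fun j => j < k)%N (xseq w).
Let sufz (k : nat) (w : Om) := mask_seq (fun j => k <= j)%N (zseq w).
Let U (i : 'I_n) (w : Om) := (i, T1 w, prex i w, sufz i.+1 w).

Let Pp : is_pmf P := prod_pmf 'I_n pp.
Let P0 : forall w, 0 <= P w := proj1 Pp.

Lemma prex_S (i : 'I_n) w w' :
  (prex i.+1 w == prex i.+1 w') = (xseq w i == xseq w' i) && (prex i w == prex i w').
Proof. by apply: mask_seq_add => j; exact: before_S. Qed.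

Lemma sufz_S (i : 'I_n) w w' :
  (sufz i w == sufz i w') = (zseq w i == zseq w' i) && (sufz i.+1 w == sufz i.+1 w').
Proof. by apply: mask_seq_add => j; exact: from_S. Qed.

Lemma prex_SP (i : 'I_n) w w' : prex i w = prex i w' -> xseq w i = xseq w' i ->
  prex i.+1 w = prex i.+1 w'.
Proof. by move=> e1 e2; apply/eqP; rewrite prex_S e1 e2 !eqxx. Qed.

Lemma sufz_SP (i : 'I_n) w w' : sufz i.+1 w = sufz i.+1 w' -> zseq w i = zseq w' i ->
  sufz i w = sufz i w'.
Proof. by move=> e1 e2; apply/eqP; rewrite sufz_S e1 e2 !eqxx. Qed.

Lemma prex_xseq k w w' : xseq w = xseq w' -> prex k w = prex k w'.
Proof. by rewrite /prex => ->. Qed.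

Lemma sufz_zseq k w w' : zseq w = zseq w' -> sufz k w = sufz k w'.
Proof. by rewrite /sufz => ->. Qed.

Lemma sumr_telescope_ord (S : nat -> R) : \sum_(i < n) (S i.+1 - S i) = S n - S 0%N.
Proof. by rewrite -(big_mkord xpredT (fun i => S i.+1 - S i)) telescope_sumr. Qed.

Lemma ler_sub_ge0 (a b c : R) : 0 <= a -> b <= c -> b - a <= c.
Proof. by move=> a0 bc; rewrite lerBlDr (le_trans bc) // lerDl. Qed.

(** Given [(U i, X_i)] the whole x-word is independent of [Z_i], so it may join the condition. What
    varies with [i] is then only the z-suffix, and the terms are increments of [S]. *)
Lemma rate2 : \sum_i cmi P (fun w => zseq w i) T2 (fun w => (U i w, xseq w i))
  <= log2 M2%:R.
Proof.
pose S k := hcond P T2 (fun w => (T1 w, xseq w, sufz k w)).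
apply: (@le_trans _ _ (\sum_(i < n) (S i.+1 - S i))); last first.
  rewrite sumr_telescope_ord; apply: ler_sub_ge0; first exact: hcond_ge0.
  by rewrite -[in leRHS](card_ord M2); exact: hcond_le.
apply: ler_sum => i _.
have ci : cind P (fun w => zseq w i) (@xseq X Y Z n) (fun w => (U i w, xseq w i)).
  apply: (cind_swap (m := zmix i.+1)) => w w' [e1 e2 e3 e4].
  have [h1 h2 h3 h4 h5] := zmixP pp mk (prex_SP e2 e4) e3.
  split=> //; first by rewrite h4.
  by rewrite /U /T1 /prex /sufz h2 h3 h4 e4 -/(prex i w') -e2 -/(T1 w') -e1.
apply: (le_trans (cmi_add_cond _ _ ci)) => //.
rewrite cmi_hcond le_eqVlt; apply/orP; left; apply/eqP; congr (_ - _); apply: hcond_eqrel => w w'.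
  rewrite !xpair_eqE eqxx /=.
  case: (eqVneq (xseq w) (xseq w')) => [E|_]; last by rewrite !andbF.
  by rewrite (prex_xseq i E) E !eqxx !andbT.
rewrite !xpair_eqE eqxx sufz_S /=.
case: (eqVneq (xseq w) (xseq w')) => [E|_]; last by rewrite !andbF.
rewrite (prex_xseq i E) E !eqxx !andbT.
by case: (T1 w == _); case: (zseq w i == _).
Qed.

(** Now the z-word joins the condition and the x-prefix grows, so the increments have the opposite
    sign. The copy of [T2] in W costs nothing, being part of the condition. *)
Lemma rate3 : \sum_i cmi P (fun w => xseq w i) (fun w => (T2 w, T3 w))
   (fun w => (U i w, T2 w, zseq w i)) <= log2 M3%:R.
Proof.
pose S k := hcond P T3 (fun w => (T1 w, T2 w, zseq w, prex k w)).
apply: (@le_trans _ _ (- \sum_(i < n) (S i.+1 - S i))); last first.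
  rewrite sumr_telescope_ord opprB; apply: ler_sub_ge0; first exact: hcond_ge0.
  by rewrite -[in leRHS](card_ord M3); exact: hcond_le.
rewrite -sumrN; apply: ler_sum => i _; rewrite opprB.
have -> : cmi P (fun w => xseq w i) (fun w => (T2 w, T3 w)) (fun w => (U i w, T2 w, zseq w i))
   = cmi P (fun w => xseq w i) T3 (fun w => (U i w, T2 w, zseq w i)).
  apply: cmi_eqrel => // w w'; rewrite !xpair_eqE.
  by case: (T2 w == _); case: (T3 w == _); rewrite ?andbF.
have ci : cind P (fun w => xseq w i) (@zseq X Y Z n) (fun w => (U i w, T2 w, zseq w i)).
  apply: cind_sym; apply: (cind_swap (m := zmix i)) => w w' [e1 e2 e3 e4 e5].
  have [h1 h2 h3 h4 h5] := zmixP pp mk e2 (sufz_SP e3 e5).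
  split=> //; first by rewrite h2.
  rewrite /U /T2 /T1 /prex /sufz h2 h3 h4 -/(prex i w') -e2 -/(T1 w') -e1 //.
apply: (le_trans (cmi_add_cond _ _ ci)) => //.
rewrite cmi_hcond le_eqVlt; apply/orP; left; apply/eqP; congr (_ - _); apply: hcond_eqrel => w w'.
  rewrite !xpair_eqE eqxx /=.
  case: (eqVneq (zseq w) (zseq w')) => [E|_]; last by rewrite !andbF.
  rewrite (sufz_zseq i.+1 E) E !eqxx !andbT.
  by case: (T1 w == _); case: (T2 w == _); rewrite ?andbT ?andbF.
rewrite !xpair_eqE eqxx prex_S /=.
case: (eqVneq (zseq w) (zseq w')) => [E|_]; last by rewrite !andbF.
rewrite (sufz_zseq i.+1 E) E !eqxx !andbT.
by case: (T1 w == _); case: (T2 w == _); case: (xseq w i == _); rewrite ?andbT ?andbF.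
Qed.

Let prew (k : nat) (w : Om) := mask_seq (fun j => j < k)%N w.
Let offz (i : 'I_n) (w : Om) := mask_seq (fun j => j != i) (zseq w).

Lemma offz_zseq i w w' :
  (zseq w == zseq w') = (zseq w i == zseq w' i) && (offz i w == offz i w').
Proof.
rewrite -(@mask_seq_add _ _ xpredT) ?mask_seqT // => j.
by case: (j == i).
Qed.

(** Both arguments are enlarged to make the terms telescope: [Y_i] to the whole letter [w i], and
    [U i] to [T1] with all past letters and all other z-letters. The added letters are independent
    of [w i] given [Z_i]. *)
Lemma rate1 : \sum_i cmi P (fun w => yseq w i) (U i) (fun w => zseq w i) <= log2 M1%:R.
Proof.
pose S k := hcond P T1 (fun w => (prew k w, zseq w)).
apply: (@le_trans _ _ (- \sum_(i < n) (S i.+1 - S i))); last first.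
  rewrite sumr_telescope_ord opprB; apply: ler_sub_ge0; first exact: hcond_ge0.
  by rewrite -[in leRHS](card_ord M1); exact: hcond_le.
rewrite -sumrN; apply: ler_sum => i _; rewrite opprB.
pose E w := (prew i w, offz i w).
have ci : cind P (fun w : Om => w i) E (fun w => zseq w i).
  apply: (cind_swap (m := lmix i i)) => w w' e.
  split; [exact: lmix_iid|by rewrite ffunE eqxx| | |exact: lmixK].
    congr (_, _); apply/mask_seqP => j.
      by move=> ji; rewrite ffunE -val_eqE /= (ltn_eqF ji).
    by move=> /negPf ji; rewrite !ffunE ji.
  by rewrite !ffunE eqxx.
apply: (@le_trans _ _ (cmi P (fun w : Om => w i) (fun w => (T1 w, E w)) (fun w => zseq w i))).
  apply: (@le_trans _ _ (cmi P (fun w => yseq w i) (fun w => (T1 w, E w)) (fun w => zseq w i))).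
    apply: cmi_le_r => // w w' [e0 /mask_seqP e1 /mask_seqP e2]; rewrite /U e0; congr (_, _, _, _).
      by apply/mask_seqP => j ji; rewrite !ffunE e1.
    by apply/mask_seqP => j ij; apply: e2; rewrite -val_eqE /= gtn_eqF.
  by apply: cmi_le_l => // w w'; rewrite !ffunE => ->.
rewrite cmi_chain (cind_cmi0 P0 ci) add0r.
rewrite cmi_hcond le_eqVlt; apply/orP; left; apply/eqP; congr (_ - _); apply: hcond_eqrel => w w'.
  rewrite !xpair_eqE (offz_zseq i).
  by case: (zseq w i == _); case: (prew i w == _).
rewrite !xpair_eqE (offz_zseq i).
rewrite /prew (@mask_seq_add _ _ (fun j : 'I_n => j < i.+1)%N (fun j => j < i)%N i) => [|j]; last exact: before_S.
rewrite -/(prew i w) -/(prew i w').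
case: (eqVneq (w i) (w' i)) => [e|//] /=.
by rewrite !ffunE e eqxx.
Qed.


Notation Om' := ('I_n * Om)%type.
Let P' : Om' -> R := @mixture R (X * Y * Z)%type p n.
Let vX (s : Om') := xseq s.2 s.1.
Let vY (s : Om') := yseq s.2 s.1.
Let vZ (s : Om') := zseq s.2 s.1.
Let vU (s : Om') := U s.1 s.2.
Let vV (s : Om') := T2 s.2.
Let vW (s : Om') := (T2 s.2, T3 s.2).
Let P'p : is_pmf P' := mixture_pmf pp n0.

Lemma mixture_swap i i' (a b c d : Om) : P a * P b = P c * P d ->
  P' (i', a) * P' (i, b) = P' (i, c) * P' (i', d).
Proof. by move=> e; rewrite /P' /mixture /= mulrACA [RHS]mulrACA; congr (_ * _). Qed.

(** U depends on the current letter only through its Y-component inside [T1]. Exchanging the current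
    letters of two outcomes, each at its own time, leaves U unchanged if these components agree. *)
Lemma cind_U : cind P' vU (fun s => (vX s, vZ s)) vY.
Proof.
apply: cind_sym.
apply: (cind_swap (m := fun s s' : Om' => (s'.1, lmix s.1 s'.1 s.2 s'.2))) => -[i w] [i' w'].
rewrite /vY /vX /vZ /vU /U /= => e; split.
- by apply: mixture_swap; exact: lmix_iid.
- by rewrite !ffunE eqxx.
- congr (_, _, _, _).
  + congr f1; apply/ffunP => j; move: e; rewrite !ffunE.
    by case: (eqVneq j i') => [->|].
  + by apply/mask_seqP => j ji; rewrite !ffunE -val_eqE /= (ltn_eqF ji).
  + by apply/mask_seqP => j ij; rewrite !ffunE -val_eqE /= (gtn_eqF ij).
- by rewrite !ffunE eqxx.
by rewrite lmixK.
Qed.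

(** The cut lies before the current letter, whose z-component is in the condition: [T2] follows the
    z-word and the current pair follows the other outcome. *)
Lemma cind_V : cind P' vV (fun s => (vX s, vY s)) (fun s => (vU s, vZ s)).
Proof.
apply: (cind_swap (m := fun s s' : Om' => (s'.1, zmix s'.1 s.2 s'.2))) => -[i w] [i' w'].
rewrite /vU /vV /vX /vY /vZ /U /= => -[ei e1 e2 e3]; subst i' => e4.
have [h1 h2 h3 h4 h5] := zmixP pp mk e2 (sufz_SP e3 e4).
have E1 : T1 (zmix i w w') = T1 w by rewrite e1 /T1 h3.
split; [exact: mixture_swap|by rewrite /T2 E1 h4|by rewrite h2 h3| |by rewrite h5].
by rewrite E1 /prex /sufz h2 h4 -/(prex i w') -e2.
Qed.

(** The cut lies after the current letter, whose x-component is in the condition; [T3] follows the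
    x-word, since both messages it reads are fixed. *)
Lemma cind_W : cind P' vW vZ (fun s => (vU s, vV s, vX s)).
Proof.
apply: cind_sym; apply: (cind_swap (m := fun s s' : Om' => (s'.1, zmix s'.1.+1 s.2 s'.2))) => -[i w] [i' w'].
rewrite /vU /vV /vX /vW /vZ /U /= => -[ei e1 e2 e3]; subst i' => e4 e5.
have [h1 h2 h3 h4 h5] := zmixP pp mk (prex_SP e2 e5) e3.
have E1 : T1 (zmix i.+1 w w') = T1 w by rewrite e1 /T1 h3.
have E2 : T2 (zmix i.+1 w w') = T2 w by rewrite /T2 E1 h4.
split; [exact: mixture_swap|by rewrite h4|by rewrite E2 /T3 E1 E2 h2 e4 e1| |by rewrite h5].
by rewrite E1 E2 /prex /sufz h2 h4 -/(prex i w') -e2 e5.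
Qed.

(** The code reconstructs from the complete z-word; this lets [reconstruct] replace it by the
    current [Z]. *)
Lemma cind_reconX : cind P' (fun s => zseq s.2) vX (fun s => (vU s, vW s, vZ s)).
Proof.
apply: (cind_swap (m := fun s s' : Om' => (s'.1, zmix s'.1 s.2 s'.2))) => -[i w] [i' w'].
rewrite /vU /vV /vX /vW /vZ /U /= => -[ei e1 e2 e3]; subst i' => e4 e5 e6.
have [h1 h2 h3 h4 h5] := zmixP pp mk e2 (sufz_SP e3 e6).
have E1 : T1 (zmix i w w') = T1 w by rewrite e1 /T1 h3.
have E2 : T2 (zmix i w w') = T2 w by rewrite /T2 E1 h4.
have E3 : T3 (zmix i w w') = T3 w.
  by rewrite e5 /T3 E1 E2 h2 e4 e1.
split; [exact: mixture_swap|by rewrite h4|by rewrite h2| |by rewrite h5].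
by rewrite E1 E2 E3 /prex /sufz h2 h4 -/(prex i w') -e2.
Qed.

Lemma cind_reconZ : cind P' (fun s => xseq s.2) vZ (fun s => (vU s, vV s, vX s)).
Proof.
apply: cind_sym; apply: (cind_swap (m := fun s s' : Om' => (s'.1, zmix s'.1.+1 s.2 s'.2))) => -[i w] [i' w'].
rewrite /vU /vV /vX /vW /vZ /U /= => -[ei e1 e2 e3]; subst i' => e4 e5.
have [h1 h2 h3 h4 h5] := zmixP pp mk (prex_SP e2 e5) e3.
have E1 : T1 (zmix i.+1 w w') = T1 w by rewrite e1 /T1 h3.
have E2 : T2 (zmix i.+1 w w') = T2 w by rewrite /T2 E1 h4.
split; [exact: mixture_swap|by rewrite h4|by rewrite h2| |by rewrite h5].
by rewrite E1 E2 /prex /sufz h2 h4 -/(prex i w') -e2 e5.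
Qed.

Lemma letter_seq (w : Om) i : (xseq w i, yseq w i, zseq w i) = w i.
Proof. by rewrite !ffunE; case: (w i) => [[]]. Qed.

Lemma mixture_law t : pushpmf P' (fun s => (vX s, vY s, vZ s)) t = p t.
Proof.
rewrite -(push_mixture_letter pp n0 t); apply: eq_bigl => s.
by rewrite /vX /vY /vZ letter_seq.
Qed.

Lemma mixture_dist (A B : finType) (d : A -> B -> R) (a : Om -> {ffun 'I_n -> A})
    (b : Om -> {ffun 'I_n -> B}) :
  expect P (fun w => avg_dist d (a w) (b w)) = expect P' (fun s => d (a s.2 s.1) (b s.2 s.1)).
Proof.
rewrite /expect (mixture_sum p (fun s => d (a s.2 s.1) (b s.2 s.1))) /avg_dist.
rewrite exchange_big /= mulr_sumr; apply: eq_bigr => w _.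
by rewrite mulrCA mulr_sumr.
Qed.

Lemma mixture_rate (c : 'I_n -> R) (M : nat) (r : R) : (0 < M)%N ->
  \sum_i c i <= log2 M%:R -> M%:R <= 2 `^ (n%:R * r) -> n%:R^-1 * \sum_i c i <= r.
Proof.
move=> M0 cM Mr; rewrite mulrC ler_pdivrMr ?ltr0n // mulrC; apply: (le_trans cM).
by rewrite -[leRHS]log2_pow2 ler_log2 // ltr0n.
Qed.

Lemma code_region (Dx Dz : R) (r : R * R * R) :
  M1%:R <= 2 `^ (n%:R * r.1.1) -> M2%:R <= 2 `^ (n%:R * r.1.2) -> M3%:R <= 2 `^ (n%:R * r.2) ->
  expect P (fun w => avg_dist dx (xseq w) (g3 (zseq w) (T1 w) (T3 w))) <= Dx ->
  expect P (fun w => avg_dist dz (zseq w) (g2 (xseq w) (T1 w) (T2 w))) <= Dz ->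
  region p dx dz Dx Dz r.
Proof.
move=> b1 b2 b3; rewrite !mixture_dist => hx hz.
have [w0 _] := pmf_inhabited Pp.
have M10 : (0 < M1)%N by apply: leq_ltn_trans (ltn_ord (T1 w0)).
have M20 : (0 < M2)%N by apply: leq_ltn_trans (ltn_ord (T2 w0)).
have M30 : (0 < M3)%N by apply: leq_ltn_trans (ltn_ord (T3 w0)).
have [xh Hxh] : exists xh : _ -> Xh, expect P' (fun s => dx (vX s) (xh (vU s, vW s, vZ s)))
    <= expect P' (fun s => dx (vX s) (g3 (zseq s.2) (T1 s.2) (T3 s.2) s.1)).
  apply: reconstruct cind_reconX => // -[i w] [i' w'] /=.
  by rewrite /vU /vW /U /= => -[-> -> _ _ _ -> _] ->.
have [zh Hzh] : exists zh : _ -> Zh, expect P' (fun s => dz (vZ s) (zh (vU s, vV s, vX s)))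
    <= expect P' (fun s => dz (vZ s) (g2 (xseq s.2) (T1 s.2) (T2 s.2) s.1)).
  apply: reconstruct cind_reconZ => // -[i w] [i' w'] /=.
  by rewrite /vU /vV /U /= => -[-> -> _ _ -> _] ->.
apply: (@region_intro _ _ _ _ _ _ _ _ _ _ _ _ _ _ _ _ P' vX vY vZ vU vV vW
  (fun u w z => xh (u, w, z)) (fun u v x => zh (u, v, x))) => //.
- exact: mixture_law.
- exact: cind_U.
- exact: cind_V.
- exact: cind_W.
(* The condition [Z] does not reveal the time index, so the first rate needs the letter version of
   the mixture formula. *)
- have -> : cmi P' vY vU vZ = n%:R^-1 * \sum_i cmi P (fun w => yseq w i) (U i) (fun w => zseq w i).
    transitivity (cmi P' (fun s => (s.2 s.1).1.2) vU (fun s => (s.2 s.1).2)).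
      by apply: cmi_eqrel => s s'; rewrite /vY /vZ !ffunE.
    rewrite (cmi_mixture_letter pp n0 (fun a => a.1.2) (fun a => a.2)); last by move=> [i w] [i' w'] [].
    congr (_ * _); apply: eq_bigr => i _.
    by apply: cmi_eqrel => w w'; rewrite !ffunE.
  exact: (mixture_rate M10 rate1).
- rewrite /P' cmi_mixture //; first exact: (mixture_rate M20 rate2).
  by move=> [i w] [i' w'] [].
- rewrite /P' cmi_mixture //; first exact: (mixture_rate M30 rate3).
  by move=> [i w] [i' w'] [].
- exact: le_trans Hxh hx.
exact: le_trans Hzh hz.
Qed.

End Converse.

(** * Closure and the equality of the two regions *)

Section Main.
Variables (R : realType) (X Y Z Xh Zh : finType) (p : X * Y * Z -> R).
Variables (dx : X -> Xh -> R) (dz : Z -> Zh -> R).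
Hypothesis pp : is_pmf p.
Hypothesis mk : markov_YXZ p.

Lemma achievable_region (Dx Dz e : R) r : 0 < e -> achievable p dx dz Dx Dz r ->
  region p dx dz (Dx + e) (Dz + e) r.
Proof.
(* Block length [N.+1] is positive, as the converse requires. *)
move=> e0 /(_ e e0)[N /(_ N.+1 (leqnSn N))[M1 [M2 [M3 [b1 b2 b3]]]]].
by case=> f1 [f2 [f3 [g2 [g3 /= [h1 h2]]]]]; exact: (code_region pp mk _ b1 b2 b3 h1 h2).
Qed.

Lemma region_mono (Dx Dz Dx' Dz' : R) r r' :
  Dx <= Dx' -> Dz <= Dz' -> r.1.1 <= r'.1.1 -> r.1.2 <= r'.1.2 -> r.2 <= r'.2 ->
  region p dx dz Dx Dz r -> region p dx dz Dx' Dz' r'.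
Proof.
move=> hx hz h1 h2 h3 [U [V [W [qu [qv [qw [xh [zh /= [qup [qvp [qwp [r1 [r2 [r3 [d1 d2]]]]]]]]]]]]]]].
exists U, V, W, qu, qv, qw, xh, zh => /=; do 3 split=> //.
split; [exact: le_trans h1|split; [exact: le_trans h2|split; [exact: le_trans h3|]]].
by split; [exact: le_trans hx|exact: le_trans hz].
Qed.

(** The approximants have slack [e k] in the rates from the closure and in the distortions from
    achievability; the cardinality bound puts them all on the same alphabets. *)
Lemma RO_sub_region (Dx Dz : R) r : RO p dx dz Dx Dz r -> region p dx dz Dx Dz r.
Proof.
move=> Hr; pose e (k : nat) : R := k.+1%:R^-1.
have e0 k : 0 < e k by rewrite invr_gt0 ltr0n.
have [qu [qv [qw [xh [zh H]]]]] :
   region_on p dx dz 'I_#|{: Y + option (bool * bool)}| 'I_#|{: Z + bool * bool}|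
    ('I_#|{: Z + bool * bool}| * 'I_#|{: X + bool}|)%type Dx Dz r.
  apply: (@region_on_limit _ _ _ _ _ _ _ _ _ _ _ _ _ _ _ e); first exact: cvg_harmonic.
  move=> k; apply: region_cardinality => //.
  have [r' [ar' br']] := Hr _ (nbhsx_ballx r _ (e0 k)).
  have rr (a b : R) : ball a (e k) b -> b <= a + e k.
    by rewrite /ball /= ltr_distlC => /andP[_ /ltW].
  case: br' => -[/rr l1 /rr l2] /rr l3.
  by apply: (@region_mono (Dx + e k) (Dz + e k) _ _ r') => //; exact: achievable_region.
by exists _, _, _, qu, qv, qw, xh, zh.
Qed.

End Main.

Theorem theorem1 (R : realType) (X Y Z Xh Zh : finType)
  (p : X * Y * Z -> R) (dx : X -> Xh -> R) (dz : Z -> Zh -> R) (Dx Dz : R) :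
  is_pmf p -> markov_YXZ p ->
  (forall x xh, 0 <= dx x xh) -> (forall z zh, 0 <= dz z zh) ->
  RO p dx dz Dx Dz = region p dx dz Dx Dz.
Proof.
move=> pp mk dx0 dz0; apply/seteqP; split=> r; first exact: RO_sub_region.
exact: region_sub_RO.
Qed.
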